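(* Let $d \ge 1$. Assume $f$ is a tempered distribution on $\mathbb{R}^d$, $\psi$ is a Schwartz function on $\mathbb{R}^d$, and $$\langle f, \psi_{s,t} \rangle = 0 \qquad \text{for all } s>0,\ t \in \mathbb{R}^d .$$ If $\widehat{\psi}$ is nontrivial in every direction, then $f$ is a polynomial.
   Context: Functions are complex-valued on $\mathbb{R}^d$. For $s>0$ and $t \in \mathbb{R}^d$, $\psi_{s,t}(x) = s^{-d/2}\, \psi\big(\frac{x-t}{s}\big)$. For a tempered distribution $f$, $\langle f, \psi_{s,t}\rangle = f[\,\overline{\psi_{s,t}}\,]$, i.e. $f$ applied to the Schwartz function $\overline{\psi_{s,t}}$; when $f$ is a function this is $\int_{\mathbb{R}^d} f(x)\, \overline{\psi_{s,t}(x)}\, dx$. The Fourier transform is normalized by $\widehat{\psi}(\omega) = \int_{\mathbb{R}^d} \psi(x) e^{-2\pi i \omega\cdot x}\, dx$. A function $\lambda$ is nontrivial in direction $\xi$, where $\xi$ is a unit vector in $\mathbb{R}^d$, if the set $\{ r>0 : \lambda(r\xi) \neq 0\}$ has positive measure (for $\lambda$ continuous this means $\lambda(r\xi)\ne 0$ for some $r>0$). ''Nontrivial in every direction'' means nontrivial in direction $\xi$ for every unit vector $\xi$. ''$f$ is a polynomial'' means that there is a polynomial $P$ in $x=(x_1,\dots,x_d)$ with complex coefficients such that $f[\eta] = \int_{\mathbb{R}^d} P(x)\eta(x)\, dx$ for all Schwartz functions $\eta$. *)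

(* Defs.v *)
From HB Require Import structures.
From mathcomp Require Import all_boot all_order all_algebra complex.
From mathcomp Require mpoly.
From mathcomp Require Import all_classical all_reals all_analysis.

Set Implicit Arguments.
Unset Strict Implicit.
Unset Printing Implicit Defensive.

Import Order.TTheory GRing.Theory Num.Theory.
Import numFieldNormedType.Exports.

Local Open Scope classical_set_scope.
Local Open Scope ring_scope.
Local Open Scope complex_scope.

Section lebesgue_tuple_step.
Variables (R : realType) (d : nat).
Variable mu : {sigma_finite_measure set (d.-tuple R) -> \bar R}.

Definition cons_pair (p : R * d.-tuple R) : d.+1.-tuple R :=
  [the d.+1.-tuple R of p.1 :: p.2].

Lemma measurable_cons_pair : measurable_fun [set: R * d.-tuple R] cons_pair.
Proof. exact: measurable_cons. Qed.

Definition lebesgue_step : set (d.+1.-tuple R) -> \bar R :=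
  pushforward (@lebesgue_measure R \x mu)%E cons_pair.

Let lebesgue_step0 : lebesgue_step set0 = 0%E.
Proof. by rewrite /lebesgue_step /pushforward preimage_set0 measure0. Qed.

Let lebesgue_step_ge0 A : (0 <= lebesgue_step A)%E.
Proof. by apply: integral_ge0 => x _; exact: measure_ge0. Qed.

Let lebesgue_step_sigma_additive : semi_sigma_additive lebesgue_step.
Proof.
by apply: measure_semi_sigma_additive; exact: measurable_cons_pair.
Qed.

HB.instance Definition _ := isMeasure.Build _ _ _ lebesgue_step
  lebesgue_step0 lebesgue_step_ge0 lebesgue_step_sigma_additive.

Let uncons (t : d.+1.-tuple R) : R * d.-tuple R :=
  (thead t, [tuple of behead t]).

Let measurable_uncons : measurable_fun [set: d.+1.-tuple R] uncons.
Proof.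
apply/measurable_fun_pair => /=.
  exact: (measurable_tnth ord0).
exact: measurable_behead.
Qed.

Let cons_pairK : cancel cons_pair uncons.
Proof.
by case=> x t; rewrite /uncons /cons_pair/= theadE; congr pair; exact/val_inj.
Qed.

Let lebesgue_step_sigma_finite : sigma_finite setT lebesgue_step.
Proof.
have /sigma_finiteP[F [TF ndF Foo]] := sigma_finiteT (@lebesgue_measure R).
have /sigma_finiteP[G [TG ndG Goo]] := sigma_finiteT mu.
exists (fun n => uncons @^-1` (F n `*` G n)).
  rewrite -preimage_bigcup (_ : \bigcup_i _ = setT) ?preimage_setT//.
  apply/seteqP; split => // -[x y] _.
  have [n _ Fnx] : (\bigcup_i F i) x by rewrite -TF.
  have [k _ Gky] : (\bigcup_i G i) y by rewrite -TG.
  exists (maxn n k) => //; split => /=.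
  - by move: x Fnx; exact/subsetPset/ndF/leq_maxl.
  - by move: y Gky; exact/subsetPset/ndG/leq_maxr.
move=> n; have [mF Fn] := Foo n; have [mG Gn] := Goo n; split.
  by rewrite -[X in measurable X]setTI; apply: measurable_uncons => //;
    exact: measurableX.
rewrite /lebesgue_step /pushforward -comp_preimage.
rewrite (_ : uncons \o cons_pair = id); last first.
  by apply/funext => p /=; rewrite cons_pairK.
by rewrite preimage_id product_measure1E// lte_mul_pinfty// ge0_fin_numE.
Qed.

HB.instance Definition _ := Measure_isSigmaFinite.Build _ _ _ lebesgue_step
  lebesgue_step_sigma_finite.

End lebesgue_tuple_step.

(* Lebesgue measure on R^d (carried by the Borel sigma-algebra of d.-tuple R),
   the d-fold product of the one-dimensional Lebesgue measure.  In dimension 0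
   it is the unit mass on the single point. *)
Fixpoint lebesgue_tuple (R : realType) (d : nat) :
    {sigma_finite_measure set (d.-tuple R) -> \bar R} :=
  match d with
  | 0%N => @dirac _ (0.-tuple R) [tuple] R
  | d'.+1 => lebesgue_step (lebesgue_tuple R d')
  end.

Lemma lebesgue_tuple_box (R : realType) (d : nat) (a b : 'I_d -> R) :
  (forall i, a i <= b i) ->
  lebesgue_tuple R d
    [set t | forall i, a i <= tnth t i <= b i] = (\prod_(i < d) (b i - a i))%:E.
Proof.
elim: d a b => [|d IH] a b ab.
  by rewrite big_ord0 /= diracE mem_set//; case.
rewrite big_ord_recl EFinM /= /lebesgue_step /pushforward.
pose B : set (d.-tuple R) :=
  [set t | forall i, a (lift ord0 i) <= tnth t i <= b (lift ord0 i)].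
rewrite (_ : _ @^-1` _ = `[a ord0, b ord0] `*` B); last first.
  apply/seteqP; split => -[x t] /=.
    move=> H; split => /=; first by have := H ord0; rewrite in_itv /= tnth0.
    by move=> i; have := H (lift ord0 i); rewrite tnthS.
  move=> [/= + H] i; rewrite in_itv /= => xab.
  by case: (unliftP ord0 i) => [j ->|->]; rewrite ?tnthS ?tnth0//; exact: H.
have mB : measurable B.
  rewrite (_ : B = \bigcap_(i in [set: 'I_d])
    ((@tnth _ R ^~ i) @^-1` `[a (lift ord0 i), b (lift ord0 i)])).
    apply: fin_bigcap_measurable => // i _.
    by rewrite -[X in measurable X]setTI; exact: measurable_tnth.
  apply/seteqP; split => t H i => [_|]; first by rewrite /= in_itv/=; exact: H.
  by have := H i Logic.I; rewrite /= in_itv.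
rewrite product_measure1E// (IH (a \o lift ord0) (b \o lift ord0))//.
  congr (_ * _)%E; rewrite [LHS]lebesgue_measure_itv/= lte_fin lt_neqAle ab.
  by rewrite andbT -EFinD; case: eqVneq => //= ->; rewrite subrr.
by move=> i; exact: ab.
Qed.

(* In this section g is real-valued, f, psi and eta are complex-valued, and
   T is a functional.  Functionals are total on all functions R^d -> C; only
   their values on Schwartz functions are ever constrained or used. *)
Section schwartz.
Variables (R : realType) (d : nat).
Implicit Types (g : 'rV[R]_d -> R) (f eta psi : 'rV[R]_d -> R[i]).
Implicit Types (T : ('rV[R]_d -> R[i]) -> R[i]).

(* iter_partial [:: i1; ...; ik] g = d_i1 ... d_ik g *)
Definition iter_partial (s : seq 'I_d) g : 'rV[R]_d -> R :=
  foldr (fun i h => fun x => 'D_(delta_mx 0 i) h x) g s.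

(* C^oo: all iterated partial derivatives, in any order, exist and are
   continuous. *)
Definition smooth g : Prop :=
  forall s : seq 'I_d, continuous (iter_partial s g) /\
    forall (i : 'I_d) (x : 'rV[R]_d),
      derivable (iter_partial s g) x (delta_mx 0 i).

(* R[i] carries no normed R-module structure in the libraries used, so
   derivatives and integrals of complex-valued functions of real variables are
   taken on the real and imaginary parts. *)
Definition csmooth f : Prop :=
  smooth (fun x => complex.Re (f x)) /\ smooth (fun x => complex.Im (f x)).

Definition iter_cpartial (s : seq 'I_d) f : 'rV[R]_d -> R[i] := fun x =>
  iter_partial s (fun y => complex.Re (f y)) x +i*
  iter_partial s (fun y => complex.Im (f y)) x.

Definition cintegral f : R[i] :=
  (\int[lebesgue_tuple R d]_t complex.Re (f (\row_i tnth t i))) +i*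
  (\int[lebesgue_tuple R d]_t complex.Im (f (\row_i tnth t i))).

(* sup_x |x^a D^s f(x)|, for a multi-index a of powers and a list s of
   directions of differentiation *)
Definition schwartz_seminorm (a : {ffun 'I_d -> nat}) (s : seq 'I_d) f :
    \bar R :=
  ereal_sup (range (fun x : 'rV[R]_d =>
    (ComplexField.Normc.normc
       ((\prod_(i < d) x 0 i ^+ a i)%:C * iter_cpartial s f x))%:E)).

Definition schwartz : set ('rV[R]_d -> R[i]) :=
  [set f | csmooth f /\ forall a s, (schwartz_seminorm a s f < +oo)%E].

Definition schwartz_linear T : Prop :=
  forall (c : R[i]) f1 f2, schwartz f1 -> schwartz f2 ->
    T (fun x => c * f1 x + f2 x) = c * T f1 + T f2.

(* Continuity for the locally convex topology of the Schwartz space: the sets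
   of Schwartz functions f with p (f - f0) < r for all p in a finite family K of
   seminorms form a basis of neighbourhoods of f0. *)
Definition schwartz_continuous T : Prop :=
  forall f0, schwartz f0 -> forall e : R, 0 < e ->
    exists (K : seq ({ffun 'I_d -> nat} * seq 'I_d)) (r : R), 0 < r /\
      forall f, schwartz f ->
        (forall k, k \in K ->
           (schwartz_seminorm k.1 k.2 (fun x => f x - f0 x)%R < r%:E)%E) ->
        ComplexField.Normc.normc (T f - T f0) < e.

Definition tempered_distribution T : Prop :=
  schwartz_linear T /\ schwartz_continuous T.

Definition pairing T f : R[i] := T (fun x => conjc (f x)).

Definition dilate_translate psi (s : R) (t : 'rV[R]_d) : 'rV[R]_d -> R[i] :=
  fun x => (s `^ (- (d%:R / 2)))%:C * psi (s^-1 *: (x - t)).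

Definition dot (x y : 'rV[R]_d) : R := \sum_(i < d) x 0 i * y 0 i.

Definition expi (theta : R) : R[i] := cos theta +i* sin theta.

Definition fourier psi : 'rV[R]_d -> R[i] := fun w =>
  cintegral (fun x => psi x * expi (- (2 * pi * dot w x))).

Definition nontrivial_in_direction f (xi : 'rV[R]_d) : Prop :=
  (0 < @lebesgue_measure R [set r : R | (0 < r)%R /\ (f (r *: xi) != 0)%R])%E.

(* Unit vectors are Euclidean: the library norm on 'rV is the sup norm. *)
Definition nontrivial_in_every_direction f : Prop :=
  forall xi : 'rV[R]_d, dot xi xi = 1 -> nontrivial_in_direction f xi.

Definition is_polynomial T : Prop :=
  exists P : mpoly.mpoly d R[i], forall eta, schwartz eta ->
    T eta = cintegral (fun x =>
      mpoly.meval (fun i => (x 0 i)%:C) P * eta x).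

End schwartz.

(* Main.v *)
(* The span of the translates of the dilates of conj psi lies in the kernel of
   f, and by Riemann sums so do their convolutions with Schwartz functions.  On
   the Fourier side f vanishes on the Fourier transforms of u * theta, where
   theta is Schwartz and u(w) is, up to a positive factor, the conjugate of the
   Fourier transform of psi at a dilate of w.  Nontriviality in every direction
   says that these u have no common zero outside the origin, so on a compact
   annulus finitely many of them suffice, and f kills the Fourier transform of
   every Schwartz function supported in an annulus.  As f has finite order,
   cutting off near 0 and near infinity extends this to the Fourier transforms
   of all Schwartz functions that are flat enough at 0 (the Fourier transform
   of f is supported at the origin).  By Fourier inversion f vanishes on the
   common kernel of finitely many moments eta |-> \int x^a eta, hence is a linear
   combination of them. *)

Require Import Defs.
From mathcomp Require Import all_boot all_order all_algebra complex.
From mathcomp Require Import all_classical all_reals all_analysis measurable_realfun.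
From mathcomp Require Import ring lra zify.
From mathcomp Require Import -(notations) mpoly.
Import Order.TTheory GRing.Theory Num.Theory.
Import numFieldNormedType.Exports.
Set Implicit Arguments.
Unset Strict Implicit.
Unset Printing Implicit Defensive.
Local Open Scope classical_set_scope.
Local Open Scope ring_scope.
Local Open Scope complex_scope.

(** Two quantitative notions carry the argument. [sb m f b] bounds by one number all weighted
    derivatives of order at most [m]. A tempered distribution is controlled by a single such order,
    fixed before any approximation is chosen, so it kills a function as soon as this function is
    approximated in that order by functions already killed. [cdom f C] is domination by a fixed
    integrable weight and reduces statements on integrals to pointwise estimates. The Fourier
    transform of [f] is never formed; its action on [h] is [f (fourier h)]. A cutoff near 0 at scale
    [l] has derivatives of size [l^-1 ^+ m]. This is why [h] must vanish at 0 to order about [2 m]: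
    its derivatives of order [m] are then still of size [l ^+ m.+1]. The inversion constant is not
    evaluated. Comparing two Schwartz functions in the multiplication formula gives
    [fourier (fourier h) x = c * h (- x)] with the same [c] for all [h], and [c] is nonzero because
    [fourier psi] is nonzero somewhere. For that a direction must exist, hence dimension at least
    1. *)

Local Notation normc := ComplexField.Normc.normc.

(** * Smooth functions *)

Section partial_derivatives.
Variables (R : realType) (d : nat).
Implicit Types (g : 'rV[R]_d -> R) (x y : 'rV[R]_d).

Definition dir (i : 'I_d) : 'rV[R]_d := delta_mx 0 i.

(** Both difference quotients are the same function of [h], so the chain rule and the mean value
    theorem of one real variable apply along lines. *)
Lemma is_derive_line g x v l :
  is_derive x v g l <-> is_derive (0 : R) (1 : R) (fun h : R => g (h *: v + x)) l.
Proof.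
have e : (fun h : R => h^-1 *: ((fun h0 : R => g (h0 *: v + x)) (h *: 1 + 0) - g (0 *: v + x)))
   = (fun h : R => h^-1 *: (g (h *: v + x) - g x)).
  by apply/funext => h; rewrite scaler1 addr0 scale0r add0r.
split => -[H1 H2]; split.
- by rewrite /derivable e.
- by rewrite /derive e.
- by move: H1; rewrite /derivable e.
- by move: H2; rewrite /derive e.
Qed.

Lemma is_derive_line_at g x v l (t : R) :
  is_derive (t *: v + x) v g l -> is_derive t (1 : R) (fun h : R => g (h *: v + x)) l.
Proof.
move=> /is_derive_line H.
have e : (fun h : R => h^-1 *: ((fun h0 : R => g (h0 *: v + x)) (h *: 1 + t) - g (t *: v + x)))
   = (fun h : R => h^-1 *: (g (h *: v + (t *: v + x)) - g (t *: v + x))).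
  by apply/funext => h; rewrite scaler1 scalerDl addrA.
have e' : (fun h : R => h^-1 *: ((fun h0 : R => g (h0 *: v + (t *: v + x))) (h *: 1 + 0) - g (0 *: v + (t *: v + x))))
   = (fun h : R => h^-1 *: (g (h *: v + (t *: v + x)) - g (t *: v + x))).
  by apply/funext => h; rewrite scaler1 addr0 scale0r add0r.
case: H => H1 H2; split.
- by rewrite /derivable e; move: H1; rewrite /derivable e'.
- by rewrite /derive e; move: H2; rewrite /derive e'.
Qed.

(** [smooth] speaks of all orders at once and offers no induction. Here the derivative taken first
    is peeled off, which is the last entry of the list in [iter_partial]; closure properties then
    follow by induction on [n]. *)
Fixpoint Cn n g : Prop := if n is n'.+1 then
  [/\ continuous g, forall i x, derivable g x (dir i) &
      forall i, Cn n' (fun x => 'D_(dir i) g x)] else continuous g.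

Lemma CnS n g : Cn n.+1 g -> Cn n g.
Proof.
elim: n g => [|n IH] g; first by case.
by move=> [c dg Cg]; split=> // i; apply: IH; exact: Cg.
Qed.

Lemma Cn_cont n g : Cn n g -> continuous g.
Proof. by case: n => //= n []. Qed.

Lemma iter_partial_rcons s i g :
  iter_partial (rcons s i) g = iter_partial s (fun x => 'D_(dir i) g x).
Proof. by rewrite /iter_partial foldr_rcons. Qed.

Lemma smoothP g : smooth g <-> forall n, Cn n g.
Proof.
split=> [sg n|H s].
  elim: n g sg => [|n IH] g sg; first exact: (sg [::]).1.
  split=> [|i x|i]; [by case: (sg [::])|by case: (sg [::])|].
  by apply: IH => s; rewrite -iter_partial_rcons; exact: sg.
elim/last_ind: s g H => [|s i IH] g H.
  by split; [exact: H 0%N|move=> i x; case: (H 1%N)].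
by rewrite iter_partial_rcons; apply: IH => n; case: (H n.+1) => _ _; exact.
Qed.

Lemma smooth_cont g : smooth g -> continuous g.
Proof. by move=> /smoothP/(_ 0%N). Qed.

Lemma smooth_derivable g i x : smooth g -> derivable g x (dir i).
Proof. by move=> /smoothP/(_ 1%N)[]. Qed.

Lemma smooth_D g i : smooth g -> smooth (fun x => 'D_(dir i) g x).
Proof. by move=> sg s; rewrite -iter_partial_rcons; exact: sg. Qed.

Lemma smooth_is_derive g i x : smooth g -> is_derive x (dir i) g ('D_(dir i) g x).
Proof. by move=> sg; apply: derivableP; exact: smooth_derivable. Qed.

Lemma smooth_iter_partial g s : smooth g -> smooth (iter_partial s g).
Proof.
elim/last_ind: s g => // s i IH g sg.
by rewrite iter_partial_rcons; apply: IH; exact: smooth_D.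
Qed.

Lemma Cn_cst n (c : R) : Cn n (fun _ => c).
Proof.
elim: n c => [|n IH] c; first exact: cst_continuous.
split; [exact: cst_continuous|by move=> i x; exact: derivable_cst|].
move=> i; rewrite (_ : 'D_(dir i) _ = fun _ => 0); first exact: IH.
by apply/funext => x; exact: derive_cst.
Qed.

Lemma CnD n g1 g2 : Cn n g1 -> Cn n g2 -> Cn n (fun x => g1 x + g2 x).
Proof.
elim: n g1 g2 => [|n IH] g1 g2.
  by move=> c1 c2 x; exact: (cvgD (c1 x) (c2 x)).
move=> [c1 d1 C1] [c2 d2 C2]; split.
- by move=> x; exact: (cvgD (c1 x) (c2 x)).
- by move=> i x; apply: derivableD; [exact: d1|exact: d2].
move=> i; rewrite (_ : 'D_(dir i) _ = fun x => 'D_(dir i) g1 x + 'D_(dir i) g2 x).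
  exact: IH (C1 i) (C2 i).
by apply/funext => x; apply: deriveD; [exact: d1|exact: d2].
Qed.

Lemma CnM n g1 g2 : Cn n g1 -> Cn n g2 -> Cn n (fun x => g1 x * g2 x).
Proof.
elim: n g1 g2 => [|n IH] g1 g2.
  by move=> c1 c2 x; exact: (cvgM (c1 x) (c2 x)).
move=> C1' C2'; have [c1 d1 C1] := C1'; have [c2 d2 C2] := C2'; split.
- by move=> x; exact: (cvgM (c1 x) (c2 x)).
- by move=> i x; apply: derivableM; [exact: d1|exact: d2].
move=> i; rewrite (_ : 'D_(dir i) _ = fun x => g1 x * 'D_(dir i) g2 x + g2 x * 'D_(dir i) g1 x).
  exact: CnD (IH _ _ (CnS C1') (C2 i)) (IH _ _ (CnS C2') (C1 i)).
by apply/funext => x; apply: deriveM; [exact: d1|exact: d2].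
Qed.

(** The derivative is a product of [1 / g], twice, and a derivative of [g], all covered at one order
    less. *)
Lemma CnV n g : (forall x, g x != 0) -> Cn n g -> Cn n (fun x => (g x)^-1).
Proof.
move=> g0; elim: n => [|n IH].
  by move=> cg x; exact: (cvgV (g0 x) (cg x)).
move=> C; have [c dg Cg] := C; split.
- by move=> x; exact: (cvgV (g0 x) (c x)).
- by move=> i x; apply: derivableV => //; exact: dg.
move=> i; rewrite (_ : 'D_(dir i) _ = fun x => (-1 * ((g x)^-1 * (g x)^-1)) * 'D_(dir i) g x).
  apply: CnM (Cg i); apply: CnM; first exact: Cn_cst.
  exact: CnM (IH (CnS C)) (IH (CnS C)).
apply/funext => x; rewrite -[LHS]/('D_(dir i) (fun y => (g y)^-1) x).
by rewrite (deriveV (g0 x) (dg i x)) /GRing.scale /= expr2 invfM mulN1r.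
Qed.

Lemma smooth_cst (c : R) : smooth (fun _ : 'rV[R]_d => c).
Proof. by apply/smoothP => n; exact: Cn_cst. Qed.

Lemma smoothD g1 g2 : smooth g1 -> smooth g2 -> smooth (fun x => g1 x + g2 x).
Proof. by move=> /smoothP s1 /smoothP s2; apply/smoothP => n; exact: CnD. Qed.

Lemma smoothM g1 g2 : smooth g1 -> smooth g2 -> smooth (fun x => g1 x * g2 x).
Proof. by move=> /smoothP s1 /smoothP s2; apply/smoothP => n; exact: CnM. Qed.

Lemma smoothN g : smooth g -> smooth (fun x => - g x).
Proof.
move=> sg; rewrite (_ : (fun x => _) = fun x => -1 * g x).
  by apply: smoothM => //; exact: smooth_cst.
by apply/funext => x; rewrite mulN1r.
Qed.

Lemma smoothV g : (forall x, g x != 0) -> smooth g -> smooth (fun x => (g x)^-1).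
Proof. by move=> g0 /smoothP s; apply/smoothP => n; exact: CnV. Qed.

Lemma is_derive_coord (x v : 'rV[R]_d) i : is_derive x v (fun y => y 0 i) (v 0 i).
Proof.
apply/is_derive_line.
rewrite (_ : (fun h : R => _) = v 0 i *: (@id R) + cst (x 0 i)); last first.
  by apply/funext => h; rewrite !mxE mulrC.
by apply: is_derive_eq; rewrite addr0 /GRing.scale/= mulr1.
Qed.

Lemma smooth_coord i : smooth (fun x : 'rV[R]_d => x 0 i).
Proof.
apply/smoothP => -[|n].
  by move=> x; apply: coord_continuous.
split.
- by move=> x; apply: coord_continuous.
- by move=> j x; have [] := is_derive_coord x (dir j) i.
move=> j; rewrite -[Cn _ _]/(Cn n ('D_(dir j) (fun x => x 0 i))).
have -> : 'D_(dir j) (fun x : 'rV[R]_d => x 0 i : R) = (fun _ : 'rV[R]_d => dir j 0 i).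
  by apply/funext => x; have [_ ->] := is_derive_coord x (dir j) i.
exact: Cn_cst.
Qed.

Lemma smooth_sum (I : Type) (r : seq I) (P : pred I) (h : I -> 'rV[R]_d -> R) :
  (forall i, P i -> smooth (h i)) -> smooth (fun x => \sum_(i <- r | P i) h i x).
Proof.
move=> sh; elim: r => [|i r IH].
  by under eq_fun do rewrite big_nil; exact: smooth_cst.
under eq_fun do rewrite big_cons.
by case: (boolP (P i)) => // Pi; apply: smoothD => //; exact: sh.
Qed.

Lemma is_derive_affine g (a : R) b x v l :
  is_derive (a *: x + b) v g l -> is_derive x v (fun y => g (a *: y + b)) (a * l).
Proof.
move=> /is_derive_line H; apply/is_derive_line.
rewrite (_ : (fun h : R => _) = (fun h : R => g (h *: v + (a *: x + b))) \o (fun h => a * h)).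
  have -> : a * l = l * a by rewrite mulrC.
  apply: (@is_derive1_comp _ _ _ 0 l a).
    by rewrite mulr0.
  rewrite (_ : (fun h => _) = a *: (@id R)) //.
  by apply: is_derive_eq; rewrite /GRing.scale/= mulr1.
by apply/funext => h /=; rewrite scalerDr scalerA addrA.
Qed.

Lemma iter_partial_affine g (a : R) b s : smooth g ->
  iter_partial s (fun y => g (a *: y + b)) = (fun x => a ^+ size s * iter_partial s g (a *: x + b)).
Proof.
move=> sg; elim: s => [|i s IH]/=.
  by apply/funext => x; rewrite expr0 mul1r.
rewrite IH; apply/funext => x.
have H := is_derive_affine (smooth_is_derive i (a *: x + b) (smooth_iter_partial s sg)).
rewrite -[LHS]/('D_(dir i) (a ^+ size s \*: (fun x => iter_partial s g (a *: x + b))) x).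
have [d1 d2] := H.
by rewrite deriveZ//; rewrite d2 /GRing.scale/= mulrA -exprSr.
Qed.

Lemma continuous_affine g (a : R) b : continuous g -> continuous (fun x => g (a *: x + b)).
Proof.
move=> cg x; apply: (@continuous_comp _ _ _ (fun x => a *: x + b) g); last exact: cg.
by apply: continuousD; [exact: scaler_continuous|exact: cst_continuous].
Qed.

Lemma smooth_affine g (a : R) b : smooth g -> smooth (fun x => g (a *: x + b)).
Proof.
move=> sg s; rewrite iter_partial_affine//; split.
  move=> x; have H := @continuous_affine _ a b (smooth_cont (smooth_iter_partial s sg)) x.
  exact: (cvgM (cvg_cst (a ^+ size s)) H).
move=> i x; apply: derivableM; first exact: derivable_cst.
by have [] := is_derive_affine (smooth_is_derive i (a *: x + b) (smooth_iter_partial s sg)).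
Qed.

(** A derivative at [x] depends only on values near [x]; openness of [U] lets the induction go
    on. *)
Lemma iter_partial_eq0 (U : set 'rV[R]_d) g s : open U ->
  (forall x, U x -> g x = 0) -> forall x, U x -> iter_partial s g x = 0.
Proof.
move=> oU g0; elim: s => [|i s IH]//= x Ux.
rewrite (@near_eq_derive _ _ _ _ (cst 0)).
- by rewrite derive_cst.
- have : nbhs x U by exact: open_nbhs_nbhs.
  by apply: filterS => y Uy; rewrite IH.
Qed.

(** The two conditions on [t] say that it lies between 0 and [c], whatever the sign of [c]. *)
Lemma mvt_line g x v (B : R) (c : R) : (forall x, derivable g x v) ->
  (forall t, `|t| <= `|c| -> 0 <= t * c -> `|'D_v g (t *: v + x)| <= B) ->
  `|g (c *: v + x) - g x| <= B * `|c|.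
Proof.
move=> dg bg.
have H (t : R) : is_derive t (1 : R) (fun h : R => g (h *: v + x)) ('D_v g (t *: v + x)).
  by apply: is_derive_line_at; exact: derivableP.
have cg : continuous (fun h : R => g (h *: v + x)).
  by move=> t; apply/differentiable_continuous/derivable1_diffP; have [] := H t.
have cgS A : {within A, continuous (fun h : R => g (h *: v + x))}.
  exact: continuous_subspaceT.
rewrite -[X in _ - g X]add0r -[X in _ - g (X + _)](scale0r v).
have [c0|c0] := leP 0 c.
  have [t /[!in_itv]/=/andP[t0 tc] ->] := @MVT_segment _ _ _ 0 c c0 (fun t _ => H t) (cgS _).
  rewrite subr0 normrM ler_wpM2r// bg//.
    by rewrite !ger0_norm// (le_trans t0).
  by rewrite mulr_ge0.
have [t /[!in_itv]/=/andP[t0 tc] e] := @MVT_segment _ _ _ c 0 (ltW c0) (fun t _ => H t) (cgS _).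
rewrite distrC e sub0r normrM normrN ler_wpM2r// bg//.
  by rewrite !ler0_norm ?lerN2// (ltW c0).
by rewrite mulr_le0// ltW.
Qed.

(* Move from x to y one coordinate at a time. *)
Lemma mvt_box g x y (B : R) : (forall i x, derivable g x (dir i)) -> 0 <= B ->
  (forall i (z : 'rV[R]_d), (forall j, Num.min (x 0 j) (y 0 j) <= z 0 j <= Num.max (x 0 j) (y 0 j)) ->
    `|'D_(dir i) g z| <= B) ->
  `|g y - g x| <= d%:R * B * `|y - x|.
Proof.
move=> dg B0 bg.
(* Only partial derivatives are at hand, so the path follows the axes instead of the segment, and
   the bound is assumed on the whole box. *)
pose z k : 'rV[R]_d := \row_j (if (j < k)%N then y 0 j else x 0 j).
have zd : z d = y by apply/rowP => j; rewrite mxE ltn_ord.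
have z0 : z 0%N = x by apply/rowP => j; rewrite mxE ltn0.
suff H k : (k <= d)%N -> `|g (z k) - g (z 0%N)| <= k%:R * B * `|y - x|.
  by rewrite -[X in g X - _]zd -[X in _ - g X]z0; exact: H.
elim: k => [|k IH] kd; first by rewrite subrr normr0 !mul0r.
rewrite -(subrK (g (z k)) (g (z k.+1))) -addrA (le_trans (ler_normD _ _))//.
rewrite -natr1 mulrDl mulrDl [X in X <= _]addrC lerD//; first exact: IH (ltnW kd).
rewrite mul1r; pose ik := Ordinal kd.
have -> : z k.+1 = (y 0 ik - x 0 ik) *: dir ik + z k.
  apply/rowP => j; rewrite !mxE eqxx /=; have [->|jk] := eqVneq j ik.
    by rewrite ltnS leqnn ltnn mulr1 subrK.
  rewrite mulr0 add0r ltnS leq_eqVlt (_ : (j == k :> nat) = false)//.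
  by apply: contra_neqF jk => /eqP jk; exact: val_inj.
apply: (le_trans (@mvt_line g (z k) (dir ik) B _ (dg ik) _)).
  move=> t tc tc0; apply: bg => j.
  (* The moving coordinate stays between its two end values; every other coordinate equals one of
     them. *)
  have cc : ((y 0 j - x 0 j <= t <= 0) || (0 <= t <= y 0 j - x 0 j)) || (j != ik).
    have [->|] := eqVneq j ik; rewrite ?orbT ?orbF//.
    move: tc tc0; set c := y 0 ik - x 0 ik; have [c0|c0|<-] := ltgtP 0 c.
    - by rewrite (gtr0_norm c0) ler_norml pmulr_lge0// => /andP[_ ->] ->; rewrite orbT.
    - rewrite (ltr0_norm c0) ler_norml nmulr_lge0// opprK => /andP[-> _] ->.
      by [].
    - by rewrite normr0 normr_le0 => /eqP -> _; rewrite !lexx.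
  rewrite !mxE eqxx /=; move: cc; have [->|jk] := eqVneq j ik.
    rewrite ltnn mulr1 orbF ge_min le_max; lra.
  by rewrite mulr0 add0r ge_min le_max; case: ifP; rewrite !lexx ?orbT.
rewrite ler_wpM2l//.
have -> : y 0 ik - x 0 ik = (y - x) 0 ik by rewrite !mxE.
by rewrite [X in _ <= X]mx_normrE; apply: (le_bigmax _ (fun ij => `|(y - x) ij.1 ij.2|) (0, ik)).
Qed.

End partial_derivatives.

(* Keeps [done] from comparing smoothness hypotheses up to unfolding. *)
Global Opaque smooth.

(** * The real-valued modulus on [R[i]] *)

Section complex_norm.
Variable R : realType.
Implicit Types z w : R[i].

Lemma normc_ge0 z : 0 <= normc z.
Proof. by case: z => a b; exact: sqrtr_ge0. Qed.

Lemma normcM z w : normc (z * w) = normc z * normc w.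
Proof. exact: ComplexField.Normc.normcM. Qed.

Lemma normcD z w : normc (z + w) <= normc z + normc w.
Proof. exact: le_normcD. Qed.

Lemma normcN z : normc (- z) = normc z.
Proof. exact: normcN. Qed.

Lemma normc_conj z : normc (conjc z) = normc z.
Proof. by case: z => a b /=; rewrite sqrrN. Qed.

Lemma normc0 : normc (0 : R[i]) = 0.
Proof. exact: ComplexField.Normc.normc0. Qed.

Lemma normc_eq0 z : (normc z == 0) = (z == 0).
Proof.
by apply/eqP/eqP => [/ComplexField.Normc.eq0_normc //|->]; exact: normc0.
Qed.

Lemma normc_real (a : R) : normc a%:C = `|a|.
Proof. by rewrite /normc /= expr0n/= addr0 sqrtr_sqr. Qed.

Lemma ler_Re_normc z : `|complex.Re z| <= normc z.
Proof.
case: z => a b /=; rewrite -sqrtr_sqr ler_sqrt ?addr_ge0 ?sqr_ge0//.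
by rewrite lerDl sqr_ge0.
Qed.

Lemma ler_Im_normc z : `|complex.Im z| <= normc z.
Proof.
case: z => a b /=; rewrite -sqrtr_sqr ler_sqrt ?addr_ge0 ?sqr_ge0//.
by rewrite lerDr sqr_ge0.
Qed.

Lemma normc_le_ReIm z : normc z <= `|complex.Re z| + `|complex.Im z|.
Proof.
case: z => a b /=.
have h : 0 <= `|a| + `|b| by rewrite addr_ge0.
rewrite -[leRHS]ger0_norm// -sqrtr_sqr ler_sqrt ?sqr_ge0//.
rewrite sqrrD !real_normK ?num_real// -addrA lerD2l lerDr mulrn_wge0// mulr_ge0//.
Qed.

Lemma cRe_mul z w : complex.Re (z * w) = complex.Re z * complex.Re w - complex.Im z * complex.Im w.
Proof. by case: z w => a b [a' b']. Qed.

Lemma cIm_mul z w : complex.Im (z * w) = complex.Re z * complex.Im w + complex.Im z * complex.Re w.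
Proof. by case: z w => a b [a' b']. Qed.

Lemma cRe_add z w : complex.Re (z + w) = complex.Re z + complex.Re w.
Proof. by case: z w => a b [a' b']. Qed.

Lemma cIm_add z w : complex.Im (z + w) = complex.Im z + complex.Im w.
Proof. by case: z w => a b [a' b']. Qed.

Lemma eq_ReIm z w : complex.Re z = complex.Re w -> complex.Im z = complex.Im w -> z = w.
Proof. by case: z w => a b [a' b'] /= -> ->. Qed.

End complex_norm.

Section csmooth_intro.
Variables (R : realType) (d : nat).
Implicit Types f : 'rV[R]_d -> R[i].

Lemma csmoothI f : smooth (fun x => complex.Re (f x)) ->
  smooth (fun x => complex.Im (f x)) -> csmooth f.
Proof. by []. Qed.

Lemma csmooth_Re f : csmooth f -> smooth (fun x => complex.Re (f x)).
Proof. by case. Qed.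

Lemma csmooth_Im f : csmooth f -> smooth (fun x => complex.Im (f x)).
Proof. by case. Qed.

End csmooth_intro.

Global Opaque csmooth.

(** * Partial derivatives of complex-valued functions *)

Section csmooth.
Variables (R : realType) (d : nat).
Implicit Types (f g : 'rV[R]_d -> R[i]) (x y : 'rV[R]_d).

Definition cpart (i : 'I_d) f : 'rV[R]_d -> R[i] := fun x =>
  'D_(dir R i) (fun y => complex.Re (f y)) x +i* 'D_(dir R i) (fun y => complex.Im (f y)) x.

Lemma iter_cpartial_rcons s i f : iter_cpartial (rcons s i) f = iter_cpartial s (cpart i f).
Proof. by rewrite /iter_cpartial !iter_partial_rcons. Qed.

Lemma iter_cpartial_cons s i f : iter_cpartial (i :: s) f = cpart i (iter_cpartial s f).
Proof. by []. Qed.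

Lemma iter_cpartial_nil f : iter_cpartial [::] f = f.
Proof. by apply/funext => x; rewrite /iter_cpartial/=; case: (f x). Qed.

Lemma csmooth_cst (c : R[i]) : csmooth (fun _ : 'rV[R]_d => c).
Proof. by apply: csmoothI; exact: smooth_cst. Qed.

Lemma csmoothD f g : csmooth f -> csmooth g -> csmooth (fun x => f x + g x).
Proof.
move=> /[dup]/csmooth_Re f1 /csmooth_Im f2 /[dup]/csmooth_Re g1 /csmooth_Im g2; apply: csmoothI.
  by under eq_fun do rewrite cRe_add; exact: smoothD.
by under eq_fun do rewrite cIm_add; exact: smoothD.
Qed.

Lemma csmoothM f g : csmooth f -> csmooth g -> csmooth (fun x => f x * g x).
Proof.
move=> /[dup]/csmooth_Re f1 /csmooth_Im f2 /[dup]/csmooth_Re g1 /csmooth_Im g2; apply: csmoothI.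
  under eq_fun do rewrite cRe_mul; apply: smoothD; first exact: smoothM.
  by apply: smoothN; exact: smoothM.
by under eq_fun do rewrite cIm_mul; apply: smoothD; exact: smoothM.
Qed.

Lemma csmoothJ f : csmooth f -> csmooth (fun x => conjc (f x)).
Proof.
move=> /[dup]/csmooth_Re f1 /csmooth_Im f2; apply: csmoothI.
  by rewrite (_ : (fun x => _) = (fun x => complex.Re (f x)))//; apply/funext => x; case: (f x).
rewrite (_ : (fun x => _) = (fun x => - complex.Im (f x))); first exact: smoothN.
by apply/funext => x; case: (f x).
Qed.

Lemma csmooth_real (g : 'rV[R]_d -> R) : smooth g -> csmooth (fun x => (g x)%:C).
Proof. by move=> sg; apply: csmoothI; [exact: sg|exact: smooth_cst]. Qed.

Lemma csmooth_sum (I : Type) (r : seq I) (P : pred I) (h : I -> 'rV[R]_d -> R[i]) :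
  (forall i, P i -> csmooth (h i)) -> csmooth (fun x => \sum_(i <- r | P i) h i x).
Proof.
move=> sh; elim: r => [|i r IH].
  by under eq_fun do rewrite big_nil; exact: csmooth_cst.
under eq_fun do rewrite big_cons.
by case: (boolP (P i)) => Pi; [exact: csmoothD (sh _ Pi) IH|exact: IH].
Qed.

Lemma csmooth_affine f (a : R) b : csmooth f -> csmooth (fun x => f (a *: x + b)).
Proof.
move=> /[dup]/csmooth_Re f1 /csmooth_Im f2; apply: csmoothI.
- exact: (@smooth_affine _ _ (fun x => complex.Re (f x))).
- exact: (@smooth_affine _ _ (fun x => complex.Im (f x))).
Qed.

Lemma csmooth_cpart f i : csmooth f -> csmooth (cpart i f).
Proof. by move=> /[dup]/csmooth_Re f1 /csmooth_Im f2; apply: csmoothI; exact: smooth_D. Qed.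

Lemma csmooth_iter_cpartial f s : csmooth f -> csmooth (iter_cpartial s f).
Proof. by move=> /[dup]/csmooth_Re f1 /csmooth_Im f2; apply: csmoothI; exact: smooth_iter_partial. Qed.

Lemma cpartD i f g : csmooth f -> csmooth g ->
  cpart i (fun x => f x + g x) = (fun x => cpart i f x + cpart i g x).
Proof.
move=> /[dup]/csmooth_Re f1 /csmooth_Im f2 /[dup]/csmooth_Re g1 /csmooth_Im g2; apply/funext => x.
have [d1 d2 d3 d4] := And4 (@smooth_derivable R d _ i x f1) (@smooth_derivable R d _ i x f2)
  (@smooth_derivable R d _ i x g1) (@smooth_derivable R d _ i x g2).
apply: eq_ReIm; rewrite ?(cRe_add, cIm_add) [LHS]/=.
- under eq_fun do rewrite cRe_add.
  exact: (deriveD d1 d3).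
- under eq_fun do rewrite cIm_add.
  exact: (deriveD d2 d4).
Qed.

Lemma cpartM i f g : csmooth f -> csmooth g ->
  cpart i (fun x => f x * g x) = (fun x => cpart i f x * g x + f x * cpart i g x).
Proof.
move=> /[dup]/csmooth_Re f1 /csmooth_Im f2 /[dup]/csmooth_Re g1 /csmooth_Im g2; apply/funext => x.
have [d1 d2 d3 d4] := And4 (@smooth_derivable R d _ i x f1) (@smooth_derivable R d _ i x f2)
  (@smooth_derivable R d _ i x g1) (@smooth_derivable R d _ i x g2).
apply: eq_ReIm; rewrite ?(cRe_add, cIm_add) ?(cRe_mul, cIm_mul) [LHS]/=.
- under eq_fun do rewrite cRe_mul.
  have [_ E] := is_deriveB (is_deriveM (derivableP d1) (derivableP d3))
    (is_deriveM (derivableP d2) (derivableP d4)).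
  apply: (etrans E); rewrite /GRing.scale/=.
  move: ('D__ _ _) ('D__ _ _) ('D__ _ _) ('D__ _ _) => u1 u2 u3 u4.
  by ring.
- under eq_fun do rewrite cIm_mul.
  have [_ E] := is_deriveD (is_deriveM (derivableP d1) (derivableP d4))
    (is_deriveM (derivableP d2) (derivableP d3)).
  apply: (etrans E); rewrite /GRing.scale/=.
  move: ('D__ _ _) ('D__ _ _) ('D__ _ _) ('D__ _ _) => u1 u2 u3 u4.
  by ring.
Qed.

Lemma cpart_cst i (c : R[i]) : cpart i (fun _ : 'rV[R]_d => c) = fun _ => 0.
Proof. by apply/funext => x; apply: eq_ReIm; exact: derive_cst. Qed.

Lemma iter_cpartial_cst s (c : R[i]) : s != [::] ->
  iter_cpartial s (fun _ : 'rV[R]_d => c) = fun _ => 0.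
Proof.
move=> s0; have {s0} : (0 < size s)%N by case: s s0.
elim/last_ind: s c => // s i IH c _; rewrite iter_cpartial_rcons cpart_cst.
case: s IH => [_|j s IH]; first by rewrite iter_cpartial_nil.
exact: IH.
Qed.

Lemma iter_cpartialD s f g : csmooth f -> csmooth g ->
  iter_cpartial s (fun x => f x + g x) = (fun x => iter_cpartial s f x + iter_cpartial s g x).
Proof.
elim/last_ind: s f g => [|s i IH] f g sf sg; first by rewrite !iter_cpartial_nil.
by rewrite !iter_cpartial_rcons (cpartD i sf sg) (IH _ _ (csmooth_cpart i sf) (csmooth_cpart i sg)).
Qed.

Lemma cpartZ i (c : R[i]) f : csmooth f ->
  cpart i (fun x => c * f x) = (fun x => c * cpart i f x).
Proof.
move=> sf; rewrite (cpartM i (csmooth_cst c) sf).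
by apply/funext => x; rewrite cpart_cst mul0r add0r.
Qed.

Lemma iter_cpartialZ s (c : R[i]) f : csmooth f ->
  iter_cpartial s (fun x => c * f x) = (fun x => c * iter_cpartial s f x).
Proof.
elim/last_ind: s f => [|s i IH] f sf; first by rewrite !iter_cpartial_nil.
by rewrite !iter_cpartial_rcons (cpartZ i c sf) (IH _ (csmooth_cpart i sf)).
Qed.

Lemma iter_cpartialB s f g : csmooth f -> csmooth g ->
  iter_cpartial s (fun x => f x - g x) = (fun x => iter_cpartial s f x - iter_cpartial s g x).
Proof.
move=> sf sg; have e h : (fun x : 'rV[R]_d => - h x) = (fun x => (-1 : R[i]) * h x).
  by apply/funext => x; rewrite mulN1r.
have sNg : csmooth (fun x => - g x) by rewrite e; exact: csmoothM (csmooth_cst _) sg.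
rewrite (iter_cpartialD s sf sNg).
by apply/funext => x; rewrite e (iter_cpartialZ s _ sg) mulN1r.
Qed.

Lemma iter_cpartial_sum s (I : Type) (r : seq I) (h : I -> 'rV[R]_d -> R[i]) :
  (forall i, csmooth (h i)) -> iter_cpartial s (fun x => \sum_(i <- r) h i x) =
  (fun x => \sum_(i <- r) iter_cpartial s (h i) x).
Proof.
move=> sh; elim: r => [|i r IH].
  under eq_fun do rewrite big_nil.
  under [RHS]eq_fun do rewrite big_nil.
  have [->|s0] := eqVneq s [::]; first by rewrite iter_cpartial_nil.
  by rewrite iter_cpartial_cst.
under eq_fun do rewrite big_cons.
under [RHS]eq_fun do rewrite big_cons.
have ssum : csmooth (fun x => \sum_(i <- r) h i x) by apply: csmooth_sum => j _; exact: sh.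
by rewrite (iter_cpartialD s (sh i) ssum) IH.
Qed.

Lemma iter_cpartial_affine f (a : R) b s : csmooth f ->
  iter_cpartial s (fun y => f (a *: y + b)) =
  (fun x => (a ^+ size s)%:C * iter_cpartial s f (a *: x + b)).
Proof.
move=> /[dup]/csmooth_Re f1 /csmooth_Im f2; apply/funext => x; rewrite /iter_cpartial.
rewrite (iter_partial_affine a b s f1) (iter_partial_affine a b s f2).
by apply: eq_ReIm; rewrite ?cRe_mul ?cIm_mul/= !mul0r ?subr0 ?addr0.
Qed.

Lemma iter_cpartialJ s f : csmooth f ->
  iter_cpartial s (fun x => conjc (f x)) = (fun x => conjc (iter_cpartial s f x)).
Proof.
elim/last_ind: s f => [|s i IH] f sf; first by rewrite !iter_cpartial_nil.
rewrite !iter_cpartial_rcons -(IH _ (csmooth_cpart i sf)).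
congr iter_cpartial; apply/funext => x; apply: eq_ReIm => /=.
  by rewrite (_ : (fun y => complex.Re _) = (fun y => complex.Re (f y)))//;
    apply/funext => y; case: (f y).
rewrite (_ : (fun y => complex.Im _) = - (fun y => complex.Im (f y))).
  by apply: deriveN; apply: smooth_derivable; exact: csmooth_Im sf.
by apply/funext => y; rewrite /GRing.opp/=; case: (f y).
Qed.

Lemma iter_cpartial_eq0 (U : set 'rV[R]_d) f s : open U ->
  (forall x, U x -> f x = 0) -> forall x, U x -> iter_cpartial s f x = 0.
Proof.
move=> oU f0 x Ux; rewrite /iter_cpartial !(iter_partial_eq0 s oU)//.
- by move=> y Uy; rewrite f0.
- by move=> y Uy; rewrite f0.
Qed.

(** Each use of the Leibniz rule doubles the number of terms, whence [2 ^+ m]. The point [x] is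
    fixed, so [a] and [b] may contain powers of the weight at [x]. *)
Lemma iter_cpartialM_le m f g x (a b : R) : csmooth f -> csmooth g ->
  (forall s, (size s <= m)%N -> normc (iter_cpartial s f x) <= a) ->
  (forall s, (size s <= m)%N -> normc (iter_cpartial s g x) <= b) ->
  forall s, (size s <= m)%N ->
  normc (iter_cpartial s (fun y => f y * g y) x) <= 2 ^+ m * (a * b).
Proof.
elim: m f g => [|m IH] f g sf sg fa gb s sm.
  move: sm; rewrite leqn0 size_eq0 => /eqP ->.
  move: (fa [::] isT) (gb [::] isT); rewrite !iter_cpartial_nil normcM mul1r => *.
  by rewrite ler_pM// normc_ge0.
have a0 : 0 <= a by apply: le_trans (fa [::] isT); exact: normc_ge0.
have b0 : 0 <= b by apply: le_trans (gb [::] isT); exact: normc_ge0.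
have IH' h k : csmooth h -> csmooth k ->
  (forall s, (size s <= m)%N -> normc (iter_cpartial s h x) <= a) ->
  (forall s, (size s <= m)%N -> normc (iter_cpartial s k x) <= b) ->
  forall s, (size s <= m)%N ->
  normc (iter_cpartial s (fun y => h y * k y) x) <= 2 ^+ m * (a * b).
  by move=> *; exact: IH.
case/lastP: s sm => [_|s i].
  move: (fa [::] isT) (gb [::] isT); rewrite !iter_cpartial_nil normcM => *.
  apply: (@le_trans _ _ (a * b)); first by rewrite ler_pM ?normc_ge0.
  by rewrite ler_peMl ?mulr_ge0 ?exprn_ege1 ?ler1n.
rewrite size_rcons ltnS => sm; rewrite iter_cpartial_rcons (cpartM i sf sg).
have si1 := csmooth_cpart i sf; have si2 := csmooth_cpart i sg.
rewrite (iter_cpartialD s (csmoothM si1 sg) (csmoothM sf si2)).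
rewrite (le_trans (normcD _ _))// exprS mulr2n 2!mulrDl !mul1r lerD//.
- apply: (IH _ _ si1 sg) => // t tm; first by rewrite -iter_cpartial_rcons fa// size_rcons.
  by rewrite gb// ltnW.
- apply: (IH _ _ sf si2) => // t tm; first by rewrite fa// ltnW.
  by rewrite -iter_cpartial_rcons gb// size_rcons.
Qed.

End csmooth.

(** There are finitely many derivatives up to a given order; this list turns one constant per
    derivative into a common constant. *)
Fixpoint seqs_upto (T : finType) n : seq (seq T) :=
  if n is n'.+1 then [::] :: [seq i :: s | i <- enum T, s <- seqs_upto T n'] else [:: [::]].

Lemma mem_seqs_upto (T : finType) n (s : seq T) : (size s <= n)%N -> s \in seqs_upto T n.
Proof.
elim: n s => [|n IH] [|i s]//= sn; rewrite in_cons /=.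
by apply: allpairs_f; [rewrite mem_enum|exact: IH].
Qed.

(** The sum of the absolute values of the finitely many chosen bounds exceeds each of them. *)
Lemma uniform_bound (R : realType) (T : finType) n (P : seq T -> R -> Prop) :
  (forall s b b', b <= b' -> P s b -> P s b') -> (forall s, exists b, P s b) ->
  exists2 b, 0 <= b & forall s, (size s <= n)%N -> P s b.
Proof.
move=> Pmono /choice[B PB]; exists (\sum_(s <- seqs_upto T n) `|B s|).
  by rewrite sumr_ge0.
move=> s /mem_seqs_upto sn; apply: Pmono (PB s).
rewrite (le_trans (ler_norm _))// (perm_big _ (perm_to_rem sn))/= big_cons.
by rewrite lerDl sumr_ge0.
Qed.

(** * Schwartz functions *)

Section schwartz_bounds.
Variables (R : realType) (d : nat).
Implicit Types (f g h : 'rV[R]_d -> R[i]) (x y : 'rV[R]_d).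

Lemma ler_coord_norm x i : `|x 0 i| <= `|x|.
Proof.
by rewrite [leRHS]mx_normrE; apply: (le_bigmax _ (fun ij => `|x ij.1 ij.2|) (0, i)).
Qed.

Lemma norm_le_coord x (b : R) : 0 <= b -> (forall i, `|x 0 i| <= b) -> `|x| <= b.
Proof.
move=> b0 xb; rewrite [leLHS]mx_normrE; apply: bigmax_le => // -[j i] _ /=.
by rewrite ord1.
Qed.

(** The first alternative is needed when [d = 0], where there is no coordinate at all. *)
Lemma norm_exists_coord x : `|x| = 0 \/ exists i, `|x| = `|x 0 i|.
Proof.
have [x0|] := eqVneq `|x| 0; first by left.
move=> x0; right; apply: contrapT => nx.
have xpos : 0 < `|x| by rewrite lt_neqAle eq_sym x0 normr_ge0.
suff : `|x| < `|x| by rewrite ltxx.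
rewrite [ltLHS]mx_normrE; apply: bigmax_lt => // -[j i] _ /=.
rewrite ord1 lt_neqAle ler_coord_norm andbT; apply/eqP => e.
by apply: nx; exists i.
Qed.

Lemma wt_ge1 x : 1 <= 1 + `|x|.
Proof. by rewrite lerDl. Qed.

Lemma wt_gt0 x : 0 < 1 + `|x|.
Proof. by rewrite (lt_le_trans ltr01)// wt_ge1. Qed.

Lemma wt_ge0 x : 0 <= 1 + `|x|.
Proof. exact: ltW (wt_gt0 x). Qed.

Lemma wt_pow_ge1 x n : 1 <= (1 + `|x|) ^+ n.
Proof. by rewrite exprn_ege1// wt_ge1. Qed.

Lemma wt_pow_ge0 x n : 0 <= (1 + `|x|) ^+ n.
Proof. by rewrite exprn_ge0// ltW// wt_gt0. Qed.

Lemma wt_pow_le x m n : (m <= n)%N -> (1 + `|x|) ^+ m <= (1 + `|x|) ^+ n.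
Proof. by move=> mn; rewrite ler_weXn2l// wt_ge1. Qed.

(** A single increasing scale of bounds that replaces the family of seminorms: order [m] limits both
    the power of the weight and the number of derivatives. *)
Definition sb m f (b : R) := forall s x, (size s <= m)%N ->
  (1 + `|x|) ^+ m * normc (iter_cpartial s f x) <= b.

Lemma sb_ge0 m f b : sb m f b -> 0 <= b.
Proof.
by move=> /(_ [::] 0 isT); apply: le_trans; rewrite mulr_ge0 ?normc_ge0 ?wt_pow_ge0.
Qed.

Lemma sb_le m m' f b b' : (m' <= m)%N -> b <= b' -> sb m f b -> sb m' f b'.
Proof.
move=> mm bb H s x sm; rewrite (le_trans _ bb)// (le_trans _ (H s x _))//.
  by rewrite ler_wpM2r ?normc_ge0// wt_pow_le.
exact: leq_trans mm.
Qed.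

Lemma sb_at m f b s x : sb m f b -> (size s <= m)%N ->
  normc (iter_cpartial s f x) <= b * ((1 + `|x|) ^+ m)^-1.
Proof.
move=> H sm; rewrite ler_pdivlMr ?exprn_gt0 ?wt_gt0// mulrC; exact: H.
Qed.

Lemma sb_sup m f b s x : sb m f b -> (size s <= m)%N -> normc (iter_cpartial s f x) <= b.
Proof.
move=> H sm; apply: le_trans (H s x sm).
by rewrite ler_peMl ?normc_ge0// wt_pow_ge1.
Qed.

Lemma seminorm_le (a : {ffun 'I_d -> nat}) s f m b : (\sum_i a i <= m)%N -> (size s <= m)%N ->
  sb m f b -> (schwartz_seminorm a s f <= b%:E)%E.
Proof.
move=> am sm H; apply: ge_ereal_sup => _ [x _ <-]; rewrite lee_fin normcM normc_real.
apply: le_trans (H s x sm); rewrite ler_wpM2r ?normc_ge0//.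
apply: le_trans (wt_pow_le x am); rewrite normr_prod expr_sum ler_prod// => i _.
rewrite normr_ge0 normrX lerXn2r ?nnegrE ?wt_ge0//.
by rewrite (le_trans (ler_coord_norm x i))// lerDr.
Qed.

Lemma seminorm_lt_pinftyP (a : {ffun 'I_d -> nat}) s f : (schwartz_seminorm a s f < +oo)%E ->
  exists b : R, forall x, `|\prod_(i < d) x 0 i ^+ a i| * normc (iter_cpartial s f x) <= b.
Proof.
move=> H; exists (fine (schwartz_seminorm a s f)) => x.
have le1 : ((`|\prod_(i < d) x 0 i ^+ a i| * normc (iter_cpartial s f x))%:E <=
  schwartz_seminorm a s f)%E.
  by apply: ereal_sup_ubound; exists x => //; rewrite normcM normc_real.
rewrite -lee_fin fineK// fin_numElt H andbT.
by rewrite (lt_le_trans _ le1)// ltNyr.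
Qed.

(** Passes from the monomials in the seminorms to powers of the weight: if |x| > 1 then 1 + |x| <= 2
    |x|, and |x| is attained at a coordinate. *)
Lemma wt_pow_bound x m : (1 + `|x|) ^+ m <= 2 ^+ m * (1 + \sum_i `|x 0 i| ^+ m).
Proof.
have S0 : 0 <= \sum_i `|x 0 i| ^+ m by rewrite sumr_ge0// => i _; rewrite exprn_ge0.
have [x1|x1] := leP `|x| 1.
  apply: (@le_trans _ _ (2 ^+ m)).
    by rewrite lerXn2r ?nnegrE ?wt_ge0//; rewrite -[2]/(1 + 1); lra.
  by rewrite ler_peMr ?exprn_ge0// lerDl.
have [x0|[i xi]] := norm_exists_coord x; first by move: x1; rewrite x0 ltr10.
apply: (@le_trans _ _ (2 ^+ m * `|x| ^+ m)).
  rewrite -exprMn lerXn2r ?nnegrE ?wt_ge0 ?mulr_gt0 ?(lt_trans ltr01)//.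
  by rewrite mulr_natl mulr2n; lra.
rewrite ler_wpM2l ?exprn_ge0// xi (bigD1 i)//=.
have : 0 <= \sum_(j | j != i) `|x 0 j| ^+ m by rewrite sumr_ge0// => j _; rewrite exprn_ge0.
lra.
Qed.

Lemma schwartz_csmooth f : schwartz f -> csmooth f.
Proof. by case. Qed.

Lemma schwartz_sb f m : schwartz f -> exists b, sb m f b.
Proof.
move=> [sf H].
suff /(@uniform_bound R 'I_d m)[] : forall s, exists b, forall x,
    (1 + `|x|) ^+ m * normc (iter_cpartial s f x) <= b.
- by move=> s b b' bb Hb x; exact: le_trans bb.
- by move=> b _ Hb; exists b => s x sm; exact: Hb.
move=> s.
have [b0 Hb0] := seminorm_lt_pinftyP (H [ffun=> 0%N] s).
have /choice[b Hb] : forall i, exists b, forall x,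
    `|x 0 i| ^+ m * normc (iter_cpartial s f x) <= b.
  move=> i; have [b Hb] := seminorm_lt_pinftyP (H [ffun j => if j == i then m else 0%N] s).
  exists b => x; apply: le_trans (Hb x).
  rewrite (bigD1 i)//= ffunE eqxx big1 ?mulr1 ?normrX// => j ji.
  by rewrite ffunE (negbTE ji).
exists (2 ^+ m * (b0 + \sum_i b i)) => x.
apply: le_trans (ler_wpM2r (normc_ge0 _) (wt_pow_bound x m)) _.
rewrite -mulrA ler_wpM2l ?exprn_ge0// mulrDl lerD//.
  apply: le_trans (Hb0 x); rewrite big1 ?normr1// => i _; by rewrite ffunE.
by rewrite mulr_suml ler_sum.
Qed.

Lemma schwartzI f : csmooth f -> (forall m, exists b, sb m f b) -> schwartz f.
Proof.
move=> sf H; split=> // a s.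
have [b Hb] := H (maxn (\sum_i a i) (size s)).
by rewrite (le_lt_trans (seminorm_le (leq_maxl _ _) (leq_maxr _ _) Hb))// ltry.
Qed.

Lemma sbD m f g b c : csmooth f -> csmooth g -> sb m f b -> sb m g c ->
  sb m (fun x => f x + g x) (b + c).
Proof.
move=> sf sg fb gc s x sm; rewrite (iter_cpartialD s sf sg).
rewrite (le_trans (ler_wpM2l (wt_pow_ge0 x m) (normcD _ _)))// mulrDr lerD//.
  exact: fb.
exact: gc.
Qed.

Lemma sbZ m f b (c : R[i]) : csmooth f -> sb m f b -> sb m (fun x => c * f x) (normc c * b).
Proof.
move=> sf fb s x sm; rewrite (iter_cpartialZ s c sf) normcM mulrCA.
by rewrite ler_wpM2l ?normc_ge0//; exact: fb.
Qed.

Lemma sb_cpart m f b i : sb m.+1 f b -> sb m (cpart i f) b.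
Proof.
move=> fb s x sm; rewrite -iter_cpartial_rcons.
apply: le_trans (fb (rcons s i) x _); last by rewrite size_rcons.
by rewrite ler_wpM2r ?normc_ge0// wt_pow_le.
Qed.

(** A multiplier that grows like the [k]-th power of the weight costs [k] orders of decay; [2 ^+ m]
    is the Leibniz constant. *)
Lemma sbM m k f g b (C : R) : csmooth f -> csmooth g ->
  (forall s x, (size s <= m)%N -> normc (iter_cpartial s g x) <= C * (1 + `|x|) ^+ k) ->
  sb (m + k) f b -> sb m (fun x => g x * f x) (2 ^+ m * (C * b)).
Proof.
move=> sf sg gC fb s x sm.
have := iter_cpartialM_le sg sf (fun s sm => gC s x sm)
  (fun s sm => sb_at x fb (leq_trans sm (leq_addr k m))) sm.
move=> /(ler_wpM2l (wt_pow_ge0 x m))/le_trans; apply.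
rewrite mulrCA ler_wpM2l ?exprn_ge0// exprD invfM.
have w0 n : (1 + `|x|) ^+ n != 0 by rewrite expf_neq0// gt_eqF// wt_gt0.
rewrite le_eqVlt; apply/orP; left; apply/eqP.
have := w0 m; have := w0 k; move: ((1 + `|x|) ^+ k) ((1 + `|x|) ^+ m) => u v u0 v0.
by field; rewrite u0 v0.
Qed.

Lemma schwartzD f g : schwartz f -> schwartz g -> schwartz (fun x => f x + g x).
Proof.
move=> Sf Sg; have sf := schwartz_csmooth Sf; have sg := schwartz_csmooth Sg.
apply: schwartzI; first exact: csmoothD sf sg.
move=> m; have [b fb] := schwartz_sb m Sf; have [c gc] := schwartz_sb m Sg.
by exists (b + c); exact: sbD.
Qed.

Lemma schwartzZ f (c : R[i]) : schwartz f -> schwartz (fun x => c * f x).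
Proof.
move=> Sf; have sf := schwartz_csmooth Sf.
apply: schwartzI; first exact: csmoothM (csmooth_cst d c) sf.
move=> m; have [b fb] := schwartz_sb m Sf.
by exists (normc c * b); exact: sbZ.
Qed.

Lemma schwartz0 : schwartz (fun _ : 'rV[R]_d => 0 : R[i]).
Proof.
apply: schwartzI; first exact: csmooth_cst.
move=> m; exists 0 => s x _.
have [->|s0] := eqVneq s [::]; first by rewrite iter_cpartial_nil normc0 mulr0.
by rewrite iter_cpartial_cst// normc0 mulr0.
Qed.

Lemma schwartz_sum (I : Type) (r : seq I) (h : I -> 'rV[R]_d -> R[i]) :
  (forall i, schwartz (h i)) -> schwartz (fun x => \sum_(i <- r) h i x).
Proof.
move=> sh; elim: r => [|i r IH].
  by under eq_fun do rewrite big_nil; exact: schwartz0.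
by under eq_fun do rewrite big_cons; exact: schwartzD (sh i) IH.
Qed.

Lemma schwartzM_slow f g : schwartz f -> csmooth g ->
  (forall m, exists k (C : R), forall s x, (size s <= m)%N ->
    normc (iter_cpartial s g x) <= C * (1 + `|x|) ^+ k) ->
  schwartz (fun x => g x * f x).
Proof.
move=> Sf sg gC; have sf := schwartz_csmooth Sf.
apply: schwartzI; first exact: csmoothM sg sf.
move=> m; have [k [C gkC]] := gC m; have [b fb] := schwartz_sb (m + k) Sf.
by exists (2 ^+ m * (C * b)); exact: sbM fb.
Qed.

Lemma schwartzM f g : schwartz f -> schwartz g -> schwartz (fun x => g x * f x).
Proof.
move=> Sf Sg; apply: schwartzM_slow => //; first exact: schwartz_csmooth.
move=> m; have [b gb] := schwartz_sb m Sg; exists 0%N, b => s x sm.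
by rewrite expr0 mulr1; exact: sb_sup gb sm.
Qed.

Lemma schwartz_cpart f i : schwartz f -> schwartz (cpart i f).
Proof.
move=> Sf; apply: schwartzI; first exact/csmooth_cpart/schwartz_csmooth.
by move=> m; have [b fb] := schwartz_sb m.+1 Sf; exists b; exact: sb_cpart.
Qed.

Lemma schwartz_iter_cpartial f s : schwartz f -> schwartz (iter_cpartial s f).
Proof.
elim/last_ind: s f => [|s i IH] f Sf; first by rewrite iter_cpartial_nil.
by rewrite iter_cpartial_rcons; apply: IH; exact: schwartz_cpart.
Qed.

Lemma schwartzJ f : schwartz f -> schwartz (fun x => conjc (f x)).
Proof.
move=> Sf; have sf := schwartz_csmooth Sf.
apply: schwartzI; first exact: csmoothJ.
move=> m; have [b fb] := schwartz_sb m Sf; exists b => s x sm.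
by rewrite (iter_cpartialJ s sf) normc_conj; exact: fb.
Qed.

Lemma schwartz_affine f (a : R) t : a != 0 -> schwartz f -> schwartz (fun x => f (a *: x + t)).
Proof.
move=> a0 Sf; have sf := schwartz_csmooth Sf.
apply: schwartzI; first exact: csmooth_affine.
move=> m; have [b fb] := schwartz_sb m Sf.
(* Chosen so that 1 + |x| <= c (1 + |a x + t|): solve y = a x + t for [x] and take norms. *)
pose c := 1 + `|a^-1| * (1 + `|t|).
have c1 : 1 <= c by rewrite lerDl mulr_ge0// ltW// wt_gt0.
have c0 : 0 <= c by exact: le_trans c1.
have wle x : 1 + `|x| <= c * (1 + `|a *: x + t|).
  set y := a *: x + t.
  have xe : x = a^-1 *: (y - t) by rewrite addrK scalerA mulVf// scale1r.
  rewrite [in leLHS]xe normrZ.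
  have n1 := ler_normB y t.
  have := ler_wpM2l (normr_ge0 a^-1) n1.
  have p : 0 <= `|a^-1| * (`|y| * `|t|) by rewrite !mulr_ge0.
  have := normr_ge0 y; have := normr_ge0 a^-1; rewrite /c.
  move: `|y - t| `|a^-1| `|y| `|t| p => N A Y T; lra.
exists (c ^+ m * ((1 + `|a|) ^+ m * b)) => s x sm.
rewrite (iter_cpartial_affine a t s sf) normcM normc_real normrX.
apply: (@le_trans _ _ ((c * (1 + `|a *: x + t|)) ^+ m * (`|a| ^+ size s *
    normc (iter_cpartial s f (a *: x + t))))).
  rewrite ler_wpM2r ?mulr_ge0 ?normc_ge0 ?exprn_ge0//.
  by rewrite lerXn2r ?nnegrE ?mulr_ge0 ?wt_ge0 ?c0 ?wle.
rewrite exprMn -mulrA ler_wpM2l ?exprn_ge0// mulrCA.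
rewrite ler_pM ?mulr_ge0 ?exprn_ge0 ?normc_ge0 ?wt_ge0//.
- apply: (@le_trans _ _ ((1 + `|a|) ^+ size s)); last by rewrite ler_weXn2l// lerDl.
  by rewrite lerXn2r ?nnegrE// ?addr_ge0// lerDr.
- exact: fb.
Qed.

Lemma csmooth_continuous_normc f : csmooth f -> continuous (fun x => normc (f x)).
Proof.
move=> sf; have c1 := smooth_cont (csmooth_Re sf); have c2 := smooth_cont (csmooth_Im sf).
have -> : (fun x => normc (f x)) =
    (fun x => Num.sqrt (complex.Re (f x) * complex.Re (f x) + complex.Im (f x) * complex.Im (f x))).
  by apply/funext => y; case: (f y) => a b /=; rewrite !expr2.
move=> x; apply: (@continuous_comp _ _ _ (fun x => complex.Re (f x) * complex.Re (f x) +
   complex.Im (f x) * complex.Im (f x)) Num.sqrt); last exact: sqrt_continuous.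
exact: (cvgD (cvgM (c1 x) (c1 x)) (cvgM (c2 x) (c2 x))).
Qed.

Lemma schwartz_compact_support f (M : R) : csmooth f -> (forall x, M < `|x| -> f x = 0) ->
  schwartz f.
Proof.
move=> sf f0; apply: schwartzI => // m.
suff /(@uniform_bound R 'I_d m)[] : forall s, exists b, forall x,
    (1 + `|x|) ^+ m * normc (iter_cpartial s f x) <= b.
- by move=> s b b' bb Hb x; exact: le_trans bb.
- by move=> b _ Hb; exists b => s x sm; exact: Hb.
move=> s; pose N := `|M|.
have oU : open [set x : 'rV[R]_d | N < `|x|].
  apply: (@open_comp _ _ (fun x : 'rV[R]_d => `|x|) [set r | N < r]); last exact: open_gt.
  by move=> x _; apply: norm_continuous.
have out x : N < `|x| -> iter_cpartial s f x = 0.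
  by apply: (iter_cpartial_eq0 s oU) => y; move/(le_lt_trans (ler_norm _)); exact: f0.
have cK : compact [set x : 'rV[R]_d | `|x| <= N].
  apply: bounded_closed_compact.
    by exists N; split; [exact: num_real|move=> y Ny z/= zN; rewrite (le_trans zN)// ltW].
  apply: (@closed_comp _ _ (fun x : 'rV[R]_d => `|x|) [set r | r <= N]); last exact: closed_le.
  by move=> x _; apply: norm_continuous.
have K0 : [set x : 'rV[R]_d | `|x| <= N] !=set0 by exists 0 => /=; rewrite normr0 /N normr_ge0.
have cs := @csmooth_continuous_normc _ (csmooth_iter_cpartial s sf).
have [c _ Hc] := EVT_max_rV K0 cK (continuous_subspaceT cs).
exists ((1 + N) ^+ m * normc (iter_cpartial s f c)) => x.
have [xN|xN] := leP `|x| N; last first.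
  by rewrite out// normc0 mulr0 mulr_ge0 ?normc_ge0 ?exprn_ge0 ?addr_ge0 /N ?normr_ge0.
by rewrite ler_pM ?normc_ge0 ?wt_pow_ge0 ?Hc ?inE// lerXn2r ?nnegrE ?addr_ge0 ?lerD2l /N ?normr_ge0.
Qed.

End schwartz_bounds.

(** * Integration on R^d *)

Section tuple_integral.
Variable R : realType.

Definition rowt d (t : d.-tuple R) : 'rV[R]_d := \row_i tnth t i.

Lemma rowtE d (t : d.-tuple R) i : rowt t 0 i = tnth t i.
Proof. by rewrite mxE. Qed.

Lemma ge0_integral_tuple_step d (phi : d.+1.-tuple R -> \bar R) :
  measurable_fun [set: d.+1.-tuple R] phi -> (forall t, 0 <= phi t)%E ->
  (\int[lebesgue_tuple R d.+1]_t phi t =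
   \int[@lebesgue_measure R]_x \int[lebesgue_tuple R d]_t phi (cons_pair (x, t)))%E.
Proof.
move=> mphi phi0 /=.
have mcp : measurable_fun [set: (measurableTypeR R * d.-tuple R)%type] (@cons_pair R d).
  exact: measurable_cons_pair.
have H := @ge0_integral_pushforward _ _ _ _ R _ mcp
  (lebesgue_measure \x lebesgue_tuple R d)%E setT phi measurableT mphi (fun t _ => phi0 t).
rewrite preimage_setT in H.
apply: (etrans _ (etrans H _)).
  by apply: eq_measure_integral.
rewrite fubini_tonelli1//; first by apply: measurableT_comp => //; exact: mcp.
by move=> p; exact: phi0.
Qed.

Lemma ge0_integral_tuple0 (phi : 0.-tuple R -> \bar R) : (forall t, 0 <= phi t)%E ->
  (\int[lebesgue_tuple R 0]_t phi t = phi [tuple])%E.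
Proof.
move=> phi0 /=; rewrite integral_dirac//; first by rewrite diracT mul1e.
move=> _ Y mY; rewrite setTI.
have [y|y] := pselect (Y (phi [tuple])).
  rewrite (_ : _ @^-1` _ = setT); first exact: measurableT.
  by apply/seteqP; split => // t _ /=; rewrite tuple0.
rewrite (_ : _ @^-1` _ = set0); first exact: measurable0.
by apply/seteqP; split => // t /=; rewrite tuple0.
Qed.

(** The vector of floors takes countably many values, each on a half-open cube, so [B] may be
    arbitrary. *)
Lemma measurable_rowt_discrete d (n : nat) (B : set {ffun 'I_d -> int}) :
  measurable [set t : d.-tuple R | B [ffun i => Num.floor (n.+1%:R * tnth t i)]].
Proof.
pose S (z : {ffun 'I_d -> int}) : set (d.-tuple R) :=
  [set t | forall i, Num.floor (n.+1%:R * tnth t i) = z i].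
have mS z : measurable (S z).
  rewrite (_ : S z = \bigcap_(i in [set: 'I_d])
    ((@tnth _ R ^~ i) @^-1` `[(z i)%:~R / n.+1%:R, (z i + 1)%:~R / n.+1%:R[)).
    apply: fin_bigcap_measurable => // i _.
    by rewrite -[X in measurable X]setTI; exact: measurable_tnth.
  have e (r : R) (k : int) : (Num.floor (n.+1%:R * r) == k) =
      (k%:~R / n.+1%:R <= r < (k + 1)%:~R / n.+1%:R).
    rewrite ler_pdivrMr ?ltr0n// ltr_pdivlMr ?ltr0n// [r * _]mulrC.
    apply/eqP/idP => [<-|/andP[h1 h2]]; last by apply: floor_def; rewrite h1 h2.
    by rewrite floor_itv.
  apply/seteqP; split => t H i.
    by move=> _; rewrite /= in_itv/= -e; apply/eqP; exact: H.
  by have := H i Logic.I; rewrite /= in_itv/= -e => /eqP.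
rewrite (_ : [set t | _] = \bigcup_k (if @unpickle {ffun 'I_d -> int} k is Some z then
   (if pselect (B z) then S z else set0) else set0)).
  apply: bigcup_measurable => k _; case: unpickle => [z|]; last exact: measurable0.
  by case: pselect => ?; [exact: mS|exact: measurable0].
apply/seteqP; split => [t Bt|t [k _]].
  exists (pickle [ffun i => Num.floor (n.+1%:R * tnth t i)]) => //.
  by rewrite pickleK; case: pselect => [? i /=|//]; rewrite ffunE.
case: unpickle => // z; case: pselect => // Bz Sz /=.
by rewrite (_ : finfun _ = z)//; apply/ffunP => i; rewrite ffunE Sz.
Qed.

(** Continuity refers to the topology of row vectors, measurability to the product sigma-algebra of
    tuples. The bridge is rounding down to a grid of mesh [1 / n.+1]: [g] is the pointwise limit of
    its rounded versions, which depend only on the floors. *)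
Lemma measurable_rowt d (g : 'rV[R]_d -> R) : continuous g ->
  measurable_fun [set: d.-tuple R] (g \o @rowt d).
Proof.
move=> cg.
pose q n (x : 'rV[R]_d) : 'rV[R]_d := \row_i ((Num.floor (n.+1%:R * x 0 i))%:~R / n.+1%:R).
apply: (@measurable_fun_cvg _ _ _ _ (fun n t => g (q n (rowt t)))) => [n|t _].
  move=> _ Y mY; rewrite setTI.
  have := @measurable_rowt_discrete d n [set z | Y (g (\row_i ((z i)%:~R / n.+1%:R)))].
  congr (measurable _); apply/seteqP; split => t /=;
    by rewrite (_ : \row_i _ = q n (rowt t))//; apply/rowP => i; rewrite !mxE ffunE.
apply: (@cvg_comp _ _ _ (q ^~ (rowt t)) g _ (nbhs (rowt t))); last exact: cg.
apply/cvgrPdist_le => e e0; near=> n.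
apply: norm_le_coord; first exact: ltW.
move=> i; rewrite !mxE.
set r := tnth t i.
have h := floor_itv (n.+1%:R * r); have n0 : 0 < n.+1%:R :> R by rewrite ltr0n.
have -> : r - (Num.floor (n.+1%:R * r))%:~R / n.+1%:R =
   (n.+1%:R * r - (Num.floor (n.+1%:R * r))%:~R) / n.+1%:R.
  by field; rewrite gt_eqF.
rewrite normrM [`|_^-1|]ger0_norm; last by rewrite invr_ge0 ltW.
rewrite ler_pdivrMr//.
apply: (@le_trans _ _ 1).
  by case/andP: h; rewrite intrD => h1 h2; rewrite ger0_norm; lra.
have : n.+1%:R^-1 < e by near: n; exact: (near_infty_natSinv_lt (PosNum e0)).
by rewrite invf_plt ?posrE// => /ltW; rewrite -ler_pdivrMl// mulr1.
Unshelve. all: by end_near. Qed.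

End tuple_integral.

(** * An integrable majorant on R^d *)

Section weight.
Variable R : realType.

(** A product, so that its integral splits into one-dimensional arctangent integrals. *)
Definition weight d (x : 'rV[R]_d) : R := \prod_i (1 + x 0 i ^+ 2)^-1.

Lemma weight_gt0 d (x : 'rV[R]_d) : 0 < weight x.
Proof. by rewrite prodr_gt0// => i _; rewrite invr_gt0 ltr_wpDr ?sqr_ge0. Qed.

Lemma weight_ge0 d (x : 'rV[R]_d) : 0 <= weight x.
Proof. exact: ltW (weight_gt0 x). Qed.

(** Each of the [d] factors satisfies 1 + x_i^2 <= (1 + |x|)^2. This is the origin of the decay
    order [d + d] wherever integrability is wanted. *)
Lemma wt_le_weight d (x : 'rV[R]_d) : ((1 + `|x|) ^+ (d + d))^-1 <= weight x.
Proof.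
rewrite /weight prodfV lef_pV2 ?posrE ?exprn_gt0 ?wt_gt0//; last first.
  by rewrite prodr_gt0// => i _; rewrite ltr_wpDr ?sqr_ge0.
rewrite addnn -mul2n exprM -[X in _ <= _ ^+ X]card_ord -prodr_const ler_prod// => i _.
rewrite addr_ge0 ?sqr_ge0//= -real_normK ?num_real//.
have := ler_coord_norm x i; have := normr_ge0 (x 0 i).
by move: `|x 0 i| `|x| => u v; nra.
Qed.

Lemma measurable_weight d : measurable_fun [set: d.-tuple R] (@weight d \o @rowt R d).
Proof.
apply: measurable_prod => i _ /=.
under eq_fun do rewrite rowtE.
apply: (@measurableT_comp _ _ _ _ _ _ (fun r : R => (1 + r ^+ 2)^-1)); last exact: measurable_tnth.
by apply: continuous_measurable_fun; exact: continuous_oneDsqrV.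
Qed.

Lemma integral_oneDsqrV_lty : (\int[@lebesgue_measure R]_x ((1 + x ^+ 2)^-1)%:E < +oo)%E.
Proof.
rewrite (@ge0_symfun_integralT R (fun x => (1 + x ^+ 2)^-1)).
- rewrite (_ : [set x : R | 0 <= x] = `[0, +oo[%classic); last first.
    by apply/seteqP; split => x /=; rewrite in_itv/= andbT.
  by rewrite integral0y_oneDsqr -EFinM ltry.
- by move=> x; rewrite invr_ge0 addr_ge0 ?sqr_ge0.
- exact: continuous_oneDsqrV.
- by move=> x /=; rewrite sqrrN.
Qed.

Lemma integral_weight_lty d : (\int[lebesgue_tuple R d]_t (weight (rowt t))%:E < +oo)%E.
Proof.
elim: d => [|d IH].
  by rewrite ge0_integral_tuple0 ?ltry// => t; rewrite lee_fin weight_ge0.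
rewrite ge0_integral_tuple_step; last 2 first.
- by apply/measurable_EFinP; exact: measurable_weight.
- by move=> t; rewrite lee_fin weight_ge0.
have e (x : R) t : weight (rowt (cons_pair (x, t))) = (1 + x ^+ 2)^-1 * weight (@rowt R d t).
  rewrite /weight big_ord_recl rowtE tnth0; congr (_ * _).
  by apply: eq_bigr => i _; rewrite !rowtE tnthS.
under eq_integral => x _.
  under eq_integral do rewrite e EFinM.
  rewrite ge0_integralZl_EFin//; last 3 first.
  - by move=> t _; rewrite lee_fin weight_ge0.
  - by apply/measurable_EFinP; exact: measurable_weight.
  - by rewrite invr_ge0 addr_ge0 ?sqr_ge0.
  rewrite muleC.
  over.
rewrite ge0_integralZl//; last 3 first.
- by apply/measurable_EFinP; apply: continuous_measurable_fun; exact: continuous_oneDsqrV.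
- by move=> x _; rewrite lee_fin invr_ge0 addr_ge0 ?sqr_ge0.
- by apply: integral_ge0 => t _; rewrite lee_fin weight_ge0.
by rewrite lte_mul_pinfty ?integral_oneDsqrV_lty// ?ge0_fin_numE//;
  apply: integral_ge0 => t _; rewrite lee_fin weight_ge0.
Qed.

End weight.

(** * Coordinatewise changes of variables *)

Section change_of_variables.
Variable R : realType.
Local Notation leb := (@lebesgue_measure R).

(** [c] is the inverse of the Jacobian of [T]. The rule is stated for nonnegative functions, to
    which Tonelli applies without integrability conditions. *)
Definition scales_lebesgue (c : R) (T : R -> R) := measurable_fun [set: R] T /\
  forall phi : R -> \bar R, measurable_fun [set: R] phi -> (forall x, 0 <= phi x)%E ->
  (\int[leb]_x phi (T x) = c%:E * \int[leb]_x phi x)%E.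

Lemma scales_lebesgue_opp : scales_lebesgue 1 -%R.
Proof.
have mN : measurable_fun [set: measurableTypeR R] (-%R : R -> measurableTypeR R).
  exact: oppr_measurable.
split=> // phi mphi phi0; rewrite mul1e.
have H := @ge0_integral_pushforward _ _ _ _ R _ mN leb setT phi measurableT mphi (fun t _ => phi0 t).
rewrite preimage_setT in H; apply: (etrans (esym H)).
by apply: eq_measure_integral => A mA _; exact: lebesgue_measureN.
Qed.

(** [a] times the image measure gives half-open intervals their length, hence is Lebesgue measure by
    uniqueness. *)
Lemma scales_lebesgue_affine (a b : R) : 0 < a -> scales_lebesgue a^-1 (fun x => a * x + b).
Proof.
move=> a0; have ai : 0 < a^-1 by rewrite invr_gt0.
have mT : measurable_fun [set: measurableTypeR R] (fun x : R => a * x + b : measurableTypeR R).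
  apply: continuous_measurable_fun => x.
  by apply: continuousD; [exact: mulrl_continuous|exact: cst_continuous].
split=> // phi mphi phi0.
have H := @ge0_integral_pushforward _ _ _ _ R _ mT leb setT phi measurableT mphi (fun t _ => phi0 t).
rewrite preimage_setT in H; apply: (etrans (esym H)).
pose k : {nonneg R} := NngNum (ltW ai).
rewrite -[a^-1]/(k%:num) -(@ge0_integral_mscale _ _ _ leb setT measurableT k phi mphi (fun t _ => phi0 t)).
apply: eq_measure_integral => A mA _.
pose pm : {measure set measurableTypeR R -> \bar R} :=
  measure_function_pushforward__canonical__measure_function_Measure leb mT.
have e : leb A = mscale (NngNum (ltW a0)) pm A.
  apply: lebesgue_measure_unique => //= _ [[u v]] _ <-.
  rewrite /mscale/= /pushforward.
  rewrite (_ : _ @^-1` _ = `](u - b) / a, (v - b) / a]%classic); last first.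
    by apply/seteqP; split => x /=; rewrite !in_itv/= ltr_pdivrMr// ler_pdivlMr//
      ltrBlDr lerBrDr mulrC.
  rewrite !lebesgue_measure_itv/= !lte_fin ltr_pM2r ?invr_gt0// ltrD2r.
  case: ifP => _; last by rewrite mule0.
  by rewrite -!EFinB -EFinM; congr EFin; field; rewrite gt_eqF.
by rewrite /= /mscale/= e /mscale/= muleA -EFinM mulVf ?gt_eqF// mul1e.
Qed.

Lemma measurable_tuple_map d (T : 'I_d -> R -> R) : (forall i, measurable_fun setT (T i)) ->
  measurable_fun [set: d.-tuple R] (fun t : d.-tuple R => [tuple T i (tnth t i) | i < d]).
Proof.
move=> mT; apply/measurable_fun_tnthP => i.
rewrite (_ : _ \o _ = (T i) \o (@tnth _ R ^~ i)); last first.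
  by apply/funext => t /=; rewrite tnth_mktuple.
by apply: measurableT_comp => //; exact: measurable_tnth.
Qed.

(** Tonelli yields one factor [c] per coordinate. [T] depends on the coordinate so as to include
    translations by a vector. *)
Lemma ge0_integral_tuple_map d (c : R) (T : 'I_d -> R -> R) : 0 <= c ->
  (forall i, scales_lebesgue c (T i)) ->
  forall phi : d.-tuple R -> \bar R, measurable_fun [set: d.-tuple R] phi ->
  (forall t, 0 <= phi t)%E ->
  (\int[lebesgue_tuple R d]_t phi [tuple T i (tnth t i) | i < d] =
   (c ^+ d)%:E * \int[lebesgue_tuple R d]_t phi t)%E.
Proof.
move=> c0; elim: d T => [|d IH] T sT phi mphi phi0.
  rewrite !ge0_integral_tuple0// expr0 mul1e; congr phi.
  by rewrite tuple0.
have mm := measurable_tuple_map (fun i => (sT i).1).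
rewrite ge0_integral_tuple_step//; last by apply: measurableT_comp.
rewrite [in RHS]ge0_integral_tuple_step//.
have mc (x : R) : measurable_fun setT (fun t : d.-tuple R => phi (cons_pair (x, t))).
  apply: measurableT_comp => //; apply: (measurableT_comp (@measurable_cons_pair R d)).
  exact: pair1_measurable.
have e (x : R) (t : d.-tuple R) :
    [tuple T i (tnth (cons_pair (x, t)) i) | i < d.+1] =
    cons_pair (T ord0 x, [tuple T (lift ord0 i) (tnth t i) | i < d]).
  apply: eq_from_tnth => i; rewrite tnth_mktuple.
  by case: (unliftP ord0 i) => [j ->|->]; rewrite ?tnthS ?tnth0// ?tnth_mktuple.
under eq_integral => x _.
  under eq_integral do rewrite e.
  rewrite (IH _ (fun i => sT (lift ord0 i)) (fun t => phi (cons_pair (T ord0 x, t))) (mc _) (fun t => phi0 _)).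
  over.
have mF : measurable_fun setT (fun x : R => \int[lebesgue_tuple R d]_t phi (cons_pair (x, t)))%E.
  apply: (measurable_fun_fubini_tonelli_F (phi \o @cons_pair R d)) => [|p]; last exact: phi0.
  by apply: measurableT_comp => //; exact: measurable_cons_pair.
have F0 (x : R) : (0 <= \int[lebesgue_tuple R d]_t phi (cons_pair (x, t)))%E.
  by apply: integral_ge0 => t _; exact: phi0.
rewrite ge0_integralZl_EFin; last 4 first.
- exact: measurableT.
- by move=> x _; exact: F0.
- by apply: (measurableT_comp mF); exact: (sT ord0).1.
- by rewrite exprn_ge0.
by rewrite ((sT ord0).2 _ mF F0) muleA -EFinM -exprSr.
Qed.

End change_of_variables.

(** * Integrals of functions dominated by the weight *)

Section dominated_integral.
Variables (R : realType) (d : nat).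
Implicit Types (g : 'rV[R]_d -> R) (f h : 'rV[R]_d -> R[i]).
Local Notation mu := (lebesgue_tuple R d).

Definition tmeas g := measurable_fun [set: d.-tuple R] (g \o @rowt R d).

Definition wint : R := fine (\int[mu]_t (weight (rowt t))%:E).

Lemma wint_ge0 : 0 <= wint.
Proof. by rewrite fine_ge0// integral_ge0// => t _; rewrite lee_fin weight_ge0. Qed.

Lemma wintE : (\int[mu]_t (weight (rowt t))%:E)%E = wint%:E.
Proof.
rewrite fineK// ge0_fin_numE ?integral_weight_lty//.
by apply: integral_ge0 => t _; rewrite lee_fin weight_ge0.
Qed.

Lemma integrable_weight (C : R) : mu.-integrable setT (fun t => (C * weight (rowt t))%:E).
Proof.
under eq_fun do rewrite EFinM; apply: integrableZl => //.
apply/integrableP; split.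
  by apply/measurable_EFinP; exact: measurable_weight.
under eq_integral do rewrite gee0_abs ?lee_fin ?weight_ge0//.
exact: integral_weight_lty.
Qed.

Lemma dominated_integrable g (C : R) : tmeas g -> (forall x, `|g x| <= C * weight x) ->
  mu.-integrable setT (EFin \o (g \o @rowt R d)).
Proof.
move=> mg gC; apply: (le_integrable _ _ _ (integrable_weight C)) => //.
  exact/measurable_EFinP.
move=> t _ /=; rewrite lee_fin [leRHS]ger0_norm ?gC//.
exact: le_trans (gC _).
Qed.

Lemma ler_norm_integral g (C : R) : tmeas g -> (forall x, `|g x| <= C * weight x) ->
  `|\int[mu]_t g (rowt t)| <= C * wint.
Proof.
move=> mg gC; have ig := dominated_integrable mg gC.
rewrite -lee_fin (EFin_normr_Rintegral measurableT ig).
apply: (le_trans (le_abse_integral _ measurableT (measurable_int _ ig))).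
rewrite EFinM -wintE -integralZl//; last first.
  by have := integrable_weight 1; under eq_fun do rewrite mul1r.
apply: ge0_le_integral => //.
- by apply: measurableT_comp => //; exact: measurable_int ig.
- by have := measurable_int _ (integrable_weight C); under eq_fun do rewrite EFinM.
- by move=> t _; rewrite /= -EFinM lee_fin.
Qed.

Definition cmeas f := tmeas (fun x => complex.Re (f x)) /\ tmeas (fun x => complex.Im (f x)).

(** The working form of integrability: it is checked pointwise, and [C] also bounds the integral up
    to a fixed factor. *)
Definition cdom f (C : R) := cmeas f /\ forall x, normc (f x) <= C * weight x.

Lemma cdom_Re f C : cdom f C -> forall x, `|complex.Re (f x)| <= C * weight x.
Proof. by move=> [_ fC] x; rewrite (le_trans (ler_Re_normc _)). Qed.

Lemma cdom_Im f C : cdom f C -> forall x, `|complex.Im (f x)| <= C * weight x.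
Proof. by move=> [_ fC] x; rewrite (le_trans (ler_Im_normc _)). Qed.

Lemma cdom_integrable_Re f C : cdom f C ->
  mu.-integrable setT (EFin \o ((fun x => complex.Re (f x)) \o @rowt R d)).
Proof. by move=> fC; apply: (dominated_integrable fC.1.1); exact: cdom_Re fC. Qed.

Lemma cdom_integrable_Im f C : cdom f C ->
  mu.-integrable setT (EFin \o ((fun x => complex.Im (f x)) \o @rowt R d)).
Proof. by move=> fC; apply: (dominated_integrable fC.1.2); exact: cdom_Im fC. Qed.

Lemma normc_cintegral f C : cdom f C -> normc (cintegral f) <= 2 * (C * wint).
Proof.
move=> fC; apply: le_trans (normc_le_ReIm _) _; rewrite mulr_natl mulr2n lerD//.
  exact: (ler_norm_integral fC.1.1 (cdom_Re fC)).
exact: (ler_norm_integral fC.1.2 (cdom_Im fC)).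
Qed.

Definition rint g : R := \int[mu]_t (g \o @rowt R d) t.

Lemma Re_cintegral f : complex.Re (cintegral f) = rint (fun x => complex.Re (f x)).
Proof. by []. Qed.

Lemma Im_cintegral f : complex.Im (cintegral f) = rint (fun x => complex.Im (f x)).
Proof. by []. Qed.

Lemma cintegralD f h C1 C2 : cdom f C1 -> cdom h C2 ->
  cintegral (fun x => f x + h x) = cintegral f + cintegral h.
Proof.
move=> fC hC; apply: eq_ReIm; rewrite ?cRe_add ?cIm_add ?Re_cintegral ?Im_cintegral.
  rewrite -[RHS](RintegralD measurableT (cdom_integrable_Re fC) (cdom_integrable_Re hC)).
  by apply: eq_Rintegral => t _ /=; rewrite cRe_add.
rewrite -[RHS](RintegralD measurableT (cdom_integrable_Im fC) (cdom_integrable_Im hC)).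
by apply: eq_Rintegral => t _ /=; rewrite cIm_add.
Qed.

Lemma cintegralZ (c : R[i]) f C : cdom f C ->
  cintegral (fun x => c * f x) = c * cintegral f.
Proof.
move=> fC; have iR := cdom_integrable_Re fC; have iI := cdom_integrable_Im fC.
have iZ (g : d.-tuple R -> R) (k : R) : mu.-integrable setT (EFin \o g) ->
    mu.-integrable setT (EFin \o (fun t => k * g t)).
  by move=> ig; rewrite (_ : EFin \o _ = (fun t => k%:E * (EFin \o g) t)%E);
    [exact: integrableZl|apply/funext => t; rewrite /= EFinM].
apply: eq_ReIm.
  rewrite [RHS]cRe_mul; apply: (etrans _ (congr2 (fun a b => a - b) (RintegralZl (complex.Re c) measurableT iR)
    (RintegralZl (complex.Im c) measurableT iI))).
  rewrite -[RHS](RintegralB measurableT (iZ _ _ iR) (iZ _ _ iI)).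
  by apply: eq_Rintegral => t _ /=; rewrite cRe_mul.
rewrite [RHS]cIm_mul; apply: (etrans _ (congr2 (fun a b => a + b) (RintegralZl (complex.Re c) measurableT iI)
  (RintegralZl (complex.Im c) measurableT iR))).
rewrite -[RHS](RintegralD measurableT (iZ _ _ iI) (iZ _ _ iR)).
by apply: eq_Rintegral => t _ /=; rewrite cIm_mul.
Qed.

Lemma cmeasD f h : cmeas f -> cmeas h -> cmeas (fun x => f x + h x).
Proof.
move=> [f1 f2] [h1 h2]; split; rewrite /tmeas.
- by under eq_fun do rewrite cRe_add; exact: measurable_funD.
- by under eq_fun do rewrite cIm_add; exact: measurable_funD.
Qed.

Lemma cmeasM f h : cmeas f -> cmeas h -> cmeas (fun x => f x * h x).
Proof.
move=> [f1 f2] [h1 h2]; split; rewrite /tmeas.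
- under eq_fun do rewrite cRe_mul.
  by apply: measurable_funB; apply: measurable_funM.
- under eq_fun do rewrite cIm_mul.
  by apply: measurable_funD; apply: measurable_funM.
Qed.

Lemma cmeas_cst (c : R[i]) : cmeas (fun _ => c).
Proof. by split; exact: measurable_cst. Qed.

Lemma tmeas_continuous g : continuous g -> tmeas g.
Proof. exact: measurable_rowt. Qed.

Lemma cmeas_csmooth f : csmooth f -> cmeas f.
Proof.
move=> sf; split; apply: tmeas_continuous; apply: smooth_cont.
  exact: csmooth_Re.
exact: csmooth_Im.
Qed.

Lemma sb_cdom f b m : csmooth f -> (d + d <= m)%N -> sb m f b -> cdom f b.
Proof.
move=> sf dm fb; split; first exact: cmeas_csmooth.
move=> x; have := sb_at x (sb_le dm (lexx b) fb) (s := [::]) isT.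
rewrite iter_cpartial_nil => /le_trans; apply.
by rewrite ler_wpM2l ?(sb_ge0 fb)// wt_le_weight.
Qed.

Lemma schwartz_cdom f : schwartz f -> exists C, cdom f C.
Proof.
move=> Sf; have [b fb] := schwartz_sb (d + d) Sf; exists b.
by apply: sb_cdom fb => //; exact: schwartz_csmooth.
Qed.

Lemma cdomD f h C1 C2 : cdom f C1 -> cdom h C2 -> cdom (fun x => f x + h x) (C1 + C2).
Proof.
move=> [mf fC] [mh hC]; split; first exact: cmeasD.
by move=> x; rewrite (le_trans (normcD _ _))// mulrDl lerD.
Qed.

Lemma cdomM f h C K : cdom f C -> cmeas h -> (forall x, normc (h x) <= K) ->
  cdom (fun x => f x * h x) (C * K).
Proof.
move=> [mf fC] mh hK; split; first exact: cmeasM.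
by move=> x; rewrite normcM mulrAC ler_pM ?normc_ge0.
Qed.

Lemma cdomZ f C (c : R[i]) : cdom f C -> cdom (fun x => c * f x) (normc c * C).
Proof.
move=> [mf fC]; split; first exact: cmeasM (cmeas_cst c) mf.
by move=> x; rewrite normcM -mulrA ler_wpM2l ?normc_ge0.
Qed.

Lemma cdom0 : cdom (fun _ => 0) 0.
Proof. by split; [exact: cmeas_cst|move=> x; rewrite normc0 mul0r]. Qed.

Lemma cintegral0 : cintegral (fun _ : 'rV[R]_d => 0 : R[i]) = 0.
Proof. by rewrite /cintegral /= Rintegral_cst// mul0r. Qed.

Lemma cintegral_sum (I : Type) (r : seq I) (h : I -> 'rV[R]_d -> R[i]) :
  (forall i, exists C, cdom (h i) C) ->
  cintegral (fun x => \sum_(i <- r) h i x) = \sum_(i <- r) cintegral (h i).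
Proof.
move=> hC; suff [] : (exists C, cdom (fun x => \sum_(i <- r) h i x) C) /\
  cintegral (fun x => \sum_(i <- r) h i x) = \sum_(i <- r) cintegral (h i) by [].
elim: r => [|i r [[C IC] IE]].
  split; first by exists 0; under eq_fun do rewrite big_nil; exact: cdom0.
  by rewrite big_nil; under eq_fun do rewrite big_nil; exact: cintegral0.
have [C' hC'] := hC i; split.
  by exists (C' + C); under eq_fun do rewrite big_cons; exact: cdomD.
by rewrite big_cons -IE -(cintegralD hC' IC); under eq_fun do rewrite big_cons.
Qed.

End dominated_integral.

Section affine_change.
Variables (R : realType) (d : nat).
Implicit Types (g : 'rV[R]_d -> R) (f h : 'rV[R]_d -> R[i]).
Local Notation mu := (lebesgue_tuple R d).

Definition row_map (T : 'I_d -> R -> R) (x : 'rV[R]_d) : 'rV[R]_d := \row_i T i (x 0 i).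

(** The rule for nonnegative functions is applied to the positive and negative parts; domination
    keeps their difference meaningful. *)
Lemma rint_map (c : R) (T : 'I_d -> R -> R) g (C : R) : 0 <= c ->
  (forall i, scales_lebesgue c (T i)) -> tmeas g -> (forall x, `|g x| <= C * weight x) ->
  rint (fun x => g (row_map T x)) = c ^+ d * rint g.
Proof.
move=> c0 sT mg gC.
have e (t : d.-tuple R) : row_map T (rowt t) = rowt [tuple T i (tnth t i) | i < d].
  by apply/rowP => i; rewrite !mxE tnth_mktuple.
pose G : d.-tuple R -> \bar R := EFin \o (g \o @rowt R d).
have iG : mu.-integrable setT G := dominated_integrable mg gC.
have mG : measurable_fun setT G := measurable_int _ iG.
have cd0 : 0 <= c ^+ d by rewrite exprn_ge0.
have pG := ge0_integral_tuple_map c0 sT (measurable_funepos mG) (fun t => funepos_ge0 G t).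
have nG := ge0_integral_tuple_map c0 sT (measurable_funeneg mG) (fun t => funeneg_ge0 G t).
rewrite /rint /Rintegral; under eq_integral do rewrite /= e.
rewrite (_ : (\int[mu]_x _)%E = ((c ^+ d)%:E * \int[mu]_t G t)%E); last first.
  rewrite [in LHS]integralE [in RHS]integralE muleBr//; last first.
    by rewrite fin_num_adde_defr// (integrable_pos_fin_num _ iG).
  rewrite -pG -nG; congr (_ - _)%E; apply: eq_integral => t _.
    by rewrite !funeposE.
  by rewrite !funenegE.
by rewrite fineM//; exact: (integrable_fin_num _ iG).
Qed.

Lemma cintegral_map (c : R) (T : 'I_d -> R -> R) f C : 0 <= c ->
  (forall i, scales_lebesgue c (T i)) -> cdom f C ->
  cintegral (fun x => f (row_map T x)) = (c ^+ d)%:C * cintegral f.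
Proof.
move=> c0 sT fC; apply: eq_ReIm.
  rewrite [RHS]cRe_mul !Re_cintegral /= mul0r subr0.
  exact: (rint_map c0 sT fC.1.1 (cdom_Re fC)).
rewrite [RHS]cIm_mul !Im_cintegral /= mul0r addr0.
exact: (rint_map c0 sT fC.1.2 (cdom_Im fC)).
Qed.

Lemma cintegral_affine (a : R) (b : 'rV[R]_d) f C : 0 < a -> cdom f C ->
  cintegral (fun x => f (a *: x + b)) = (a^-1 ^+ d)%:C * cintegral f.
Proof.
move=> a0 fC; rewrite -(cintegral_map _ (fun i => scales_lebesgue_affine (b 0 i) a0) fC).
  by congr cintegral; apply/funext => x; congr f; apply/rowP => i; rewrite !mxE.
by rewrite invr_ge0 ltW.
Qed.

Lemma cintegral_opp f C : cdom f C -> cintegral (fun x => f (- x)) = cintegral f.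
Proof.
move=> fC; have := cintegral_map ler01 (fun i : 'I_d => @scales_lebesgue_opp R) fC.
rewrite expr1n mul1r => <-.
by congr cintegral; apply/funext => x; congr f; apply/rowP => i; rewrite !mxE.
Qed.

End affine_change.

(** * Fubini for dominated kernels *)

Section fubini.
Variables (R : realType) (d : nat).
Local Notation mu := (lebesgue_tuple R d).
Local Notation V := ('rV[R]_d).

Definition tmeas2 (G : V -> V -> R) := measurable_fun [set: d.-tuple R * d.-tuple R]
  (fun p => G (rowt p.1) (rowt p.2)).

Lemma tmeas2_section (G : V -> V -> R) x : tmeas2 G -> tmeas (G (rowt x)).
Proof.
by move=> mG; apply: (measurableT_comp mG (pair1_measurable x)).
Qed.

Lemma tmeas2_section2 (G : V -> V -> R) y : tmeas2 G -> tmeas (fun x => G x (rowt y)).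
Proof.
by move=> mG; apply: (measurableT_comp mG (pair2_measurable y)).
Qed.

Lemma rint_fubini (G : V -> V -> R) (C : R) : tmeas2 G ->
  (forall x y, `|G x y| <= C * (weight x * weight y)) ->
  rint (fun x => rint (G x)) = rint (fun y => rint (fun x => G x y)).
Proof.
move=> mG GC.
pose K : d.-tuple R * d.-tuple R -> \bar R := fun p => (G (rowt p.1) (rowt p.2))%:E.
pose W : d.-tuple R * d.-tuple R -> \bar R := fun p => (C * (weight (rowt p.1) * weight (rowt p.2)))%:E.
have mK : measurable_fun setT K by exact/measurable_EFinP.
have mW : measurable_fun setT W.
  apply/measurable_EFinP; apply: measurable_funM => //; apply: measurable_funM.
    exact: (measurableT_comp (@measurable_weight R d) measurable_fst).
  exact: (measurableT_comp (@measurable_weight R d) measurable_snd).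
have C0 : 0 <= C.
  have w0 := mulr_gt0 (weight_gt0 (0 : V)) (weight_gt0 (0 : V)).
  by rewrite -(pmulr_lge0 _ w0) (le_trans (normr_ge0 _) (GC 0 0)).
have W0 x y : 0 <= C * (weight (rowt x) * weight (rowt y) : R) :> R.
  by rewrite !mulr_ge0 ?weight_ge0.
have eW x y : `|W (x, y)|%E = ((C * weight (rowt x))%:E * (weight (rowt y))%:E)%E.
  by rewrite gee0_abs ?lee_fin ?W0// -EFinM -mulrA.
have iW : (mu \x mu)%E.-integrable setT W.
  apply/(integrable12ltyP _ _ mW).
  rewrite (_ : (\int[mu]_x _)%E = (C * (wint R d * wint R d))%:E) ?ltry//.
  under eq_integral => x _.
    under eq_integral do rewrite eW.
    rewrite ge0_integralZl_EFin//; last 3 first.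
    - by move=> t _; rewrite lee_fin weight_ge0.
    - by apply/measurable_EFinP; exact: measurable_weight.
    - by rewrite mulr_ge0 ?weight_ge0.
    rewrite wintE EFinM -muleA [X in (_ * X)%E]muleC muleA -EFinM EFinM.
    over.
  rewrite ge0_integralZl_EFin//; last 3 first.
  - by move=> t _; rewrite lee_fin weight_ge0.
  - by apply/measurable_EFinP; exact: measurable_weight.
  - by rewrite mulr_ge0 ?wint_ge0.
  by rewrite wintE -EFinM mulrA.
have iK : (mu \x mu)%E.-integrable setT K.
  apply: (le_integrable _ _ _ iW) => //= -[x y] _ /=.
  by rewrite lee_fin [leRHS]ger0_norm ?GC ?W0.
have e1 x : rint (G (rowt x)) = fine (\int[mu]_y K (x, y)).
  by [].
have fin1 x : (\int[mu]_y K (x, y))%E \is a fin_num.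
  have := @dominated_integrable R d (G (rowt x)) (C * weight (rowt x)) (tmeas2_section x mG).
  move=> /(_ _)/(integrable_fin_num measurableT); apply => y.
  by rewrite -mulrA GC.
have fin2 y : (\int[mu]_x K (x, y))%E \is a fin_num.
  have := @dominated_integrable R d (fun x => G x (rowt y)) (C * weight (rowt y)) (tmeas2_section2 y mG).
  move=> /(_ _)/(integrable_fin_num measurableT); apply => x.
  by rewrite -mulrA [weight (rowt y) * _]mulrC GC.
rewrite /rint /Rintegral; apply: (congr1 fine).
transitivity (\int[mu]_x \int[mu]_y K (x, y))%E.
  by apply: eq_integral => x _ /=; rewrite fineK//; exact: fin1.
rewrite (Fubini iK).
by apply: eq_integral => x _ /=; rewrite fineK//; exact: fin2.
Qed.

Definition cmeas2 (G : V -> V -> R[i]) := tmeas2 (fun x y => complex.Re (G x y)) /\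
  tmeas2 (fun x y => complex.Im (G x y)).

Lemma cintegral_fubini (G : V -> V -> R[i]) (C : R) : cmeas2 G ->
  (forall x y, normc (G x y) <= C * (weight x * weight y)) ->
  cintegral (fun x => cintegral (G x)) = cintegral (fun y => cintegral (fun x => G x y)).
Proof.
move=> [m1 m2] GC; apply: eq_ReIm.
  by apply: (rint_fubini m1) => x y; exact: le_trans (ler_Re_normc _) (GC x y).
by apply: (rint_fubini m2) => x y; exact: le_trans (ler_Im_normc _) (GC x y).
Qed.

Lemma cmeas2_fst (f : V -> R[i]) : cmeas f -> cmeas2 (fun x _ => f x).
Proof.
move=> [m1 m2]; split.
  exact: (measurableT_comp m1 measurable_fst).
exact: (measurableT_comp m2 measurable_fst).
Qed.

Lemma cmeas2_snd (f : V -> R[i]) : cmeas f -> cmeas2 (fun _ y => f y).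
Proof.
move=> [m1 m2]; split.
  exact: (measurableT_comp m1 measurable_snd).
exact: (measurableT_comp m2 measurable_snd).
Qed.

Lemma cmeas2M (G H : V -> V -> R[i]) : cmeas2 G -> cmeas2 H -> cmeas2 (fun x y => G x y * H x y).
Proof.
move=> [f1 f2] [h1 h2]; split; rewrite /tmeas2.
- under eq_fun do rewrite cRe_mul.
  by apply: measurable_funB; apply: measurable_funM.
- under eq_fun do rewrite cIm_mul.
  by apply: measurable_funD; apply: measurable_funM.
Qed.

Lemma tmeas2_dot : tmeas2 (@dot R d).
Proof.
apply: measurable_sum => i; apply: measurable_funM.
  under eq_fun do rewrite rowtE.
  exact: (measurableT_comp (measurable_tnth i) measurable_fst).
under eq_fun do rewrite rowtE.
exact: (measurableT_comp (measurable_tnth i) measurable_snd).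
Qed.

Lemma cmeas2_expi (c : R) : cmeas2 (fun x y => expi (c * dot x y)).
Proof.
have m : tmeas2 (fun x y : V => c * dot x y).
  by apply: measurable_funM => //; exact: tmeas2_dot.
split; rewrite /tmeas2/=.
- exact: (measurableT_comp (continuous_measurable_fun (@continuous_cos R)) m).
- exact: (measurableT_comp (continuous_measurable_fun (@continuous_sin R)) m).
Qed.

End fubini.

(** * Positivity and differentiation under the integral sign *)

Section integral_misc.
Variables (R : realType) (d : nat).
Local Notation mu := (lebesgue_tuple R d).
Local Notation V := ('rV[R]_d).

(** Near [x0] the function exceeds [g x0 / 2], and this neighbourhood contains a box of positive
    measure. *)
Lemma rint_gt0 (g : V -> R) (C : R) x0 : continuous g -> (forall x, 0 <= g x) ->
  (forall x, `|g x| <= C * weight x) -> 0 < g x0 -> 0 < rint g.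
Proof.
move=> cg g0 gC gx0.
have mg := tmeas_continuous cg.
have ig := dominated_integrable mg gC.
have : nbhs x0 (g @^-1` [set r | g x0 / 2 < r]).
  by apply: cg; apply: open_nbhs_nbhs; split; [exact: open_gt|rewrite /= ltr_pdivrMr//; lra].
move=> /nbhs_ballP[e /= e0 ball_e].
pose a i := x0 0 i - e / 2; pose b i := x0 0 i + e / 2.
have ab i : a i <= b i by rewrite /a /b; lra.
pose B : set (d.-tuple R) := [set t | forall i, a i <= tnth t i <= b i].
have mB : measurable B.
  rewrite (_ : B = \bigcap_(i in [set: 'I_d]) ((@tnth _ R ^~ i) @^-1` `[a i, b i])).
    apply: fin_bigcap_measurable => // i _.
    by rewrite -[X in measurable X]setTI; exact: measurable_tnth.
  apply/seteqP; split => t H i => [_|]; first by rewrite /= in_itv/=; exact: H.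
  by have := H i Logic.I; rewrite /= in_itv.
have gB t : B t -> g x0 / 2 <= g (rowt t).
  move=> Bt; apply/ltW/ball_e; rewrite -ball_normE /=.
  apply: (@le_lt_trans _ _ (e / 2)); last by rewrite ltr_pdivrMr//; lra.
  apply: norm_le_coord; first by rewrite divr_ge0// ltW.
  by move=> i; rewrite !mxE ler_norml; have := Bt i; rewrite /a /b; lra.
have vB : (0 < mu B)%E.
  rewrite /B lebesgue_tuple_box// lte_fin prodr_gt0// => i _.
  by rewrite /a /b; lra.
have : ((g x0 / 2)%:E * mu B <= \int[mu]_t (g (rowt t))%:E)%E.
  rewrite -(setIT B) -integral_cst//; last exact: measurableI.
  rewrite setIT; apply: (@le_trans _ _ (\int[mu]_(t in B) (g (rowt t))%:E)%E).
    apply: ge0_le_integral => //.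
    - by move=> t _; rewrite lee_fin divr_ge0// ltW.
    - by apply: measurable_funTS; exact: measurable_int ig.
  apply: (ge0_subset_integral mu mB measurableT (measurable_int _ ig)) => // t _.
  by rewrite /= lee_fin g0.
have : (0 < (g x0 / 2)%:E * mu B)%E by rewrite mule_gt0// lte_fin divr_gt0.
move=> /lt_le_trans/[apply].
by rewrite -(fineK (integrable_fin_num measurableT ig)) lte_fin.
Qed.

(** Domination is asked only for |tau| < 1, because translates by unbounded amounts have no common
    multiple of the weight above them. *)
Lemma is_derive_rint (phi phi' : R -> V -> R) (C C' : R) :
  (forall tau, tmeas (phi tau)) ->
  (forall tau x, `|tau| < 1 -> `|phi tau x| <= C * weight x) ->
  (forall tau x, `|tau| < 1 -> is_derive tau (1 : R) (phi ^~ x) (phi' tau x)) ->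
  (forall tau x, `|tau| < 1 -> `|phi' tau x| <= C' * weight x) ->
  is_derive (0 : R) (1 : R) (fun tau => rint (phi tau)) (rint (phi' 0)).
Proof.
move=> mphi phiC dphi phiC'.
have I01 (tau : R) : `]-1, 1[%classic tau -> `|tau| < 1.
  by rewrite /= in_itv/= ltr_norml.
have I0 : `]-1, 1[%classic (0 : R) by rewrite /= in_itv/= ltrN10 ltr01.
pose f (tau : R) (t : d.-tuple R) := phi tau (rowt t).
have C'0 : 0 <= C'.
  have := phiC' 0 0; rewrite normr0 => /(_ ltr01)/(le_trans (normr_ge0 _)).
  by rewrite pmulr_lge0// weight_gt0.
have intf tau : `]-1, 1[%classic tau -> mu.-integrable setT (EFin \o f tau).
  by move=> /I01 t1; apply: (dominated_integrable (mphi tau)) => x; exact: phiC.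
have der tau t : `]-1, 1[%classic tau -> setT t -> derivable (f ^~ t) tau 1.
  by move=> /I01 t1 _; have [] := dphi _ (rowt t) t1.
have d1E tau t : `|tau| < 1 -> partial1of2 f tau t = phi' tau (rowt t).
  by move=> t1; rewrite partial1of2E; have [_ ->] := dphi _ (rowt t) t1.
have ub tau t : `]-1, 1[%classic tau -> setT t -> `|partial1of2 f tau t| <= C' * weight (rowt t).
  by move=> /I01 t1 _; rewrite d1E//; exact: phiC'.
have G0 t : 0 <= C' * weight (@rowt R d t) by rewrite mulr_ge0 ?weight_ge0.
have H := @cvg_differentiation_under_integral R _ _ mu f setT measurableT 0 (-1) 1 I0
  intf der _ G0 (integrable_weight d C') ub.
have e : rint (phi' 0) = \int[mu]_t partial1of2 f 0 t.
  by apply: eq_Rintegral => t _; rewrite d1E ?normr0.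
have eh : (fun h : R => h^-1 *: (rint (phi (h *: 1 + 0)) - rint (phi 0))) =
    (fun h : R => h^-1 *: ((\int[mu]_y f (h + 0) y) - \int[mu]_y f 0 y)).
  by apply/funext => h; rewrite scaler1.
rewrite e; split.
  by rewrite /derivable eh; apply/cvg_ex; eexists; exact: H.
by rewrite /derive eh; apply/cvg_lim => //; exact: H.
Qed.

End integral_misc.

(** * The Fourier transform *)

Section expi.
Variable R : realType.
Implicit Types a b : R.

Lemma normc_expi a : normc (expi a) = 1.
Proof. by rewrite /expi /= cos2Dsin2 sqrtr1. Qed.

Lemma expiD a b : expi (a + b) = expi a * expi b.
Proof. by apply: eq_ReIm; rewrite ?cRe_mul ?cIm_mul/= ?cosD ?sinD// addrC. Qed.

Lemma expi0 : expi 0 = 1 :> R[i].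
Proof. by rewrite /expi cos0 sin0. Qed.

Lemma conjc_expi a : conjc (expi a) = expi (- a).
Proof. by rewrite /expi cosN sinN. Qed.

Lemma is_derive_cos_lin a b (t : R) :
  is_derive t (1 : R) (fun t => cos (a * t + b)) (- (a * sin (a * t + b))).
Proof.
have H : is_derive t (1 : R) (fun t => a * t + b) a.
  rewrite (_ : (fun t => _) = a *: (@id R) + cst b) //.
  by apply: is_derive_eq; rewrite addr0 /GRing.scale/= mulr1.
rewrite mulrC -mulNr.
exact: (@is_derive1_comp _ cos (fun t => a * t + b) t _ _ (is_derive_cos _) H).
Qed.

Lemma is_derive_sin_lin a b (t : R) :
  is_derive t (1 : R) (fun t => sin (a * t + b)) (a * cos (a * t + b)).
Proof.
have H : is_derive t (1 : R) (fun t => a * t + b) a.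
  rewrite (_ : (fun t => _) = a *: (@id R) + cst b) //.
  by apply: is_derive_eq; rewrite addr0 /GRing.scale/= mulr1.
rewrite mulrC.
exact: (@is_derive1_comp _ sin (fun t => a * t + b) t _ _ (is_derive_sin _) H).
Qed.

Lemma is_derive_Re_expi (z : R[i]) a b (t : R) :
  is_derive t (1 : R) (fun t => complex.Re (z * expi (a * t + b)))
    (complex.Re ((0 +i* a) * z * expi (a * t + b))).
Proof.
rewrite (_ : (fun t => _) = complex.Re z *: (fun t => cos (a * t + b))
   + (- complex.Im z) *: (fun t => sin (a * t + b))); last first.
  by apply/funext => u; rewrite cRe_mul -mulNr.
have := is_deriveD (is_deriveZ (complex.Re z) (is_derive_cos_lin a b t))
  (is_deriveZ (- complex.Im z) (is_derive_sin_lin a b t)).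
congr (is_derive _ _ _ _); case: z => u v; rewrite /GRing.scale /=; ring.
Qed.

Lemma is_derive_Im_expi (z : R[i]) a b (t : R) :
  is_derive t (1 : R) (fun t => complex.Im (z * expi (a * t + b)))
    (complex.Im ((0 +i* a) * z * expi (a * t + b))).
Proof.
rewrite (_ : (fun t => _) = complex.Re z *: (fun t => sin (a * t + b))
   + (complex.Im z) *: (fun t => cos (a * t + b))); last first.
  by apply/funext => u; rewrite cIm_mul.
have := is_deriveD (is_deriveZ (complex.Re z) (is_derive_sin_lin a b t))
  (is_deriveZ (complex.Im z) (is_derive_cos_lin a b t)).
congr (is_derive _ _ _ _); case: z => u v; rewrite /GRing.scale /=; ring.
Qed.

End expi.

(** * Characters and smoothness of the Fourier transform *)

Section wave.
Variables (R : realType) (d : nat).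
Local Notation V := ('rV[R]_d).
Implicit Types (f h k : V -> R[i]) (w x : V).

Lemma dotC w x : dot w x = dot x w.
Proof. by apply: eq_bigr => i _; rewrite mulrC. Qed.

Lemma dotDr w x y : dot w (x + y) = dot w x + dot w y.
Proof. by rewrite -big_split; apply: eq_bigr => i _; rewrite mxE mulrDr. Qed.

Lemma dotZr (a : R) w x : dot w (a *: x) = a * dot w x.
Proof. by rewrite mulr_sumr; apply: eq_bigr => i _; rewrite mxE mulrCA. Qed.

Lemma dotNr w x : dot w (- x) = - dot w x.
Proof. by rewrite -sumrN; apply: eq_bigr => i _; rewrite mxE mulrN. Qed.

Lemma dot_dir w i : dot w (dir R i) = w 0 i.
Proof.
rewrite /dot (bigD1 i)//= mxE !eqxx mulr1 big1 ?addr0// => j ji.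
by rewrite mxE (negbTE ji) andbF mulr0.
Qed.

(** The character exp(-2 pi i w.x), symmetric in [w] and [x]. *)
Definition wave w x : R[i] := expi (- (2 * pi * dot w x)).

Lemma fourierE f w : fourier f w = cintegral (fun x => f x * wave w x).
Proof. by []. Qed.

Lemma normc_wave w x : normc (wave w x) = 1.
Proof. exact: normc_expi. Qed.

Lemma waveC w x : wave w x = wave x w.
Proof. by rewrite /wave dotC. Qed.

Lemma waveDr w x y : wave w (x + y) = wave w x * wave w y.
Proof. by rewrite /wave dotDr -expiD mulrDr opprD. Qed.

(** This is -2 pi i: the sign is that of the exponent in [wave]. *)
Definition i2pi : R[i] := 0 +i* (- (2 * pi)).

Lemma normc_i2pi : normc i2pi = 2 * pi.
Proof. by rewrite /= expr0n/= add0r sqrrN sqrtr_sqr ger0_norm// mulr_ge0// pi_ge0. Qed.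

Lemma i2piM (r : R) : i2pi * r%:C = 0 +i* (- (2 * pi * r)).
Proof. by apply: eq_ReIm => /=; ring. Qed.

Lemma is_derive_wave w i x :
  is_derive x (dir R i) (fun x => complex.Re (wave w x))
    (complex.Re (i2pi * (w 0 i)%:C * wave w x)) /\
  is_derive x (dir R i) (fun x => complex.Im (wave w x))
    (complex.Im (i2pi * (w 0 i)%:C * wave w x)).
Proof.
have e (t : R) : wave w (t *: dir R i + x) =
    1 * expi ((- (2 * pi * w 0 i)) * t + - (2 * pi * dot w x)).
  by rewrite mul1r /wave dotDr dotZr dot_dir; congr expi; ring.
have e0 : i2pi * (w 0 i)%:C * wave w x =
    (0 +i* (- (2 * pi * w 0 i))) * 1 * expi ((- (2 * pi * w 0 i)) * 0 + - (2 * pi * dot w x)).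
  by rewrite mulr1 mulr0 add0r /wave; congr (_ * _); apply: eq_ReIm => /=; ring.
split; apply/is_derive_line; rewrite e0.
  by under eq_fun do rewrite e; exact: is_derive_Re_expi.
by under eq_fun do rewrite e; exact: is_derive_Im_expi.
Qed.

Lemma continuous_dot w : continuous (dot w).
Proof.
have : smooth (dot w).
  apply: (@smooth_sum _ _ _ _ _ (fun i x => w 0 i * x 0 i)) => i _.
  by apply: smoothM; [exact: smooth_cst|exact: smooth_coord].
by move/smooth_cont.
Qed.

(** The real and imaginary parts must go through the induction together, since each partial
    derivative of one is a multiple of the other. *)
Lemma csmooth_wave w : csmooth (wave w).
Proof.
have c1 : continuous (fun x => complex.Re (wave w x)).
  move=> x; apply: (@continuous_comp _ _ _ (fun x => - (2 * pi * dot w x)) cos); last exact: continuous_cos.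
  by apply: continuousN; apply: continuousM; [exact: cst_continuous|exact: continuous_dot].
have c2 : continuous (fun x => complex.Im (wave w x)).
  move=> x; apply: (@continuous_comp _ _ _ (fun x => - (2 * pi * dot w x)) sin); last exact: continuous_sin.
  by apply: continuousN; apply: continuousM; [exact: cst_continuous|exact: continuous_dot].
suff H n : Cn n (fun x => complex.Re (wave w x)) /\ Cn n (fun x => complex.Im (wave w x)).
  by apply: csmoothI; apply/smoothP => n; case: (H n).
elim: n => [|n [IH1 IH2]]; first by split; [exact: c1|exact: c2].
have eR (u : R) x : complex.Re (i2pi * u%:C * wave w x) = (2 * pi * u) * complex.Im (wave w x).
  by rewrite /= ; ring.
have eI (u : R) x : complex.Im (i2pi * u%:C * wave w x) = (- (2 * pi * u)) * complex.Re (wave w x).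
  by rewrite /= ; ring.
split; split => [|i x|i].
- exact: c1.
- by case: (is_derive_wave w i x) => -[].
- rewrite (_ : 'D_(dir R i) _ = fun x => (2 * pi * w 0 i) * complex.Im (wave w x)).
    exact: CnM (Cn_cst _ _ _) IH2.
  by apply/funext => x; rewrite -eR; case: (is_derive_wave w i x) => -[].
- exact: c2.
- by case: (is_derive_wave w i x) => _ [].
- rewrite (_ : 'D_(dir R i) _ = fun x => (- (2 * pi * w 0 i)) * complex.Re (wave w x)).
    exact: CnM (Cn_cst _ _ _) IH1.
  by apply/funext => x; rewrite -eI; case: (is_derive_wave w i x) => _ [].
Qed.

Lemma cpart_wave i w : cpart i (wave w) = fun x => i2pi * (w 0 i)%:C * wave w x.
Proof.
apply/funext => x; apply: eq_ReIm.
  by case: (is_derive_wave w i x) => -[].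
by case: (is_derive_wave w i x) => _ [].
Qed.

Lemma cdom_wave f C w : cdom f C -> cdom (fun x => f x * wave w x) C.
Proof.
move=> fC; rewrite -[C]mulr1; apply: cdomM => //.
  exact: cmeas_csmooth (csmooth_wave w).
by move=> x; rewrite normc_wave.
Qed.

Lemma normc_fourier f C w : cdom f C -> normc (fourier f w) <= 2 * (C * wint R d).
Proof. by move=> fC; apply: normc_cintegral; exact: cdom_wave. Qed.

(** The operator that becomes the [i]-th partial derivative after the Fourier transform. *)
Definition mulx i f : V -> R[i] := fun x => i2pi * (x 0 i)%:C * f x.

Lemma is_derive_fourier i f C C' w : cdom f C -> cdom (mulx i f) C' ->
  is_derive w (dir R i) (fun w => complex.Re (fourier f w)) (complex.Re (fourier (mulx i f) w)) /\
  is_derive w (dir R i) (fun w => complex.Im (fourier f w)) (complex.Im (fourier (mulx i f) w)).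
Proof.
move=> fC mC.
have e (t : R) x : f x * wave (t *: dir R i + w) x =
    f x * expi ((- (2 * pi * x 0 i)) * t + - (2 * pi * dot w x)).
  rewrite /wave dotC dotDr dotZr dot_dir [dot x w]dotC; congr (_ * expi _); ring.
have e0 (t : R) x : mulx i f x * wave (t *: dir R i + w) x =
    (0 +i* (- (2 * pi * x 0 i))) * f x * expi ((- (2 * pi * x 0 i)) * t + - (2 * pi * dot w x)).
  by rewrite /mulx i2piM -mulrA e mulrA.
have fd t := cdom_wave (t *: dir R i + w) fC.
have md t := cdom_wave (t *: dir R i + w) mC.
split; apply/is_derive_line; rewrite ?Re_cintegral ?Im_cintegral.
- have := @is_derive_rint R d (fun t x => complex.Re (f x * wave (t *: dir R i + w) x))
    (fun t x => complex.Re (mulx i f x * wave (t *: dir R i + w) x)) C C'.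
  rewrite scale0r add0r; apply.
  + by move=> t; exact: (fd t).1.1.
  + by move=> t x _; exact: (cdom_Re (fd t)).
  + by move=> t x _; rewrite e0; under eq_fun do rewrite e; exact: is_derive_Re_expi.
  + by move=> t x _; exact: (cdom_Re (md t)).
- have := @is_derive_rint R d (fun t x => complex.Im (f x * wave (t *: dir R i + w) x))
    (fun t x => complex.Im (mulx i f x * wave (t *: dir R i + w) x)) C C'.
  rewrite scale0r add0r; apply.
  + by move=> t; exact: (fd t).1.2.
  + by move=> t x _; exact: (cdom_Im (fd t)).
  + by move=> t x _; rewrite e0; under eq_fun do rewrite e; exact: is_derive_Im_expi.
  + by move=> t x _; exact: (cdom_Im (md t)).
Qed.

Lemma lipschitz_continuous (g : V -> R) (K : R) :
  (forall x y, `|g y - g x| <= K * `|y - x|) -> continuous g.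
Proof.
move=> gK x; apply/(@cvgrPdist_le _ _ _ (nbhs x)) => e e0.
have K1 : 0 < `|K| + 1 by rewrite ltr_wpDl.
have := nbhsx_ballx x _ (divr_gt0 e0 K1); apply: filterS => y.
rewrite -ball_normE /= distrC => /ltW; rewrite ler_pdivlMr// => h.
rewrite distrC (le_trans (gK x y))// (le_trans _ h)// mulrC ler_wpM2l//.
by rewrite (le_trans (ler_norm _))// lerDl.
Qed.

Lemma normc_iter_coord i s (x : V) :
  normc (iter_cpartial s (fun x => (x 0 i)%:C) x) <= 1 * (1 + `|x|) ^+ 1.
Proof.
rewrite mul1r expr1; case/lastP: s => [|s j].
  by rewrite iter_cpartial_nil normc_real (le_trans (ler_coord_norm x i))// lerDr.
rewrite iter_cpartial_rcons.
have -> : cpart j (fun x : V => (x 0 i)%:C) = fun _ => (dir R j 0 i)%:C.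
  apply/funext => y; apply: eq_ReIm; last exact: derive_cst.
  by have [_] := is_derive_coord y (dir R j) i.
have [->|s0] := eqVneq s [::]; last by rewrite iter_cpartial_cst// normc0 wt_ge0.
rewrite iter_cpartial_nil normc_real mxE (le_trans _ (wt_ge1 x))//.
by case: (_ && _); rewrite ?normr1 ?normr0.
Qed.

Lemma csmooth_coord i : csmooth (fun x : V => (x 0 i)%:C).
Proof. exact/csmooth_real/smooth_coord. Qed.

Lemma sb_mulx m i f b : csmooth f -> sb m.+1 f b -> sb m (mulx i f) (2 * pi * (2 ^+ m * b)).
Proof.
move=> sf fb; rewrite -normc_i2pi.
rewrite (_ : mulx i f = fun x => i2pi * ((x 0 i)%:C * f x)); last first.
  by apply/funext => x; rewrite /mulx mulrA.
apply: sbZ; first exact: csmoothM (csmooth_coord i) sf.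
rewrite -[b]mul1r; apply: (sbM (k := 1) sf (csmooth_coord i)); last by rewrite addn1.
by move=> s x _; exact: normc_iter_coord.
Qed.

Lemma schwartz_mulx i f : schwartz f -> schwartz (mulx i f).
Proof.
move=> Sf; have sf := schwartz_csmooth Sf; apply: schwartzI.
  exact: csmoothM (csmoothM (csmooth_cst d _) (csmooth_coord i)) sf.
by move=> m; have [b fb] := schwartz_sb m.+1 Sf; eexists; exact: (sb_mulx i sf fb).
Qed.

Lemma is_derive_fourier_schwartz i f w : schwartz f ->
  is_derive w (dir R i) (fun w => complex.Re (fourier f w)) (complex.Re (fourier (mulx i f) w)) /\
  is_derive w (dir R i) (fun w => complex.Im (fourier f w)) (complex.Im (fourier (mulx i f) w)).
Proof.
move=> Sf; have [C fC] := schwartz_cdom Sf.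
have [C' mC] := schwartz_cdom (schwartz_mulx i Sf).
exact: is_derive_fourier fC mC.
Qed.

Lemma cpart_fourier i f : schwartz f -> cpart i (fourier f) = fourier (mulx i f).
Proof.
move=> Sf; apply/funext => w; apply: eq_ReIm.
  by case: (is_derive_fourier_schwartz i w Sf) => -[].
by case: (is_derive_fourier_schwartz i w Sf) => _ [].
Qed.

(** Existence of partial derivatives does not give continuity. Here they are bounded, being
    transforms of [mulx i f], so the transform is Lipschitz by the mean value bound. *)
Lemma fourier_continuous f : schwartz f ->
  continuous (fun w => complex.Re (fourier f w)) /\ continuous (fun w => complex.Im (fourier f w)).
Proof.
move=> Sf.
have /choice[C mC] : forall i, exists C, cdom (mulx i f) C.
  by move=> i; exact: schwartz_cdom (schwartz_mulx i Sf).
pose B := \sum_i `|2 * (C i * wint R d)|.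
have B0 : 0 <= B by rewrite sumr_ge0.
have CB i w : normc (fourier (mulx i f) w) <= B.
  rewrite (le_trans (normc_fourier w (mC i)))// (le_trans (ler_norm _))//.
  by rewrite /B (bigD1 i)//= lerDl sumr_ge0.
split; apply: (@lipschitz_continuous _ (d%:R * B)) => x y.
  apply: (@mvt_box _ _ (fun w => complex.Re (fourier f w)) x y B _ B0) => i z.
    by case: (is_derive_fourier_schwartz i z Sf) => -[].
  case: (is_derive_fourier_schwartz i z Sf) => -[_ ->] _ _.
  exact: le_trans (ler_Re_normc _) (CB i z).
apply: (@mvt_box _ _ (fun w => complex.Im (fourier f w)) x y B _ B0) => i z.
  by case: (is_derive_fourier_schwartz i z Sf) => _ [].
case: (is_derive_fourier_schwartz i z Sf) => _ [_ ->] _.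
exact: le_trans (ler_Im_normc _) (CB i z).
Qed.

Lemma csmooth_fourier f : schwartz f -> csmooth (fourier f).
Proof.
suff H n : forall f, schwartz f -> Cn n (fun w => complex.Re (fourier f w)) /\
    Cn n (fun w => complex.Im (fourier f w)).
  by move=> Sf; apply: csmoothI; apply/smoothP => n; case: (H n _ Sf).
elim: n => [|n IH] {}f Sf; first exact: fourier_continuous.
have [c1 c2] := fourier_continuous Sf.
have E i := IH _ (schwartz_mulx i Sf).
split; split => [|i x|i].
- exact: c1.
- by case: (is_derive_fourier_schwartz i x Sf) => -[].
- rewrite (_ : 'D_(dir R i) _ = fun w => complex.Re (fourier (mulx i f) w)).
    by case: (E i).
  by apply/funext => x; case: (is_derive_fourier_schwartz i x Sf) => -[].
- exact: c2.
- by case: (is_derive_fourier_schwartz i x Sf) => _ [].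
- rewrite (_ : 'D_(dir R i) _ = fun w => complex.Im (fourier (mulx i f) w)).
    by case: (E i).
  by apply/funext => x; case: (is_derive_fourier_schwartz i x Sf) => _ [].
Qed.

Definition mulxs (s : seq 'I_d) f := foldr mulx f s.

Lemma schwartz_mulxs s f : schwartz f -> schwartz (mulxs s f).
Proof. by move=> Sf; elim: s => //= i s IH; exact: schwartz_mulx. Qed.

Lemma iter_cpartial_fourier s f : schwartz f ->
  iter_cpartial s (fourier f) = fourier (mulxs s f).
Proof.
elim/last_ind: s f => [|s i IH] f Sf; first by rewrite iter_cpartial_nil.
rewrite iter_cpartial_rcons (cpart_fourier i Sf) (IH _ (schwartz_mulx i Sf)).
by rewrite /mulxs foldr_rcons.
Qed.

End wave.

(** * The Fourier transform on the Schwartz space *)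

Section fourier_schwartz.
Variables (R : realType) (d : nat).
Local Notation V := ('rV[R]_d).
Implicit Types (f h k : V -> R[i]) (w x : V).

Lemma normc_is_derive f i x : csmooth f ->
  is_derive x (dir R i) (fun x => complex.Re (f x)) (complex.Re (cpart i f x)) /\
  is_derive x (dir R i) (fun x => complex.Im (f x)) (complex.Im (cpart i f x)).
Proof.
move=> sf; split; apply: smooth_is_derive.
  exact: csmooth_Re.
exact: csmooth_Im.
Qed.

(* Translation invariance makes the integral of [k (t e_i + x)] independent of [t]. *)
Lemma cintegral_cpart i k (C : R) : csmooth k ->
  (forall x, (1 + `|x|) ^+ (d + d) * normc (k x) <= C) ->
  (forall x, (1 + `|x|) ^+ (d + d) * normc (cpart i k x) <= C) ->
  cintegral (cpart i k) = 0.
Proof.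
move=> sk kC dC.
have C0 : 0 <= C by apply: le_trans (kC 0); rewrite mulr_ge0 ?normc_ge0 ?wt_pow_ge0.
have dir1 : `|dir R i| <= 1.
  apply: norm_le_coord => // j; rewrite mxE.
  by case: (_ && _); rewrite ?normr1 ?normr0.
have dom (u : V -> R[i]) : csmooth u -> (forall x, (1 + `|x|) ^+ (d + d) * normc (u x) <= C) ->
    forall t : R, `|t| < 1 -> cdom (fun x => u (t *: dir R i + x)) (2 ^+ (d + d) * C).
  move=> su uC t t1; split.
    apply: cmeas_csmooth; have := csmooth_affine 1 (t *: dir R i) su.
    by under eq_fun do rewrite scale1r addrC.
  move=> x; set y := t *: _ + x.
  (* A shift of norm at most 1 changes the weight by a factor at most 2, so one constant dominates
     all translates with |t| < 1. *)
  have xy : 1 + `|x| <= 2 * (1 + `|y|).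
    have -> : x = y - t *: dir R i by rewrite /y [_ + x]addrC addrK.
    have := ler_normB y (t *: dir R i); rewrite normrZ.
    have := normr_ge0 y; have := normr_ge0 t; have := normr_ge0 (dir R i).
    move: t1 dir1; move: `|t| `|dir R i| `|y| `|y - t *: dir R i| => a b c e; nra.
  apply: (@le_trans _ _ (2 ^+ (d + d) * C * ((1 + `|x|) ^+ (d + d))^-1)); last first.
    by rewrite ler_wpM2l ?mulr_ge0 ?exprn_ge0 ?wt_le_weight.
  rewrite ler_pdivlMr ?exprn_gt0 ?wt_gt0// mulrC.
  apply: (@le_trans _ _ ((2 * (1 + `|y|)) ^+ (d + d) * normc (u y))).
    by rewrite ler_wpM2r ?normc_ge0// lerXn2r ?nnegrE ?mulr_ge0 ?wt_ge0.
  by rewrite exprMn -mulrA ler_wpM2l ?exprn_ge0// uC.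
have line (x : V) (t : R) := normc_is_derive i (t *: dir R i + x) sk.
have tr (t : R) : cintegral (fun x => k (t *: dir R i + x)) = cintegral k.
  have [C1 H] : exists C1, cdom k C1.
    exists (2 ^+ (d + d) * C); have := dom k sk kC 0; rewrite normr0 => /(_ ltr01).
    by rewrite scale0r; under eq_fun do rewrite add0r.
  have := cintegral_affine (t *: dir R i) ltr01 H; rewrite invr1 expr1n mul1r => <-.
  by congr cintegral; apply/funext => x; rewrite scale1r addrC.
have tm (u : V -> R[i]) t : csmooth u -> cmeas (fun x => u (t *: dir R i + x)).
  move=> su; apply: cmeas_csmooth; have := csmooth_affine 1 (t *: dir R i) su.
  by under eq_fun do rewrite scale1r addrC.
have sd := csmooth_cpart i sk.
apply: eq_ReIm.
- have := @is_derive_rint R d (fun t x => complex.Re (k (t *: dir R i + x)))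
    (fun t x => complex.Re (cpart i k (t *: dir R i + x))) (2 ^+ (d + d) * C) (2 ^+ (d + d) * C).
  move=> /(_ (fun t => (tm k t sk).1)) /(_ (fun t x t1 => cdom_Re (dom k sk kC t t1) x)).
  move=> /(_ (fun t x t1 => is_derive_line_at (line x t).1)).
  move=> /(_ (fun t x t1 => cdom_Re (dom _ sd dC t t1) x)).
  have -> : (fun t => rint (fun x => complex.Re (k (t *: dir R i + x)))) =
      cst (complex.Re (cintegral k)).
    by apply/funext => t; rewrite -(tr t).
  move=> [_]; rewrite derive_cst => e0; rewrite Re_cintegral [RHS]e0; congr rint.
  by apply/funext => x; rewrite scale0r add0r.
- have := @is_derive_rint R d (fun t x => complex.Im (k (t *: dir R i + x)))
    (fun t x => complex.Im (cpart i k (t *: dir R i + x))) (2 ^+ (d + d) * C) (2 ^+ (d + d) * C).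
  move=> /(_ (fun t => (tm k t sk).2)) /(_ (fun t x t1 => cdom_Im (dom k sk kC t t1) x)).
  move=> /(_ (fun t x t1 => is_derive_line_at (line x t).2)).
  move=> /(_ (fun t x t1 => cdom_Im (dom _ sd dC t t1) x)).
  have -> : (fun t => rint (fun x => complex.Im (k (t *: dir R i + x)))) =
      cst (complex.Im (cintegral k)).
    by apply/funext => t; rewrite -(tr t).
  move=> [_]; rewrite derive_cst => e0; rewrite Im_cintegral [RHS]e0; congr rint.
  by apply/funext => x; rewrite scale0r add0r.
Qed.

(** Integration by parts: the integral of the [i]-th derivative of [f * wave w] vanishes. *)
Lemma fourier_cpart i f w : schwartz f ->
  fourier (cpart i f) w = - (i2pi R * (w 0 i)%:C) * fourier f w.
Proof.
move=> Sf; have sf := schwartz_csmooth Sf.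
have [b fb] := schwartz_sb (d + d).+1 Sf.
pose c := i2pi R * (w 0 i)%:C.
have b0 := sb_ge0 fb.
have H : cintegral (cpart i (fun x => f x * wave w x)) = 0.
  apply: (@cintegral_cpart i _ (b + b * normc c)).
  - exact: csmoothM sf (csmooth_wave w).
  - move=> x; rewrite normcM normc_wave mulr1 (@le_trans _ _ b)//.
      by have := sb_le (leqnSn _) (lexx b) fb (s := [::]) x isT; rewrite iter_cpartial_nil.
    by rewrite lerDl mulr_ge0 ?normc_ge0.
  - move=> x; rewrite (cpartM i sf (csmooth_wave w)) cpart_wave.
    rewrite (le_trans (ler_wpM2l (wt_pow_ge0 x _) (normcD _ _)))// mulrDr lerD//.
      rewrite normcM normc_wave mulr1.
      by have := sb_cpart i fb (s := [::]) x isT; rewrite iter_cpartial_nil.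
    rewrite !normcM normc_wave mulr1 -normcM mulrA ler_wpM2r ?normc_ge0//.
    by have := sb_le (leqnSn _) (lexx b) fb (s := [::]) x isT; rewrite iter_cpartial_nil.
have [C fC] := schwartz_cdom Sf; have [C' dC] := schwartz_cdom (schwartz_cpart i Sf).
move: H; rewrite (cpartM i sf (csmooth_wave w)) cpart_wave.
under [X in cintegral X]eq_fun do rewrite [f _ * _]mulrCA.
rewrite (cintegralD (cdom_wave w dC) (cdomZ c (cdom_wave w fC))).
rewrite (cintegralZ _ (cdom_wave w fC)) -!fourierE -/c => /eqP.
by rewrite addr_eq0 mulNr => /eqP.
Qed.

(** Continuity on the Schwartz space in terms of [sb], in a form stable under composition; [C] does
    not depend on [f]. *)
Definition bounded_op (T : (V -> R[i]) -> V -> R[i]) :=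
  (forall f, schwartz f -> schwartz (T f)) /\
  forall m, exists m' (C : R), 0 <= C /\
    forall f b, schwartz f -> sb m' f b -> sb m (T f) (C * b).

Lemma bounded_op_id : bounded_op (fun f => f).
Proof. by split=> // m; exists m, 1; split=> // f b _; rewrite mul1r. Qed.

Lemma bounded_op_comp T1 T2 : bounded_op T1 -> bounded_op T2 -> bounded_op (T1 \o T2).
Proof.
move=> [S1 B1] [S2 B2]; split=> [f Sf|m]; first exact/S1/S2.
have [m1 [C1 [C10 H1]]] := B1 m; have [m2 [C2 [C20 H2]]] := B2 m1.
exists m2, (C1 * C2); split; first exact: mulr_ge0.
by move=> f b Sf fb; rewrite -mulrA; apply: (H1 _ _ (S2 _ Sf)); exact: H2.
Qed.

Lemma bounded_op_cpart i : bounded_op (cpart i).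
Proof.
split=> [f|m]; first exact: schwartz_cpart.
by exists m.+1, 1; split=> // f b _ fb; rewrite mul1r; exact: sb_cpart.
Qed.

Lemma bounded_op_mulx i : bounded_op (mulx i).
Proof.
split=> [f|m]; first exact: schwartz_mulx.
exists m.+1, (2 * pi * 2 ^+ m); split; first by rewrite !mulr_ge0 ?pi_ge0 ?exprn_ge0.
move=> f b Sf fb; rewrite -mulrA; exact: (sb_mulx i (schwartz_csmooth Sf) fb).
Qed.

Lemma bounded_op_iter T n : bounded_op T -> bounded_op (iter n T).
Proof.
move=> BT; elim: n => [|n IH]; first exact: bounded_op_id.
exact: (bounded_op_comp BT IH).
Qed.

Lemma bounded_op_mulxs s : bounded_op (mulxs s).
Proof.
elim: s => [|i s IH]; first exact: bounded_op_id.
exact: (bounded_op_comp (bounded_op_mulx i) IH).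
Qed.

Lemma fourier_sup f b w : schwartz f -> sb (d + d) f b -> normc (fourier f w) <= 2 * (b * wint R d).
Proof.
by move=> Sf fb; apply: normc_fourier; exact: (sb_cdom (schwartz_csmooth Sf) (leqnn _) fb).
Qed.

Lemma two_pi_ge1 : 1 <= 2 * pi :> R.
Proof. by have := @pi_ge2 R; lra. Qed.

(** Each derivative contributes a factor 2 pi |w_i|, and 2 pi >= 1. *)
Lemma fourier_coord_pow f i n w : schwartz f ->
  `|w 0 i| ^+ n * normc (fourier f w) <= normc (fourier (iter n (cpart i) f) w).
Proof.
move=> Sf; elim: n => [|n IH]; first by rewrite expr0 mul1r.
have Sn : schwartz (iter n (cpart i) f) := (bounded_op_iter n (bounded_op_cpart i)).1 _ Sf.
rewrite iterS (fourier_cpart i w Sn) normcM normcN normcM normc_i2pi normc_real exprS -mulrA.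
apply: (le_trans (ler_wpM2l (normr_ge0 _) IH)).
by rewrite -[leRHS]mulrA ler_peMl ?two_pi_ge1// mulr_ge0 ?normc_ge0.
Qed.

Lemma uniform_order (T : eqType) (r : seq T) (P : T -> nat -> R -> Prop) :
  (forall s m m' C C', (m <= m')%N -> C <= C' -> P s m C -> P s m' C') ->
  (forall s, exists m C, 0 <= C /\ P s m C) ->
  exists m C, 0 <= C /\ forall s, s \in r -> P s m C.
Proof.
move=> mono H; elim: r => [|s r [m [C [C0 IH]]]]; first by exists 0%N, 0.
have [m' [C' [C'0 Hs]]] := H s.
exists (maxn m m'), (C + C'); split; first exact: addr_ge0.
move=> u; rewrite in_cons => /orP[/eqP ->|/IH Hu].
  by apply: mono Hs; [exact: leq_maxr|rewrite lerDr].
by apply: mono Hu; [exact: leq_maxl|rewrite lerDl].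
Qed.

(** Derivatives of the transform are multiplications before it, and powers of [w] are derivatives
    before it; what remains is a supremum bounded by an integral. Uniformity in [f] lets
    approximations pass through the transform. *)
Lemma fourier_sb m : exists m' (C : R), 0 <= C /\
  forall f b, schwartz f -> sb m' f b -> sb m (fourier f) (C * b).
Proof.
pose P (s : seq 'I_d) m' (C : R) := forall f b, schwartz f -> sb m' f b -> forall w,
  (1 + `|w|) ^+ m * normc (fourier (mulxs s f) w) <= C * b.
suff [m' [C [C0 H]]] : exists m' (C : R), 0 <= C /\ forall s, s \in seqs_upto 'I_d m -> P s m' C.
  exists m', C; split=> // f b Sf fb s w sm; rewrite (iter_cpartial_fourier s Sf).
  exact: (H s (mem_seqs_upto sm)).
apply: uniform_order.
  move=> s m1 m2 C C' m12 CC H f b Sf fb w.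
  have fb1 := sb_le m12 (lexx b) fb.
  by rewrite (le_trans (H f b Sf fb1 w))// ler_wpM2r// (sb_ge0 fb).
move=> s.
pose Q (i : 'I_d) m' (C : R) := forall f b, schwartz f -> sb m' f b -> forall w,
  `|w 0 i| ^+ m * normc (fourier (mulxs s f) w) <= C * b.
have [m1 [C1 [C10 H1]]] : exists m' (C : R), 0 <= C /\ forall i, i \in enum 'I_d -> Q i m' C.
  apply: uniform_order.
    move=> i m1 m2 C C' m12 CC H f b Sf fb w.
    have fb1 := sb_le m12 (lexx b) fb.
    by rewrite (le_trans (H f b Sf fb1 w))// ler_wpM2r// (sb_ge0 fb).
  move=> i.
  have [S1 B1] := bounded_op_comp (bounded_op_iter m (bounded_op_cpart i)) (bounded_op_mulxs s).
  have [m' [C [C0 H]]] := B1 (d + d)%N.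
  exists m', (2 * (C * wint R d)); split; first by rewrite !mulr_ge0 ?wint_ge0.
  move=> f b Sf fb w.
  rewrite (le_trans (fourier_coord_pow i m w (schwartz_mulxs s Sf)))//.
  rewrite (le_trans (fourier_sup w (S1 _ Sf) (H _ _ Sf fb)))//.
  by rewrite (_ : 2 * (C * b * wint R d) = 2 * (C * wint R d) * b)//; ring.
have [m2 [C2 [C20 H2]]] := (bounded_op_mulxs s).2 (d + d)%N.
exists (maxn m1 m2), (2 ^+ m * (2 * (C2 * wint R d) + \sum_(i < d) C1)); split.
  rewrite mulr_ge0 ?exprn_ge0// addr_ge0 ?mulr_ge0 ?wint_ge0//.
  by rewrite sumr_ge0.
move=> f b Sf fb w.
have fb1 := sb_le (leq_maxl m1 m2) (lexx b) fb.
have fb2 := sb_le (leq_maxr m1 m2) (lexx b) fb.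
rewrite (le_trans (ler_wpM2r (normc_ge0 _) (wt_pow_bound w m)))//.
rewrite -[leLHS]mulrA -[leRHS]mulrA ler_wpM2l ?exprn_ge0// [leLHS]mulrDl [leRHS]mulrDl mul1r lerD//.
  rewrite (le_trans (fourier_sup w (schwartz_mulxs s Sf) (H2 _ _ Sf fb2)))//.
  by rewrite (_ : 2 * (C2 * b * wint R d) = 2 * (C2 * wint R d) * b)//; ring.
rewrite !mulr_suml ler_sum// => i _.
by apply: H1 fb1 w; rewrite ?mem_enum.
Qed.

Lemma schwartz_fourier f : schwartz f -> schwartz (fourier f).
Proof.
move=> Sf; apply: schwartzI; first exact: csmooth_fourier.
move=> m; have [m' [C [C0 H]]] := fourier_sb m; have [b fb] := schwartz_sb m' Sf.
by exists (C * b); exact: H.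
Qed.

(** Fubini for [f x * k w * wave w x], whose kernel is symmetric. *)
Lemma fourier_mul_formula f k C C' : cdom f C -> cdom k C' ->
  cintegral (fun w => fourier f w * k w) = cintegral (fun x => f x * fourier k x).
Proof.
move=> fC kC.
pose G w x := f x * k w * wave w x.
transitivity (cintegral (fun w => cintegral (G w))).
  congr cintegral; apply/funext => w; rewrite fourierE mulrC -(cintegralZ _ (cdom_wave w fC)).
  by congr cintegral; apply/funext => x; rewrite /G mulrCA mulrA.
rewrite (@cintegral_fubini R d G (C * C')).
- congr cintegral; apply/funext => x; rewrite fourierE -(cintegralZ _ (cdom_wave x kC)).
  by congr cintegral; apply/funext => w; rewrite /G waveC mulrA.
- apply: cmeas2M.
    by apply: cmeas2M; [exact: cmeas2_snd fC.1|exact: cmeas2_fst kC.1].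
  have := @cmeas2_expi R d (- (2 * pi)).
  congr cmeas2; apply/funext => w; apply/funext => x; by rewrite /wave mulNr.
- move=> w x; rewrite !normcM normc_wave mulr1.
  rewrite (_ : C * C' * _ = (C * weight x) * (C' * weight w)); last by ring.
  by rewrite ler_pM ?normc_ge0 ?fC.2 ?kC.2.
Qed.

Lemma fourier_affine f (a : R) (b w : V) C : 0 < a -> cdom f C ->
  fourier (fun x => f (a *: x + b)) w =
  (a^-1 ^+ d)%:C * (wave w (- (a^-1 *: b)) * fourier f (a^-1 *: w)).
Proof.
move=> a0 fC; have an0 : a != 0 by rewrite gt_eqF.
pose h y := wave w (- (a^-1 *: b)) * (f y * wave (a^-1 *: w) y).
have hC : cdom h (normc (wave w (- (a^-1 *: b))) * C) := cdomZ _ (cdom_wave _ fC).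
rewrite !fourierE -(cintegralZ _ (cdom_wave _ fC)) -(cintegral_affine b a0 hC).
congr cintegral; apply/funext => x; rewrite /h mulrCA; congr (_ * _).
have e y : wave (a^-1 *: w) y = wave w (a^-1 *: y).
  by rewrite /wave dotC dotZr dotZr dotC.
by rewrite e -waveDr scalerDr scalerA mulVf// scale1r addrC addrK.
Qed.

Lemma dotNl w x : dot (- w) x = - dot w x.
Proof. by rewrite dotC dotNr dotC. Qed.

Lemma fourier_opp f w C : cdom f C -> fourier (fun x => f (- x)) w = fourier f (- w).
Proof.
move=> fC; rewrite !fourierE -(cintegral_opp (cdom_wave (- w) fC)).
by congr cintegral; apply/funext => x; rewrite /wave dotNr dotNl opprK.
Qed.

Lemma cintegralJ f C : cdom f C -> cintegral (fun x => conjc (f x)) = conjc (cintegral f).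
Proof.
move=> fC; apply: eq_ReIm.
  transitivity (complex.Re (cintegral f)); last by case: (cintegral f).
  by apply: eq_Rintegral => t _; case: (f _).
transitivity (- complex.Im (cintegral f)); last by case: (cintegral f).
rewrite -mulN1r; apply: (etrans _ (RintegralZl (-1) measurableT (cdom_integrable_Im fC))).
by apply: eq_Rintegral => t _ /=; rewrite mulN1r /rowt; case: (f _).
Qed.

Lemma fourierJ f w C : cdom f C -> fourier (fun x => conjc (f x)) w = conjc (fourier f (- w)).
Proof.
move=> fC; rewrite !fourierE -(cintegralJ (cdom_wave (- w) fC)).
have cM (a b : R[i]) : conjc (a * b) = conjc a * conjc b by exact: rmorphM.
congr cintegral; apply/funext => x; rewrite cM /wave conjc_expi.
by rewrite dotNl mulrN opprK.
Qed.

End fourier_schwartz.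

(** * Fourier inversion *)

Section inversion.
Variables (R : realType) (d : nat).
Local Notation V := ('rV[R]_d).
Implicit Types (f g h k : V -> R[i]) (w x : V).

Lemma schwartz_opp f : schwartz f -> schwartz (fun x => f (- x)).
Proof.
move=> Sf; have := @schwartz_affine R d f (-1) 0 _ Sf.
rewrite oppr_eq0 oner_eq0 => /(_ isT).
by under eq_fun do rewrite scaleN1r addr0.
Qed.

Lemma schwartz_translate f t : schwartz f -> schwartz (fun x => f (x - t)).
Proof.
move=> Sf; have := @schwartz_affine R d f 1 (- t) _ Sf.
rewrite oner_eq0 => /(_ isT).
by under eq_fun do rewrite scale1r.
Qed.

(** The real and imaginary parts are estimated apart, whence the factor 2. *)
Lemma csmooth_mvt f (B : R) (x y : V) : csmooth f -> 0 <= B ->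
  (forall i (z : V), (forall j, Num.min (x 0 j) (y 0 j) <= z 0 j <= Num.max (x 0 j) (y 0 j)) ->
    normc (cpart i f z) <= B) ->
  normc (f y - f x) <= 2 * (d%:R * B * `|y - x|).
Proof.
move=> sf B0 fB; apply: (le_trans (normc_le_ReIm _)).
have subRe (a b : R[i]) : complex.Re (a - b) = complex.Re a - complex.Re b.
  by case: a b => a1 a2 [b1 b2].
have subIm (a b : R[i]) : complex.Im (a - b) = complex.Im a - complex.Im b.
  by case: a b => a1 a2 [b1 b2].
rewrite mulr_natl mulr2n lerD// ?subRe ?subIm.
  apply: (@mvt_box _ _ (fun x => complex.Re (f x))) => // i z.
    by apply: smooth_derivable; exact: csmooth_Re.
  by move=> /(fB i); apply: le_trans; exact: (ler_Re_normc (cpart i f z)).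
apply: (@mvt_box _ _ (fun x => complex.Im (f x))) => // i z.
  by apply: smooth_derivable; exact: csmooth_Im.
by move=> /(fB i); apply: le_trans; exact: (ler_Im_normc (cpart i f z)).
Qed.

Lemma schwartz_lipschitz f : schwartz f ->
  exists2 K : R, 0 <= K & forall x y, normc (f y - f x) <= K * `|y - x|.
Proof.
move=> Sf; have [b fb] := schwartz_sb 1 Sf; have b0 := sb_ge0 fb.
exists (2 * (d%:R * b)); first by rewrite !mulr_ge0.
move=> x y; rewrite -[leRHS]mulrA; apply: csmooth_mvt => //; first exact: schwartz_csmooth.
by move=> i z _; have := sb_sup (s := [:: i]) z fb isT; rewrite iter_cpartial_cons iter_cpartial_nil.
Qed.

(** [b] is Lipschitz, so replacing [b (e w)] by [b 0] costs a multiple of e |w|; one order of decay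
    of [a] beyond [d + d] absorbs |w|. *)
Lemma cintegral_dilate a b : schwartz a -> schwartz b -> exists K : R, forall e : R, 0 < e ->
  normc (cintegral (fun w => a w * b (e *: w)) - b 0 * cintegral a) <= e * K.
Proof.
move=> Sa Sb; have [K K0 bK] := schwartz_lipschitz Sb.
have [C aC] := schwartz_sb (d + d).+1 Sa; have C0 := sb_ge0 aC.
have [A aA] := schwartz_cdom Sa; have [B bB] := schwartz_sb 0 Sb.
exists (2 * (K * C * wint R d)) => e e0.
have sbe : csmooth (fun w => b (e *: w)).
  by have := csmooth_affine e 0 (schwartz_csmooth Sb); under eq_fun do rewrite addr0.
have ab : cdom (fun w => a w * b (e *: w)) (A * B).
  apply: cdomM aA (cmeas_csmooth sbe) _ => x.
  by have := sb_sup (s := [::]) (e *: x) bB isT; rewrite iter_cpartial_nil.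
have ba := cdomZ (- b 0) aA.
rewrite -mulNr -(cintegralZ _ aA) -(cintegralD ab ba).
have -> : e * (2 * (K * C * wint R d)) = 2 * (e * K * C * wint R d) by ring.
apply: normc_cintegral; split; first exact: cmeasD ab.1 ba.1.
move=> x; have -> : a x * b (e *: x) + - b 0 * a x = (b (e *: x) - b 0) * a x by ring.
rewrite normcM.
apply: (le_trans (ler_wpM2r (normc_ge0 _) (bK _ _))).
rewrite subr0 normrZ (gtr0_norm e0).
have -> : K * (e * `|x|) * normc (a x) = (e * K) * (`|x| * normc (a x)) by ring.
rewrite -[leRHS]mulrA ler_wpM2l ?mulr_ge0 ?(ltW e0)//.
have := sb_at (s := [::]) x aC isT; rewrite iter_cpartial_nil => aCx.
apply: (le_trans (ler_wpM2l (normr_ge0 x) aCx)).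
rewrite mulrCA ler_wpM2l//; apply: le_trans (wt_le_weight x).
rewrite exprSr invfM mulrCA -[leRHS]mulr1 ler_wpM2l ?invr_ge0 ?wt_pow_ge0//.
by rewrite ler_pdivrMr ?wt_gt0// mul1r lerDr.
Qed.

Lemma le_eps_eq0 (z : R[i]) (K : R) : (forall e : R, 0 < e -> normc z <= e * K) -> z = 0.
Proof.
move=> H; apply/eqP; rewrite -normc_eq0 eq_le normc_ge0 andbT.
have K1 : 0 < `|K| + 1 by rewrite ltr_wpDl.
apply/ler_addgt0Pl => e e0; rewrite addr0.
apply: (le_trans (H _ (divr_gt0 e0 K1))).
rewrite -mulrA ger_pMr// mulrC ler_pdivrMr// mul1r.
by rewrite (le_trans (ler_norm _))// lerDl.
Qed.

(** Inversion at the origin up to a constant. The multiplication formula for [h] and the dilate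
    [g (e w)], followed by a dilation of the variable, gives the identity [E], in which [g] and [h]
    exchange roles; then [e] tends to 0. *)
Lemma fourier_fourier0 g h : schwartz g -> schwartz h ->
  g 0 * cintegral (fourier h) = h 0 * cintegral (fourier g).
Proof.
move=> Sg Sh; have SFg := schwartz_fourier Sg; have SFh := schwartz_fourier Sh.
have [K1 H1] := cintegral_dilate SFh Sg; have [K2 H2] := cintegral_dilate SFg Sh.
apply/eqP; rewrite -subr_eq0; apply/eqP/(@le_eps_eq0 _ (K1 + K2)) => e e0.
have E : cintegral (fun w => fourier h w * g (e *: w)) = cintegral (fun z => fourier g z * h (e *: z)).
  have e1 : e^-1 != 0 by rewrite invr_eq0 gt_eqF.
  have [C hC] := schwartz_cdom Sh; have [C' gC] := schwartz_cdom Sg.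
  have Sge : schwartz (fun w => g (e *: w)).
    have := @schwartz_affine R d g e 0 _ Sg; rewrite gt_eqF// => /(_ isT).
    by under eq_fun do rewrite addr0.
  have SFge : schwartz (fun w => fourier g (e^-1 *: w)).
    have := @schwartz_affine R d (fourier g) e^-1 0 e1 SFg.
    by under eq_fun do rewrite addr0.
  have [D geD] := schwartz_cdom Sge.
  rewrite (fourier_mul_formula hC geD).
  have [D' pD] := schwartz_cdom (schwartzM SFge Sh).
  have := cintegral_affine 0 e0 (cdomZ (e^-1 ^+ d)%:C pD).
  rewrite (cintegralZ _ pD).
  have FE y : fourier (fun w => g (e *: w)) y = (e^-1 ^+ d)%:C * fourier g (e^-1 *: y).
    have := fourier_affine 0 y e0 gC; under [X in fourier X]eq_fun do rewrite addr0.
    by rewrite scaler0 oppr0 /wave (_ : dot y 0 = 0) ?mulr0 ?oppr0 ?expi0 ?mul1r//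
      /dot big1// => i _; rewrite mxE mulr0.
  have cn0 : (e^-1 ^+ d)%:C != 0 :> R[i].
    by rewrite (inj_eq (@complexI _)) expf_neq0.
  under [X in cintegral X = _ -> _]eq_fun do rewrite addr0 scalerA mulVf ?gt_eqF// scale1r mulrC [h _ * _]mulrC.
  under [X in _ -> cintegral X = _]eq_fun do rewrite FE.
  have [D2 pD2] : exists C, cdom (fun x => fourier g x * h (e *: x)) C.
    by apply: schwartz_cdom; apply: schwartzM => //;
    have := @schwartz_affine R d h e 0 _ Sh; rewrite gt_eqF// => /(_ isT);
    under eq_fun do rewrite addr0.
  under [X in cintegral X = _ -> _]eq_fun do rewrite mulrC.
  rewrite (cintegralZ _ pD2) => /(mulfI cn0) ->.
  rewrite -(cintegralZ _ pD).
  by congr cintegral; apply/funext => x; ring.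
have -> : g 0 * cintegral (fourier h) - h 0 * cintegral (fourier g) =
   (cintegral (fun z => fourier g z * h (e *: z)) - h 0 * cintegral (fourier g))
   - (cintegral (fun w => fourier h w * g (e *: w)) - g 0 * cintegral (fourier h)).
  rewrite E; move: (g 0 * cintegral (fourier h)) (h 0 * cintegral (fourier g)) => u v.
  by move: (cintegral _) => t; ring.
rewrite mulrDr (le_trans (normcD _ _))// addrC normcN lerD//.
  exact: H1.
exact: H2.
Qed.

Lemma wave0 x : wave 0 x = 1.
Proof. by rewrite /wave (_ : dot 0 x = 0) ?mulr0 ?oppr0 ?expi0// /dot big1// => i _; rewrite mxE mul0r. Qed.

(** Translating [h] carries the identity at the origin to every point; the constant depends on [g]
    alone. *)
Lemma fourier_fourier g : schwartz g -> g 0 != 0 ->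
  forall h, schwartz h -> forall x, fourier (fourier h) x = cintegral (fourier g) / g 0 * h (- x).
Proof.
move=> Sg g0 h Sh x; have [C hC] := schwartz_cdom Sh.
have e : fourier (fourier h) x = cintegral (fourier (fun y => h (y - x))).
  rewrite fourierE; congr cintegral; apply/funext => w.
  have := fourier_affine (- x) w ltr01 hC; under [X in fourier X]eq_fun do rewrite scale1r.
  by move=> ->; rewrite invr1 expr1n mul1r !scale1r opprK mulrC waveC.
have := fourier_fourier0 Sg (schwartz_translate x Sh); rewrite e sub0r => H.
by apply: (mulfI g0); rewrite H; field.
Qed.

(* If the constant vanished, the multiplication formula would give
   [\int |fourier psi|^2 = 0]. *)
Lemma fourier_fourier_neq0 (c : R[i]) psi w0 : schwartz psi -> fourier psi w0 != 0 ->
  (forall h, schwartz h -> forall x, fourier (fourier h) x = c * h (- x)) -> c != 0.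
Proof.
move=> Sp p0 H; apply/eqP => c0.
(* The transform of this reflected conjugate is the conjugate of [fourier psi], so the product of
   the two transforms is a squared modulus. *)
pose k x := conjc (psi (- x)).
have Sk : schwartz k := schwartzJ (schwartz_opp Sp).
have [C pC] := schwartz_cdom Sp; have [C1 kC] := schwartz_cdom Sk.
have [C2 oC] := schwartz_cdom (schwartz_opp Sp).
have Fk w : fourier k w = conjc (fourier psi w).
  by rewrite (fourierJ w oC) (fourier_opp _ pC) opprK.
have SFp := schwartz_fourier Sp; have SFk := schwartz_fourier Sk.
have [C3 FkC] := schwartz_cdom SFk.
have [C4 PC] := schwartz_cdom (schwartzM SFk SFp).
have I0 : cintegral (fun w => fourier psi w * fourier k w) = 0.
  rewrite (fourier_mul_formula pC FkC) -(@cintegral0 R d); congr cintegral.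
  by apply/funext => x; rewrite (H _ Sk) c0 mul0r mulr0.
pose g w := complex.Re (fourier psi w * fourier k w).
have gE w : g w = normc (fourier psi w) ^+ 2.
  rewrite /g Fk; case: (fourier psi w) => a b /=.
  by rewrite sqr_sqrtr ?addr_ge0 ?sqr_ge0// !expr2; ring.
have : 0 < rint g.
  apply: (@rint_gt0 _ _ g C4 w0).
  - exact: smooth_cont (csmooth_Re (schwartz_csmooth (schwartzM SFk SFp))).
  - by move=> x; rewrite gE sqr_ge0.
  - exact: cdom_Re PC.
  - by rewrite gE exprn_gt0// lt_neqAle normc_ge0 andbT eq_sym normc_eq0.
by rewrite -Re_cintegral I0 /= ltxx.
Qed.

End inversion.

(** * Convolutions as limits of sums of translates *)

Section convolution.
Variables (R : realType) (d : nat).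
Local Notation V := ('rV[R]_d).
Implicit Types (f g h psi theta : V -> R[i]) (w x t : V).

(** The right-hand side is a convolution, an integral of translates of [psi]: its Riemann sums lie
    in the span of these translates. *)
Lemma fourier_conv psi theta x : schwartz psi -> schwartz theta ->
  fourier (fun w => fourier (fun y => psi (- y)) w * theta w) x =
  cintegral (fun t => fourier theta t * psi (x - t)).
Proof.
move=> Sp St; have So := schwartz_opp Sp.
have [C oC] := schwartz_cdom So; have [C' tC] := schwartz_cdom St.
have SFt := schwartz_fourier St.
rewrite fourierE.
transitivity (cintegral (fun w => fourier (fun y => psi (- y)) w * (theta w * wave x w))).
  by congr cintegral; apply/funext => w; rewrite mulrA.
rewrite (fourier_mul_formula oC (cdom_wave x tC)).
have e y : fourier (fun w => theta w * wave x w) y = fourier theta (y + x).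
  rewrite !fourierE; congr cintegral; apply/funext => w.
  by rewrite -mulrA [in RHS]waveC waveDr mulrC ![wave w _]waveC -mulrA mulrCA mulrA mulrC.
under eq_fun do rewrite e.
have SFx : schwartz (fun y => fourier theta (y + x)).
  by have := schwartz_translate (- x) SFt; rewrite opprK.
have [D pD] := schwartz_cdom (schwartzM So SFx).
transitivity (cintegral (fun y => fourier theta (y + x) * psi (- y))).
  by congr cintegral; apply/funext => y; rewrite mulrC.
have := cintegral_affine (- x) ltr01 pD; rewrite invr1 expr1n mul1r => <-.
by congr cintegral; apply/funext => t; rewrite scale1r subrK opprB.
Qed.

Lemma cpart_opp i f : csmooth f -> cpart i (fun y => f (- y)) = fun y => - cpart i f (- y).
Proof.
move=> sf; have := iter_cpartial_affine (-1) 0 [:: i] sf.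
rewrite iter_cpartial_cons iter_cpartial_nil.
under eq_fun do rewrite scaleN1r addr0; move=> ->.
apply/funext => y; rewrite expr1 scaleN1r addr0 iter_cpartial_cons iter_cpartial_nil.
by rewrite rmorphN mulN1r.
Qed.

Lemma fourierN f w C : cdom f C -> fourier (fun x => - f x) w = - fourier f w.
Proof.
move=> fC; rewrite !fourierE -mulN1r -(cintegralZ _ (cdom_wave w fC)).
by congr cintegral; apply/funext => x; rewrite mulNr mulN1r.
Qed.

(** All derivatives of the convolution fall on [psi], so each derivative is approximated by the same
    sums with [psi] replaced by its derivative. *)
Lemma iter_cpartial_conv psi theta s : schwartz psi -> schwartz theta ->
  iter_cpartial s (fourier (fun w => fourier (fun y => psi (- y)) w * theta w)) =
  fourier (fun w => fourier (fun y => iter_cpartial s psi (- y)) w * theta w).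
Proof.
move=> Sp St; elim: s => [|i s IH]; first by rewrite !iter_cpartial_nil.
rewrite iter_cpartial_cons IH.
have Ss := schwartz_iter_cpartial s Sp; have So := schwartz_opp Ss.
rewrite cpart_fourier; last exact: schwartzM St (schwartz_fourier So).
congr fourier; apply/funext => w; rewrite /mulx mulrA; congr (_ * _).
have Sio : schwartz (fun y => iter_cpartial (i :: s) psi (- y)).
  exact: schwartz_opp (schwartz_iter_cpartial (i :: s) Sp).
have [C iC] := schwartz_cdom Sio.
apply: (@oppr_inj R[i]); rewrite -(fourierN w iC) -mulNr -(fourier_cpart i w So).
by rewrite (cpart_opp i (schwartz_csmooth Ss)).
Qed.

Definition grid_index n x : {ffun 'I_d -> int} := [ffun i => Num.floor (n.+1%:R * x 0 i)].

Definition grid_point n (z : {ffun 'I_d -> int}) : V := \row_i ((z i)%:~R / n.+1%:R).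

(** Indices from -(n+1)^2 to (n+1)^2. At mesh 1/(n+1) they reach out to distance n+1, so the one
    parameter [n] both refines the grid and exhausts the space. *)
Definition grid_box n (k : {ffun 'I_d -> 'I_((n.+1 ^ 2).*2.+1)}) : {ffun 'I_d -> int} :=
  [ffun i => (k i)%:Z - (n.+1 ^ 2)%:Z].

Lemma grid_box_inj n : injective (@grid_box n).
Proof.
move=> k k' /ffunP H; apply/ffunP => i; have := H i; rewrite !ffunE.
by move=> /addIr [] /val_inj.
Qed.

Lemma grid_dist n x i : 0 <= x 0 i - grid_point n (grid_index n x) 0 i <= n.+1%:R^-1.
Proof.
rewrite !mxE ffunE; have n0 : 0 < n.+1%:R :> R by rewrite ltr0n.
have /andP[h1 h2] := floor_itv (n.+1%:R * x 0 i).
rewrite subr_ge0 ler_pdivrMr// [x 0 i * _]mulrC h1/= lerBlDr -(ler_pM2l n0) mulrDr mulfV ?gt_eqF//.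
rewrite [X in _ <= _ + X]mulrCA mulfV ?gt_eqF// mulr1.
by rewrite intrD in h2; rewrite addrC ltW.
Qed.

(** Outside the box some coordinate is at least [n.+1] in absolute value. One extra power of the
    weight therefore pays for a factor [1 / n.+1]. *)
Lemma grid_box_complete n x : (forall k, grid_index n x != @grid_box n k) ->
  1 <= (1 + `|x|) / n.+1%:R.
Proof.
move=> H; have n0 : 0 < n.+1%:R :> R by rewrite ltr0n.
suff [i Hi] : exists i, ~ (`|Num.floor (n.+1%:R * x 0 i)| <= (n.+1 ^ 2)%:Z)%R.
  have {}Hi : (n.+1 ^ 2)%:Z + 1 <= `|Num.floor (n.+1%:R * x 0 i)|.
    by rewrite lezD1 ltNge; apply/negP.
  have : (((n.+1 ^ 2)%:Z + 1)%:~R : R) <= (`|Num.floor (n.+1%:R * x 0 i)|)%:~R by rewrite ler_int.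
  rewrite intrD intr_norm => {}Hi.
  have e2 : ((n.+1 ^ 2)%:Z)%:~R = n.+1%:R ^+ 2 :> R by rewrite -natrX.
  rewrite e2 in Hi.
  have /andP[h1 h2] := floor_itv (n.+1%:R * x 0 i).
  rewrite intrD in h2.
  have h3 : `|(Num.floor (n.+1%:R * x 0 i))%:~R : R| <= `|n.+1%:R * x 0 i| + 1.
    have -> : (Num.floor (n.+1%:R * x 0 i))%:~R = n.+1%:R * x 0 i -
       (n.+1%:R * x 0 i - (Num.floor (n.+1%:R * x 0 i))%:~R) :> R by ring.
    rewrite (le_trans (ler_normB _ _))// lerD2l ger0_norm; lra.
  rewrite normrM (gtr0_norm n0) in h3.
  have h4 := ler_coord_norm x i.
  rewrite ler_pdivlMr// mul1r.
  suff : n.+1%:R <= `|x 0 i| by lra.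
  by rewrite -(ler_pM2l n0) -expr2; have := le_trans Hi h3; rewrite mulr1z lerD2r.
apply: contrapT => nex.
have le i : `|Num.floor (n.+1%:R * x 0 i)| <= (n.+1 ^ 2)%:Z.
  by apply: contrapT => h; apply: nex; exists i.
have bnd i : (`|(Num.floor (n.+1%:R * x 0 i) + (n.+1 ^ 2)%:Z)%R| < (n.+1 ^ 2).*2.+1)%N.
  by have := le i; lia.
have := H [ffun i => Ordinal (bnd i)]; move=> /eqP; apply.
apply/ffunP => i; rewrite !ffunE /=.
by have := le i; lia.
Qed.

Lemma cmeas_grid n (z : {ffun 'I_d -> int}) :
  cmeas (fun t : V => ((grid_index n t == z)%:R : R)%:C).
Proof.
split; last exact: measurable_cst.
rewrite /tmeas /=.
have mA := @measurable_rowt_discrete R d n [set z].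
rewrite (_ : _ \o _ = \1_[set t : d.-tuple R | [set z] [ffun i => Num.floor (n.+1%:R * tnth t i)]]).
  exact: measurable_indic.
apply/funext => t /=; rewrite indicE; congr (_%:R).
have -> : grid_index n (rowt t) = [ffun i => Num.floor (n.+1%:R * tnth t i)].
  by apply/ffunP => i; rewrite !ffunE rowtE.
by congr nat_of_bool; apply/idP/idP => [/eqP e|/set_mem e]; [exact/mem_set|exact/eqP].
Qed.

(** By injectivity of [grid_box] at most one term survives: the sum is a step function of [t], zero
    outside the box. *)
Lemma grid_sum n (F : {ffun 'I_d -> int} -> R[i]) t :
  \sum_k ((grid_index n t == @grid_box n k)%:R : R)%:C * F (grid_box k) =
  if [exists k, grid_index n t == @grid_box n k] then F (grid_index n t) else 0.
Proof.
case: ifP => [/existsP[k /eqP kt]|/negbT/existsPn H].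
  rewrite (bigD1 k)//= kt eqxx mul1r big1 ?addr0// => k' k'k.
  rewrite (_ : (grid_box k == grid_box k') = false) ?mul0r//.
  by apply/negP => /eqP/grid_box_inj e; rewrite e eqxx in k'k.
by rewrite big1// => k _; rewrite (negbTE (H k)) mul0r.
Qed.

Lemma wt_triangle x y : 1 + `|x| <= (1 + `|x - y|) * (1 + `|y|).
Proof.
have h := ler_normD (x - y) y; rewrite subrK in h.
have := normr_ge0 y; have := normr_ge0 (x - y); nra.
Qed.

(** Inside the box the mean value bound over a cell gives the first constant. Outside it the sum is
    0 and the value of [psi] itself is the error, which gives the summand [b]. Moving the weight
    from [x - t] to [x] costs powers of 1 + |t|. *)
Lemma grid_error m n psi b s x t : schwartz psi -> sb m.+1 psi b -> (size s <= m)%N ->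
  (1 + `|x|) ^+ m * normc (iter_cpartial s psi (x - t) -
    \sum_k ((grid_index n t == @grid_box n k)%:R : R)%:C *
       iter_cpartial s psi (x - grid_point n (grid_box k)))
  <= (2 * (d%:R * (2 ^+ m * b)) + b) / n.+1%:R * (1 + `|t|) ^+ m.+1.
Proof.
move=> Sp pb sm; have b0 := sb_ge0 pb; have n0 : 0 < n.+1%:R :> R by rewrite ltr0n.
have pb' := sb_le (leqnSn m) (lexx b) pb.
rewrite (@grid_sum n (fun z => iter_cpartial s psi (x - grid_point n z))).
case: ifP => [_|/negbT/existsPn H]; last first.
  rewrite subr0; have := grid_box_complete H => nt.
  apply: (@le_trans _ _ (b * (1 + `|t|) ^+ m)).
    apply: (@le_trans _ _ (((1 + `|x - t|) * (1 + `|t|)) ^+ m * normc (iter_cpartial s psi (x - t)))).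
      by rewrite ler_wpM2r ?normc_ge0// lerXn2r ?nnegrE ?mulr_ge0 ?wt_ge0 ?wt_triangle.
    by rewrite exprMn mulrAC ler_wpM2r ?wt_pow_ge0// pb'.
  rewrite exprS -[X in _ <= X]mulrA [n.+1%:R^-1 * _]mulrA [n.+1%:R^-1 * _]mulrC.
  apply: ler_pM; rewrite ?wt_pow_ge0//.
    by rewrite lerDr !mulr_ge0 ?exprn_ge0.
  by rewrite ler_peMl ?wt_pow_ge0.
set p := grid_point n (grid_index n t).
have nV : n.+1%:R^-1 <= 1 :> R by rewrite invf_le1 ?ler1n.
have tp : `|t - p| <= n.+1%:R^-1.
  apply: norm_le_coord; first by rewrite invr_ge0 ltW.
  move=> i; rewrite !mxE; have /andP[h1 h2] := grid_dist n t i.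
  by rewrite ger0_norm//; move: h1 h2; rewrite !mxE.
(* A bound for the derivatives at any [z] between [x - t] and [x - p]: there |x - z| <= 1 + |t|,
   hence 1 + |x| <= (1 + |z|) * 2 (1 + |t|). *)
pose B := b * ((2 * (1 + `|t|)) / (1 + `|x|)) ^+ m.
have B0 : 0 <= B by rewrite mulr_ge0 ?exprn_ge0 ?divr_ge0 ?mulr_ge0 ?wt_ge0.
have sP := schwartz_csmooth (schwartz_iter_cpartial s Sp).
have mv : normc (iter_cpartial s psi (x - t) - iter_cpartial s psi (x - p)) <=
    2 * (d%:R * B * `|(x - t) - (x - p)|).
  apply: csmooth_mvt => // i z Hz.
  have xz : 1 + `|x| <= (1 + `|z|) * (2 * (1 + `|t|)).
    have xzt : `|x - z| <= 1 + `|t|.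
      apply: norm_le_coord; first exact: wt_ge0.
      move=> j; have := Hz j; have := ler_coord_norm t j.
      have := grid_dist n t j; rewrite -/p.
      have sub (u v : V) : (u - v) 0 j = u 0 j - v 0 j by rewrite !mxE.
      rewrite !sub !ler_norml ge_min le_max; move: nV.
      by move: (p 0 j) (n.+1%:R^-1) => *; lra.
    have xx : x - (x - z) = z by rewrite opprB addrC subrK.
    have h := wt_triangle x (x - z); rewrite xx in h.
    apply: (le_trans h); rewrite ler_wpM2l ?wt_ge0//.
    have := normr_ge0 t; lra.
  have := pb (i :: s) z sm; rewrite iter_cpartial_cons => pz.
  have pzm : (1 + `|z|) ^+ m * normc (cpart i (iter_cpartial s psi) z) <= b.
    by apply: le_trans pz; rewrite ler_wpM2r ?normc_ge0// wt_pow_le.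
  rewrite /B exprMn exprVn mulrA ler_pdivlMr ?exprn_gt0 ?wt_gt0//.
  apply: (@le_trans _ _ (normc (cpart i (iter_cpartial s psi) z) *
     ((1 + `|z|) * (2 * (1 + `|t|))) ^+ m)).
    by rewrite ler_wpM2l ?normc_ge0// lerXn2r ?nnegrE ?mulr_ge0 ?wt_ge0.
  rewrite exprMn mulrA ler_wpM2r ?exprn_ge0 ?mulr_ge0 ?wt_ge0//.
  by rewrite mulrC.
have dist : `|x - t - (x - p)| <= n.+1%:R^-1.
  by rewrite opprB addrC addrA subrK -normrN opprB.
apply: (le_trans (ler_wpM2l (wt_pow_ge0 x m) mv)).
apply: (@le_trans _ _ ((1 + `|x|) ^+ m * (2 * (d%:R * B * n.+1%:R^-1)))).
  by rewrite !ler_wpM2l ?wt_pow_ge0 ?mulr_ge0.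
have -> : (1 + `|x|) ^+ m * (2 * (d%:R * B * n.+1%:R^-1)) =
    2 * (d%:R * (2 ^+ m * b)) / n.+1%:R * (1 + `|t|) ^+ m.
  have w0 : (1 + `|x|) ^+ m != 0 by rewrite expf_neq0// gt_eqF// wt_gt0.
  rewrite /B !exprMn exprVn.
  move: w0; move: ((1 + `|x|) ^+ m) ((1 + `|t|) ^+ m) n.+1%:R^-1 (2 ^+ m) => X T N E X0.
  by field.
apply: ler_pM; rewrite ?wt_pow_ge0 ?wt_pow_le//.
  by rewrite divr_ge0 ?mulr_ge0 ?exprn_ge0// ltW.
by rewrite ler_wpM2r ?invr_ge0 ?(ltW n0)// lerDl.
Qed.

Lemma conv_approx psi theta m (e : R) : schwartz psi -> schwartz theta -> 0 < e ->
  exists (K : finType) (c : K -> R[i]) (t : K -> V),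
  sb m (fun x => fourier (fun w => fourier (fun y => psi (- y)) w * theta w) x -
     \sum_k c k * psi (x - t k)) e.
Proof.
move=> Sp St e0; have SFt := schwartz_fourier St.
have [b pb] := schwartz_sb m.+1 Sp; have b0 := sb_ge0 pb.
(* Decay of order [m.+1] compensates the growth in [t] of the grid error, and [d + d] more makes the
   product integrable. *)
have [A FA] := schwartz_sb (m.+1 + (d + d)) SFt; have A0 := sb_ge0 FA.
have [A' tA'] := schwartz_cdom SFt.
pose K0 := 2 * (d%:R * (2 ^+ m * b)) + b.
have K00 : 0 <= K0 by rewrite addr_ge0 ?mulr_ge0 ?exprn_ge0.
pose M := 2 * (A * K0 * wint R d).
have [n nM] : exists n : nat, M / n.+1%:R <= e.
  exists (Num.truncn (M / e)); rewrite ler_pdivrMr ?ltr0n// -ler_pdivrMl// mulrC.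
  by rewrite ltW// truncnS_gt.
(* The coefficients are exact integrals of [fourier theta] over the cells. Only [psi] is sampled,
   and the total error is one integral of [fourier theta] against the grid error. *)
pose c k := cintegral (fun t => fourier theta t * ((grid_index n t == @grid_box n k)%:R : R)%:C).
exists {ffun 'I_d -> 'I_((n.+1 ^ 2).*2.+1)}, c, (fun k => grid_point n (grid_box k)).
have Sconv : schwartz (fourier (fun w => fourier (fun y => psi (- y)) w * theta w)).
  by apply: schwartz_fourier; exact: schwartzM St (schwartz_fourier (schwartz_opp Sp)).
have St' k : schwartz (fun x => psi (x - grid_point n (@grid_box n k))) := schwartz_translate _ Sp.
have Sk k : schwartz (fun x => c k * psi (x - grid_point n (@grid_box n k))) := schwartzZ _ (St' k).
have csum : csmooth (fun x => \sum_k c k * psi (x - grid_point n (@grid_box n k))).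
  by apply: csmooth_sum => k _; exact: schwartz_csmooth.
move=> s x sm.
rewrite (iter_cpartialB s (schwartz_csmooth Sconv) csum).
rewrite (iter_cpartial_sum s _ (fun k => schwartz_csmooth (Sk k))).
under eq_bigr => k _.
  rewrite (iter_cpartialZ s (c k) (schwartz_csmooth (St' k))).
  have -> : iter_cpartial s (fun y => psi (y - grid_point n (grid_box k))) x =
      iter_cpartial s psi (x - grid_point n (grid_box k)).
    have := iter_cpartial_affine 1 (- grid_point n (grid_box k)) s (schwartz_csmooth Sp).
    under eq_fun do rewrite scale1r; move=> ->.
    by rewrite expr1n mul1r scale1r.
  over.
rewrite (iter_cpartial_conv s Sp St) (fourier_conv x (schwartz_iter_cpartial s Sp) St).
have gridC k : cdom (fun t => fourier theta t * ((grid_index n t == @grid_box n k)%:R : R)%:C) A'.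
  rewrite -[A']mulr1; apply: cdomM tA' (cmeas_grid n _) _ => t.
  by rewrite normc_real; case: (_ == _); rewrite ?normr1 ?normr0.
have Ss := schwartz_iter_cpartial s Sp.
pose E t := iter_cpartial s psi (x - t) -
    \sum_k ((grid_index n t == @grid_box n k)%:R : R)%:C *
       iter_cpartial s psi (x - grid_point n (grid_box k)).
have gZ k := cdomZ (- iter_cpartial s psi (x - grid_point n (@grid_box n k))) (gridC k).
have [C1 pC] : exists C, cdom (fun t => fourier theta t * iter_cpartial s psi (x - t)) C.
  apply: schwartz_cdom; apply: schwartzM; last exact: SFt.
  by have := schwartz_translate x (schwartz_opp Ss); under eq_fun do rewrite opprB.
have mE : cmeas (fun t => fourier theta t * E t).
  apply: cmeasM; first exact: tA'.1.
  apply: cmeasD.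
    have := schwartz_translate x (schwartz_opp Ss); under eq_fun do rewrite opprB.
    by move=> /schwartz_csmooth/cmeas_csmooth.
  under eq_fun do rewrite -sumrN.
  elim: (index_enum _) => [|k r IH].
    by under eq_fun do rewrite big_nil; exact: cmeas_cst.
  under eq_fun do rewrite big_cons.
  apply: cmeasD IH; under eq_fun do rewrite -mulrN.
  by apply: cmeasM; [exact: cmeas_grid|exact: cmeas_cst].
have -> : cintegral (fun t => fourier theta t * iter_cpartial s psi (x - t)) -
    \sum_k c k * iter_cpartial s psi (x - grid_point n (grid_box k)) =
    cintegral (fun t => fourier theta t * E t).
  have sC : exists C, cdom (fun t => \sum_k - iter_cpartial s psi (x - grid_point n (grid_box k)) *
      (fourier theta t * ((grid_index n t == @grid_box n k)%:R : R)%:C)) C.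
    elim: (index_enum _) => [|k r [D IH]].
      by exists 0; under eq_fun do rewrite big_nil; exact: cdom0.
    by eexists; under eq_fun do rewrite big_cons; exact: cdomD (gZ k) IH.
  have [D sD] := sC.
  transitivity (cintegral (fun t => fourier theta t * iter_cpartial s psi (x - t) +
     \sum_k - iter_cpartial s psi (x - grid_point n (grid_box k)) *
      (fourier theta t * ((grid_index n t == @grid_box n k)%:R : R)%:C))).
    rewrite (cintegralD pC sD) cintegral_sum; last by move=> k; eexists; exact: gZ.
    congr (_ + _); rewrite -sumrN; apply: eq_bigr => k _.
    by rewrite (cintegralZ _ (gridC k)) mulNr mulrC.
  congr cintegral; apply/funext => t; rewrite /E mulrBr mulr_sumr -sumrN; congr (_ + _).
  by apply: eq_bigr => k _; rewrite mulNr; congr (- _); rewrite mulrC mulrA.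
have ED : cdom (fun t => fourier theta t * E t) (A * K0 / n.+1%:R / (1 + `|x|) ^+ m).
  split=> // t; rewrite normcM.
  have err := grid_error n x t Sp pb sm.
  rewrite mulrC in err; rewrite -ler_pdivlMr ?exprn_gt0 ?wt_gt0// in err.
  have Ft := sb_at (s := [::]) t FA isT; rewrite iter_cpartial_nil in Ft.
  apply: (le_trans (ler_pM (normc_ge0 _) (normc_ge0 _) Ft err)).
  have w0 k : (1 + `|t|) ^+ k != 0 by rewrite expf_neq0// gt_eqF// wt_gt0.
  have wx0 : (1 + `|x|) ^+ m != 0 by rewrite expf_neq0// gt_eqF// wt_gt0.
  rewrite -/K0 exprD.
  have -> : A * ((1 + `|t|) ^+ m.+1 * (1 + `|t|) ^+ (d + d))^-1 *
     (K0 / n.+1%:R * (1 + `|t|) ^+ m.+1 / (1 + `|x|) ^+ m) =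
     A * K0 / n.+1%:R / (1 + `|x|) ^+ m * ((1 + `|t|) ^+ (d + d))^-1.
    move: (w0 m.+1) (w0 (d + d)%N) wx0.
    move: ((1 + `|t|) ^+ m.+1) ((1 + `|t|) ^+ (d + d)) ((1 + `|x|) ^+ m) (n.+1%:R^-1) => u v y N u0 v0 y0.
    by field; rewrite u0 v0 y0.
  rewrite ler_wpM2l ?wt_le_weight//.
  by rewrite !divr_ge0 ?mulr_ge0 ?wt_pow_ge0.
apply: (le_trans (ler_wpM2l (wt_pow_ge0 x m) (normc_cintegral ED))).
apply: le_trans nM; rewrite /M le_eqVlt; apply/orP; left; apply/eqP.
have wx0 : (1 + `|x|) ^+ m != 0 by rewrite expf_neq0// gt_eqF// wt_gt0.
move: wx0; move: ((1 + `|x|) ^+ m) (n.+1%:R^-1) => y N y0.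
by field.
Qed.

End convolution.

(** * Tempered distributions *)

Section tempered.
Variables (R : realType) (d : nat).
Local Notation V := ('rV[R]_d).
Implicit Types (f g h : V -> R[i]) (T L : (V -> R[i]) -> R[i]).

Lemma schwartz_linear0 T : schwartz_linear T -> T (fun _ => 0) = 0.
Proof.
move=> lT; have S0 := schwartz0 R d.
have := lT (-1) _ _ S0 S0; under eq_fun do rewrite mulr0 addr0.
by rewrite mulN1r addNr.
Qed.

Lemma schwartz_linearZ T (c : R[i]) f : schwartz_linear T -> schwartz f ->
  T (fun x => c * f x) = c * T f.
Proof.
move=> lT Sf; have := lT c _ _ Sf (schwartz0 R d); under eq_fun do rewrite addr0.
by rewrite (schwartz_linear0 lT) addr0.
Qed.

Lemma schwartz_linearB T f g : schwartz_linear T -> schwartz f -> schwartz g ->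
  T (fun x => f x - g x) = T f - T g.
Proof.
move=> lT Sf Sg; have := lT (-1) _ _ Sg Sf; rewrite mulN1r addrC => <-.
by congr T; apply/funext => x; rewrite mulN1r addrC.
Qed.

Lemma schwartz_linear_sum T (I : Type) (r : seq I) (c : I -> R[i]) (h : I -> V -> R[i]) :
  schwartz_linear T -> (forall i, schwartz (h i)) ->
  T (fun x => \sum_(i <- r) c i * h i x) = \sum_(i <- r) c i * T (h i).
Proof.
move=> lT Sh; elim: r => [|i r IH].
  by rewrite big_nil; under eq_fun do rewrite big_nil; exact: schwartz_linear0.
rewrite big_cons -IH -(lT _ _ _ (Sh i)); last first.
  by apply: schwartz_sum => j; exact: schwartzZ.
by congr T; apply/funext => x; rewrite big_cons.
Qed.

(** Continuity at 0 with tolerance 1 involves finitely many seminorms; [m] is the largest order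
    among them. *)
Lemma tempered_order T : tempered_distribution T -> exists m (r : R), 0 < r /\
  forall f b, schwartz f -> sb m f b -> b < r -> normc (T f) < 1.
Proof.
move=> [lT cT]; have [K [r [r0 H]]] := cT _ (schwartz0 R d) _ ltr01.
exists (\max_(k <- K) maxn (\sum_i k.1 i) (size k.2)), r; split=> // f b Sf fb br.
have := H f Sf; rewrite (schwartz_linear0 lT) subr0; apply => k kK.
have := @leq_bigmax_seq _ K xpredT (fun k => maxn (\sum_i k.1 i) (size k.2)) k kK isT.
rewrite geq_max => /andP[k1 k2].
under eq_fun do rewrite subr0.
by rewrite (le_lt_trans (seminorm_le k1 k2 fb))// lte_fin.
Qed.

(** The kernel of [T] is closed for bounds of one order [m]. As [m] comes before [f], later
    vanishing conditions on [f] may depend on it. *)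
Lemma tempered_approx0 T : tempered_distribution T -> exists m, forall f, schwartz f ->
  (forall e : R, 0 < e -> exists g, [/\ schwartz g, T g = 0 & sb m (fun x => f x - g x) e]) ->
  T f = 0.
Proof.
move=> TT; have lT := TT.1; have [m [r [r0 H]]] := tempered_order TT.
exists m => f Sf fg; apply: (@le_eps_eq0 _ _ 1) => e e0; rewrite mulr1.
(* An error of [e * r / 2], rescaled by [e^-1], falls strictly below the threshold [r]. *)
have [g [Sg Tg fgb]] := fg _ (divr_gt0 (mulr_gt0 e0 r0) (ltr0n _ 2)).
have Sfg : schwartz (fun x => f x - g x).
  have := schwartzD Sf (schwartzZ (-1) Sg).
  by under eq_fun do rewrite mulN1r.
have := H _ _ (schwartzZ (e^-1)%:C Sfg) (sbZ (e^-1)%:C (schwartz_csmooth Sfg) fgb).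
have -> : normc (e^-1)%:C * (e * r / 2%:R) = r / 2.
  by rewrite normc_real ger0_norm ?invr_ge0 ?ltW//; field; rewrite gt_eqF.
rewrite ltr_pdivrMr// ltr_pMr// ltr1n => /(_ isT).
rewrite (schwartz_linearZ _ lT Sfg) (schwartz_linearB lT Sf Sg) Tg subr0.
rewrite normcM normc_real ger0_norm ?invr_ge0 ?(ltW e0)//.
by rewrite ltr_pdivrMl// mulr1 => /ltW.
Qed.

Lemma tempered_conv0 T psi theta : tempered_distribution T -> schwartz psi -> schwartz theta ->
  (forall t, T (fun x => psi (x - t)) = 0) ->
  T (fourier (fun w => fourier (fun y => psi (- y)) w * theta w)) = 0.
Proof.
move=> TT Sp St T0; have [m H] := tempered_approx0 TT; apply: H.
  by apply: schwartz_fourier; exact: schwartzM St (schwartz_fourier (schwartz_opp Sp)).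
move=> e e0; have [K [c [t Hb]]] := conv_approx m Sp St e0.
exists (fun x => \sum_k c k * psi (x - t k)); split=> //.
- by apply: schwartz_sum => k; apply: schwartzZ; exact: schwartz_translate.
- rewrite (schwartz_linear_sum _ c TT.1 (fun k => schwartz_translate (t k) Sp)).
  by rewrite big1// => k _; rewrite T0 mulr0.
Qed.

(** Either [L j] already vanishes on the common kernel of the others and is dropped, or some [v] in
    that kernel has [L j v] nonzero, and subtracting [(T v / L j v) * L j] from [T] gives a
    functional to which the induction applies. *)
Lemma linear_span (I : eqType) (L : I -> (V -> R[i]) -> R[i]) (r : seq I) T :
  (forall i, schwartz_linear (L i)) -> schwartz_linear T ->
  (forall f, schwartz f -> (forall i, i \in r -> L i f = 0) -> T f = 0) ->
  exists l : seq (I * R[i]), forall f, schwartz f -> T f = \sum_(p <- l) p.2 * L p.1 f.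
Proof.
move=> lL; elim: r T => [|j r IH] T lT H.
  by exists [::] => f Sf; rewrite big_nil H.
have [Hj|] := pselect (forall f, schwartz f -> (forall i, i \in r -> L i f = 0) -> L j f = 0).
  apply: IH => // f Sf fr; apply: H => // i; rewrite in_cons => /orP[/eqP ->|]; last exact: fr.
  exact: Hj.
move=> /existsNP[v /not_implyP[Sv /not_implyP[vr /eqP vj]]].
pose a := T v / L j v.
have [|f Sf fr|l Hl] := IH (fun f => T f - a * L j f).
- by move=> c f1 f2 S1 S2; rewrite lT// (lL j)//; ring.
- pose b := L j f / L j v.
  have Sb := schwartzZ b Sv.
  have : T (fun x => f x - b * v x) = 0.
    apply: H.
      have := schwartzD Sf (schwartzZ (-1) Sb); by under eq_fun do rewrite mulN1r.
    move=> i; rewrite (schwartz_linearB (lL i) Sf Sb) (schwartz_linearZ _ (lL i) Sv).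
    rewrite in_cons => /orP[/eqP ->|ir]; last by rewrite fr// vr// mulr0 subr0.
    by rewrite /b divfK// subrr.
  rewrite (schwartz_linearB lT Sf Sb) (schwartz_linearZ _ lT Sv) => <-.
  by rewrite /a /b mulrC mulrAC mulrA.
- exists ((j, a) :: l) => f Sf; rewrite big_cons /= -Hl//.
  by rewrite addrC subrK.
Qed.

Lemma cintegral_mulxs_linear s : schwartz_linear (fun f => cintegral (mulxs s f)).
Proof.
move=> c f1 f2 S1 S2.
have e : mulxs s (fun x => c * f1 x + f2 x) = fun x => c * mulxs s f1 x + mulxs s f2 x.
  elim: s => [//|i s IH] /=; rewrite IH; apply/funext => x; rewrite /mulx; ring.
have [C1 D1] := schwartz_cdom (schwartz_mulxs s S1).
have [C2 D2] := schwartz_cdom (schwartz_mulxs s S2).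
by rewrite e (cintegralD (cdomZ c D1) D2) (cintegralZ c D1).
Qed.

(** By linear algebra [T] is a combination of moments. Each [mulx] brings a factor -2 pi i, which
    reappears beside each variable of the polynomial. *)
Lemma moments_polynomial T (r : seq (seq 'I_d)) : schwartz_linear T ->
  (forall f, schwartz f -> (forall s, s \in r -> cintegral (mulxs s f) = 0) -> T f = 0) ->
  is_polynomial T.
Proof.
move=> lT H; have [l Hl] := linear_span cintegral_mulxs_linear lT H.
exists (\sum_(p <- l) mpoly.mpolyC d p.2 * \prod_(i <- p.1)
  (mpoly.mpolyC d (i2pi R) * mpoly.mpolyX R[i] (mpoly.mnm1 i))) => eta Se.
rewrite Hl//.
have D p : exists C, cdom (fun x => p.2 * mulxs p.1 eta x) C.
  by apply: schwartz_cdom; apply: schwartzZ; exact: schwartz_mulxs.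
transitivity (cintegral (fun x => \sum_(p <- l) p.2 * mulxs p.1 eta x)).
  rewrite cintegral_sum//; apply: eq_bigr => p _.
  have [C mC] := schwartz_cdom (schwartz_mulxs p.1 Se).
  by rewrite (cintegralZ _ mC).
congr cintegral; apply/funext => x.
rewrite raddf_sum /= mulr_suml; apply: eq_bigr => p _.
rewrite rmorphM /= mpoly.mevalC -mulrA; congr (_ * _).
elim: (p.1) => [|i s IH] /=; first by rewrite big_nil rmorph1 mul1r.
by rewrite big_cons rmorphM rmorphM /= mpoly.mevalC mpoly.mevalXU /mulx IH !mulrA.
Qed.

End tempered.

(** * Cutoff functions *)

Section flat_function.
Variable R : realType.
Implicit Types x y : R.

(** The powers of [x^-1] make the family closed under differentiation up to linear combinations;
    [flat 0] is the classical exp(-1/x). *)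
Definition flat k x : R := if 0 < x then x^-1 ^+ k * expR (- x^-1) else 0.

Lemma flat_gt0 x : 0 < x -> 0 < flat 0 x.
Proof. by move=> x0; rewrite /flat x0 expr0 mul1r expR_gt0. Qed.

Lemma flat_le0 k x : x <= 0 -> flat k x = 0.
Proof. by rewrite /flat leNgt => /negbTE ->. Qed.

Lemma flat_ge0 k x : 0 <= flat k x.
Proof.
rewrite /flat; case: ifP => // x0.
by rewrite mulr_ge0 ?exprn_ge0 ?invr_ge0 ?(ltW x0)// ltW// expR_gt0.
Qed.

(** With y = 1/x and k > 0: exp y = exp(y/k)^k >= (y/k)^k. For [k = 0] the bound is 0^0 = 1. *)
Lemma flat_bound k x : flat k x <= k%:R ^+ k.
Proof.
have k0 : 0 <= k%:R ^+ k :> R by rewrite exprn_ge0.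
rewrite /flat; case: ifP => // x0; have y0 : 0 < x^-1 by rewrite invr_gt0.
rewrite expRN ler_pdivrMr ?expR_gt0//.
case: k k0 => [|k] _.
  by rewrite !expr0 mul1r (le_trans _ (expR_ge1Dx _))// lerDl ltW.
have kn : k.+1%:R != 0 :> R by rewrite pnatr_eq0.
have -> : expR x^-1 = expR (x^-1 / k.+1%:R) ^+ k.+1.
  by rewrite -expRM_natl mulrC divfK.
rewrite -exprMn lerXn2r ?nnegrE ?mulr_ge0 ?(ltW y0) ?(ltW (expR_gt0 _))//.
apply: (@le_trans _ _ (k.+1%:R * (x^-1 / k.+1%:R))); first by rewrite mulrC divfK.
by rewrite ler_wpM2l// (le_trans _ (expR_ge1Dx _))// lerDr.
Qed.

Lemma is_derive_flat k x :
  is_derive x (1 : R) (flat k) (flat k.+2 x - k%:R * flat k.+1 x).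
Proof.
have [x0|x0|<-] := ltgtP 0 x.
- have xn : x != 0 by rewrite gt_eqF.
  have dV : is_derive x (1 : R) (fun y : R => y^-1) (- x ^- 2).
    by have := is_deriveV xn (is_derive_id x (1 : R)); rewrite /GRing.scale/= mulr1.
  have dX : is_derive x (1 : R) (fun y : R => y^-1 ^+ k) (- (k%:R * x^-1 ^+ k.+1)).
    have := is_deriveX k dV; congr (is_derive _ _ _ _).
      by apply/funext => y; rewrite fctE.
    rewrite /GRing.scale/=; case: k => [|k]; first by rewrite !mul0r oppr0.
    by rewrite /= -exprVn mulrN -mulrA -exprD addn2.
  have dE : is_derive x (1 : R) (fun y : R => expR (- y^-1)) (x ^- 2 * expR (- x^-1)).
    have := @is_derive1_comp _ expR (fun y => - y^-1) x _ _ (is_derive_expR _) (is_deriveN dV).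
    by rewrite opprK mulrC.
  have := is_deriveM dX dE.
  have -> : (x^-1 ^+ k *: (x ^- 2 * expR (- x^-1)) + expR (- x^-1) *: (- (k%:R * x^-1 ^+ k.+1))) =
      flat k.+2 x - k%:R * flat k.+1 x.
    by rewrite /flat x0 /GRing.scale/= -exprVn !exprS; ring.
  move=> H; apply: near_eq_is_derive H.
  have : nbhs x [set y : R | 0 < y] by apply: open_nbhs_nbhs; split => //; exact: open_gt.
  by apply: filterS => y /= y0; rewrite /flat y0.
- rewrite !flat_le0 ?(ltW x0)// mulr0 subr0.
  have H := is_derive_cst (0 : R) x (1 : R).
  apply: near_eq_is_derive H.
  have : nbhs x [set y : R | y < 0] by apply: open_nbhs_nbhs; split => //; exact: open_lt.
  by apply: filterS => y /= y0; rewrite flat_le0// ltW.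
- rewrite !flat_le0// mulr0 subr0.
  have lim : (fun h : R => h^-1 *: (flat k (h *: 1 + 0) - flat k 0)) @ 0^' --> (0 : R).
    apply/cvgrPdist_le => e e0.
    pose K : R := (k.+2)%:R ^+ k.+2 + 1.
    have K0 : 0 < K by rewrite ltr_wpDl ?exprn_ge0.
    exists (e / K); first by rewrite /= divr_gt0.
    move=> h /=; rewrite sub0r normrN => hK h0.
    rewrite sub0r normrN /GRing.scale/= mulr1 addr0 (flat_le0 k (lexx 0)) subr0.
    have [hp|hn] := ltP 0 h; last by rewrite flat_le0// mulr0 normr0 ltW.
    rewrite ger0_norm ?mulr_ge0 ?invr_ge0 ?(ltW hp) ?flat_ge0//.
    (* Two of the inverse powers are traded for [h], so the difference quotient at 0 is [h] times a
       bounded function. *)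
    have -> : h^-1 * flat k h = h * flat k.+2 h.
      rewrite /flat hp !exprS; field; exact: h0.
    rewrite (gtr0_norm hp) ltr_pdivlMr// in hK.
    apply: le_trans (ltW hK); rewrite ler_wpM2l ?(ltW hp)//.
    by rewrite (le_trans (flat_bound _ _))// lerDl.
  split; first by apply/cvg_ex; exists 0; exact: lim.
  by apply/cvg_lim => //; exact: lim.
Qed.

End flat_function.

(** * Smooth cutoffs and approximation on annuli *)

Section cutoff.
Variables (R : realType) (d : nat).
Local Notation V := ('rV[R]_d).
Implicit Types (f g h : V -> R[i]) (q : V -> R) (x : V).

Lemma smooth_flat k q : smooth q -> smooth (fun x => flat k (q x)).
Proof.
move=> sq; apply/smoothP => n; elim: n k => [|n IH] k.
  move=> x; apply: (@continuous_comp _ _ _ q (flat k)); first exact: (smooth_cont sq).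
  by apply/differentiable_continuous/derivable1_diffP; have [] := is_derive_flat k (q x).
have D i x : is_derive x (dir R i) (fun x => flat k (q x))
    ((flat k.+2 (q x) - k%:R * flat k.+1 (q x)) * 'D_(dir R i) q x).
  apply/is_derive_line.
  have := smooth_is_derive i x sq => /is_derive_line dq.
  apply: (@is_derive1_comp _ (flat k) (fun h : R => q (h *: dir R i + x)) 0 _ _ _ dq).
  by rewrite scale0r add0r; exact: is_derive_flat.
split=> [|i x|i].
- exact: Cn_cont (IH k).
- by case: (D i x).
- rewrite (_ : 'D_(dir R i) _ = fun x =>
    (flat k.+2 (q x) + (- k%:R) * flat k.+1 (q x)) * 'D_(dir R i) q x).
    apply: CnM; last exact: (smoothP _).1 (smooth_D i sq) n.
    apply: CnD (IH _) _; exact: CnM (Cn_cst _ _ _) (IH _).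
  by apply/funext => x; case: (D i x) => _ ->; rewrite mulNr.
Qed.

(** The squared Euclidean norm: unlike the sup norm it is smooth, and it is the one that defines
    unit vectors. *)
Definition sqnorm x : R := \sum_i x 0 i * x 0 i.

Lemma smooth_sqnorm : smooth sqnorm.
Proof.
apply: (@smooth_sum _ _ _ _ _ (fun i x => x 0 i * x 0 i)) => i _.
by apply: smoothM; exact: smooth_coord.
Qed.

Lemma sqnormZ (a : R) x : sqnorm (a *: x) = a ^+ 2 * sqnorm x.
Proof. by rewrite mulr_sumr; apply: eq_bigr => i _; rewrite !mxE; ring. Qed.

Lemma sqnorm_ge0 x : 0 <= sqnorm x.
Proof. by rewrite sumr_ge0// => i _; rewrite -expr2 sqr_ge0. Qed.

Lemma norm_sqr_le_sqnorm x : `|x| ^+ 2 <= sqnorm x.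
Proof.
have [->|[i ->]] := norm_exists_coord x; first by rewrite expr0n/= sqnorm_ge0.
rewrite real_normK ?num_real// /sqnorm (bigD1 i)//= expr2 lerDl sumr_ge0// => j _.
by rewrite -expr2 sqr_ge0.
Qed.

Lemma sqnorm_le_norm_sqr x : sqnorm x <= d%:R * `|x| ^+ 2.
Proof.
rewrite -[d in d%:R]card_ord -sumr_const mulr_suml ler_sum// => i _.
rewrite mul1r -expr2 -real_normK ?num_real// lerXn2r ?nnegrE//.
exact: ler_coord_norm.
Qed.

(** The quotient [a / (a + b)], with [a] positive where [sqnorm x < 2] and [b] positive where
    [sqnorm x > 1], so that the denominator never vanishes. *)
Lemma exists_cutoff : exists chi : V -> R[i], [/\ schwartz chi,
  (forall x, sqnorm x <= 1 -> chi x = 1) & (forall x, 2 <= sqnorm x -> chi x = 0)].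
Proof.
pose a x := flat 0 (2 - sqnorm x); pose b x := flat 0 (sqnorm x - 1).
have sa : smooth a.
  apply: (smooth_flat 0 (q := fun x => 2 - sqnorm x)).
  by apply: smoothD; [exact: smooth_cst|apply: smoothN; exact: smooth_sqnorm].
have sb : smooth b.
  apply: (smooth_flat 0 (q := fun x => sqnorm x - 1)).
  by apply: smoothD; [exact: smooth_sqnorm|exact: smooth_cst].
have ab x : 0 < a x + b x.
  have [q2|q2] := ltP (sqnorm x) 2.
    by rewrite ltr_wpDr ?flat_ge0// flat_gt0// subr_gt0.
  rewrite ltr_wpDl ?flat_ge0// flat_gt0// subr_gt0 (lt_le_trans _ q2)//.
  by rewrite -[2]/(1 + 1) ltrDl.
pose c x := a x * (a x + b x)^-1.
have sc : smooth c.
  apply: smoothM sa (smoothV _ (smoothD sa sb)) => x; by rewrite gt_eqF.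
have c0 x : 2 <= sqnorm x -> c x = 0.
  by move=> q2; rewrite /c /a flat_le0 ?mul0r// subr_le0.
exists (fun x => (c x)%:C); split.
- apply: (@schwartz_compact_support _ _ _ 2); first exact: csmooth_real.
  move=> x x2; rewrite c0//; apply: le_trans (norm_sqr_le_sqnorm x).
  by move: x2; move: `|x| => r; nra.
- move=> x q1; rewrite /c; have b0 : b x = 0 by rewrite /b flat_le0// subr_le0.
  by rewrite b0 addr0 divff// gt_eqF//; have := ab x; rewrite b0 addr0.
- by move=> x /c0 ->.
Qed.

Lemma iter_cpartial_cat s1 s2 f : iter_cpartial s1 (iter_cpartial s2 f) = iter_cpartial (s1 ++ s2) f.
Proof. by elim: s1 => [|i s1 IH] /=; rewrite ?iter_cpartial_nil// !iter_cpartial_cons IH. Qed.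

(** By induction the first partials are O(|x|^n), and the mean value bound on the box from 0 to [x],
    where |z| <= |x|, gains one power. *)
Lemma taylor_bound n f : schwartz f ->
  (forall s, (size s < n)%N -> iter_cpartial s f 0 = 0) ->
  exists2 C : R, 0 <= C & forall x, normc (f x) <= C * `|x| ^+ n.
Proof.
elim: n f => [|n IH] f Sf f0.
  have [b fb] := schwartz_sb 0 Sf; exists b; first exact: sb_ge0 fb.
  by move=> x; have := sb_sup (s := [::]) x fb isT; rewrite iter_cpartial_nil mulr1.
have /choice[C HC] : forall i, exists C : R, 0 <= C /\ forall x, normc (cpart i f x) <= C * `|x| ^+ n.
  move=> i; have [|C C0 H] := IH _ (schwartz_cpart i Sf); last by exists C.
  by move=> s sn; rewrite -iter_cpartial_rcons f0// size_rcons.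
pose D := \sum_i C i; have D0 : 0 <= D by rewrite sumr_ge0// => i _; case: (HC i).
exists (2 * (d%:R * D)); first by rewrite !mulr_ge0.
move=> x; have f00 : f 0 = 0 by have := f0 [::] isT; rewrite iter_cpartial_nil.
rewrite -[f x]subr0 -f00.
have -> : 2 * (d%:R * D) * `|x| ^+ n.+1 = 2 * (d%:R * (D * `|x| ^+ n) * `|x - 0|).
  by rewrite subr0 exprS; ring.
apply: csmooth_mvt; first exact: schwartz_csmooth.
  by rewrite mulr_ge0 ?exprn_ge0.
move=> i z Hz; have [Ci0 H] := HC i.
apply: (le_trans (H z)); apply: ler_pM; rewrite ?exprn_ge0//.
  by rewrite /D (bigD1 i)//= lerDl sumr_ge0// => j _; case: (HC j).
rewrite lerXn2r ?nnegrE//; apply: norm_le_coord => // j.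
have := Hz j; have := ler_coord_norm x j; rewrite mxE !ler_norml ge_min le_max.
by move: `|x| (x 0 j) (z 0 j) => u v w; lra.
Qed.

Lemma iter_cpartial_dilate s f (a : R) x : csmooth f ->
  iter_cpartial s (fun y => f (a *: y)) x = (a ^+ size s)%:C * iter_cpartial s f (a *: x).
Proof.
move=> sf; have := iter_cpartial_affine a 0 s sf.
by under eq_fun do rewrite addr0; move=> ->; rewrite addr0.
Qed.

Lemma csmooth_dilate f (a : R) : csmooth f -> csmooth (fun y => f (a *: y)).
Proof. by move=> sf; have := csmooth_affine a 0 sf; under eq_fun do rewrite addr0. Qed.

(* [h] is approximated by its product with the cutoff
   [chi (l x) (1 - chi (x / l))], which vanishes near 0 and near infinity. *)
Lemma annulus_approx m h : schwartz h ->
  (forall s, (size s < m.*2.+1)%N -> iter_cpartial s h 0 = 0) ->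
  forall e : R, 0 < e -> exists g (r r' : R), [/\ schwartz g, 0 < r,
    (forall x, g x != 0 -> r <= sqnorm x <= r') & sb m (fun x => h x - g x) e].
Proof.
move=> Sh h0 e e0; have sh := schwartz_csmooth Sh.
have [chi [Schi chi1 chi2]] := exists_cutoff; have schi := schwartz_csmooth Schi.
have [A chiA] := schwartz_sb m Schi; have A0 := sb_ge0 chiA.
(* The surplus decay of order [m.+1] becomes a factor [l ^+ m.+1] where |x| is at least of order
   [1 / l]. *)
have [b hb] := schwartz_sb (m + m.+1) Sh; have b0 := sb_ge0 hb.
(* Of the [m.*2.+1] orders of vanishing at 0, at most [m] are spent on the derivative, and [m.+1]
   remain. *)
have [C C0 hC] : exists2 C : R, 0 <= C & forall s, (size s <= m)%N -> forall x, `|x| <= 1 ->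
    normc (iter_cpartial s h x) <= C * `|x| ^+ m.+1.
  have [||C C0 HC] := @uniform_bound R 'I_d m (fun s (C : R) => (size s <= m)%N -> forall x, `|x| <= 1 ->
    normc (iter_cpartial s h x) <= C * `|x| ^+ m.+1); last by exists C => // s sm; exact: HC.
    move=> s C C' CC H sm x x1; apply: (le_trans (H sm x x1)).
    by rewrite ler_wpM2r// exprn_ge0.
  move=> s; have [sm|sm] := leqP (size s) m; last by exists 0.
  have [|C C0 H] := @taylor_bound m.+1 _ (schwartz_iter_cpartial s Sh).
    by move=> s' s'm; rewrite iter_cpartial_cat h0// size_cat ltnS -addnn leq_add.
  by exists C => _ x _; exact: H.
(* [K * l^-1 ^+ m] will bound the derivatives of [ka]. In [M] it meets the constant of [hU], whose
   factor [l ^+ m.+1] leaves one power of [l] in the final error. *)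
pose K := 1 + 2 ^+ m * (A * (1 + A)).
have K0 : 0 <= K by rewrite addr_ge0 ?mulr_ge0 ?exprn_ge0 ?addr_ge0.
pose M := 2 ^+ m * ((b * (d.+1%:R) ^+ m.+1 + C * 2 ^+ m.+1 * 2 ^+ m) * K).
have M0 : 0 <= M.
  by rewrite mulr_ge0 ?exprn_ge0// mulr_ge0// addr_ge0// !mulr_ge0 ?exprn_ge0.
(* The bound [1 / 2] keeps the inner region [|x| <= 2 * l] within the unit ball; [M + 1] avoids
   dividing by 0. *)
pose l : R := Num.min (1 / 2) (e / (M + 1)).
have l0 : 0 < l by rewrite lt_min divr_gt0//= divr_gt0// ltr_wpDl.
have ln0 : l != 0 by rewrite gt_eqF.
have l2 : l <= 1 / 2 by rewrite ge_min lexx.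
have l1 : l <= 1 by lra.
have lM : M * l <= e.
  have : l <= e / (M + 1) by rewrite ge_min lexx orbT.
  rewrite ler_pdivlMr ?ltr_wpDl// => H; apply: le_trans H.
  by rewrite mulrC ler_wpM2l ?(ltW l0)// lerDl.
have lV : 1 <= l^-1 by rewrite invf_ge1.
pose al x := chi (l *: x); pose be x := 1 - chi (l^-1 *: x).
have sal : csmooth al := csmooth_dilate l schi.
have sbe : csmooth be.
  have := csmoothD (csmooth_cst d 1) (csmoothM (csmooth_cst d (-1)) (csmooth_dilate l^-1 schi)).
  by under eq_fun do rewrite mulN1r.
pose ka x := 1 + (-1) * (al x * be x).
have ska : csmooth ka := csmoothD (csmooth_cst d 1) (csmoothM (csmooth_cst d (-1)) (csmoothM sal sbe)).
have one1 s x : normc (iter_cpartial s (fun _ : V => 1 : R[i]) x) <= 1.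
  have [->|s0] := eqVneq s [::].
    by rewrite iter_cpartial_nil -[1]/(1%:C) normc_real normr1.
  by rewrite iter_cpartial_cst// normc0.
have alA s x : (size s <= m)%N -> normc (iter_cpartial s al x) <= A.
  move=> sm; rewrite (iter_cpartial_dilate s l x schi) normcM normc_real normrX gtr0_norm//.
  rewrite -[A]mul1r ler_pM ?exprn_ge0 ?normc_ge0 ?(ltW l0)//; first by rewrite exprn_ile1// ltW.
  exact: sb_sup chiA sm.
have beA s x : (size s <= m)%N -> normc (iter_cpartial s be x) <= (1 + A) * l^-1 ^+ m.
  move=> sm; rewrite (iter_cpartialB s (csmooth_cst d 1) (csmooth_dilate l^-1 schi)).
  apply: (le_trans (normcD _ _)); rewrite normcN mulrDl mul1r lerD//.
    by apply: (le_trans (one1 s x)); rewrite exprn_ege1.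
  rewrite (iter_cpartial_dilate s l^-1 x schi) normcM normc_real normrX gtr0_norm ?invr_gt0//.
  rewrite mulrC ler_pM ?exprn_ge0 ?normc_ge0 ?invr_ge0 ?(ltW l0)//; first exact: sb_sup chiA sm.
  by rewrite ler_weXn2l.
have kaK s x : (size s <= m)%N -> normc (iter_cpartial s ka x) <= K * l^-1 ^+ m.
  move=> sm; rewrite (iter_cpartialD s (csmooth_cst d 1) (csmoothM (csmooth_cst d (-1)) (csmoothM sal sbe))).
  apply: (le_trans (normcD _ _)); rewrite mulrDl mul1r lerD//.
    by apply: (le_trans (one1 s x)); rewrite exprn_ege1.
  rewrite (iter_cpartialZ s (-1) (csmoothM sal sbe)) mulN1r normcN.
  rewrite -mulrA -mulrA; apply: (iter_cpartialM_le sal sbe) sm => s' s'm; first exact: alA.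
  exact: beA.
(* On this open set the cutoff is identically 1, so [h - g] and all its derivatives vanish there. *)
pose U := [set x : V | sqnorm (l *: x) < 1] `&` [set x : V | 2 < sqnorm (l^-1 *: x)].
have oU : open U.
  have cq a : continuous (fun x => sqnorm (a *: x)).
    have := @continuous_affine _ _ _ a 0 (smooth_cont smooth_sqnorm).
    by under eq_fun do rewrite addr0.
  apply: openI.
    by apply: (@open_comp _ _ (fun x => sqnorm (l *: x)) [set r | r < 1]); [move=> x _; exact: cq|exact: open_lt].
  by apply: (@open_comp _ _ (fun x => sqnorm (l^-1 *: x)) [set r | 2 < r]); [move=> x _; exact: cq|exact: open_gt].
have ka0 x : U x -> ka x = 0.
  move=> [/= h1 h2]; rewrite /ka /al /be chi1 ?(ltW h1)// chi2 ?(ltW h2)//.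
  by rewrite subr0 mulr1 mulr1 subrr.
(* Off [U] either 1 <= (d+1) l |x|, and decay is used, or |x| <= 2 l, and flatness at 0 is used. The
   factor [d.+1] compares the Euclidean norm with the sup norm without a square root. *)
have hU s x : (size s <= m)%N -> ~ U x -> normc (iter_cpartial s h x) <=
    (b * d.+1%:R ^+ m.+1 + C * 2 ^+ m.+1 * 2 ^+ m) * l ^+ m.+1 / (1 + `|x|) ^+ m.
  move=> sm /not_andP nU; rewrite mulrDl mulrDl.
  have p1 : 0 <= b * d.+1%:R ^+ m.+1 * l ^+ m.+1 / (1 + `|x|) ^+ m.
    by rewrite divr_ge0 ?wt_pow_ge0// !mulr_ge0 ?exprn_ge0 ?(ltW l0).
  have p2 : 0 <= C * 2 ^+ m.+1 * 2 ^+ m * l ^+ m.+1 / (1 + `|x|) ^+ m.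
    by rewrite divr_ge0 ?wt_pow_ge0// !mulr_ge0 ?exprn_ge0 ?(ltW l0).
  case: nU => /= /negP; rewrite -leNgt sqnormZ => qx.
    apply: (le_trans (sb_at x hb (leq_trans sm (leq_addr _ _)))).
    rewrite -[leLHS]addr0 lerD// exprD invfM [(_ ^+ m)^-1 * _]mulrC mulrA ler_wpM2r ?invr_ge0 ?wt_pow_ge0//.
    rewrite -mulrA ler_wpM2l// -exprMn -exprVn lerXn2r ?nnegrE ?invr_ge0 ?mulr_ge0 ?wt_ge0 ?(ltW l0)//.
    rewrite -div1r ler_pdivrMr ?wt_gt0//.
    have h1 : 1 <= l ^+ 2 * (d%:R * `|x| ^+ 2).
      by apply: (le_trans qx); rewrite ler_wpM2l ?sqr_ge0// sqnorm_le_norm_sqr.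
    have h2 : 1 <= (d.+1%:R * l * `|x|) ^+ 2.
      apply: (le_trans h1); rewrite !exprMn mulrCA mulrA ler_wpM2r ?sqr_ge0// ler_wpM2r ?sqr_ge0//.
      by rewrite -natrX ler_nat -mulnn (leq_trans (leqnSn d))// leq_pmulr.
    have h3 : 1 <= d.+1%:R * l * `|x|.
      by rewrite -(@expr_ge1 _ 2)// !mulr_ge0// ltW.
    by apply: (le_trans h3); rewrite ler_wpM2l ?lerDr ?mulr_ge0 ?(ltW l0).
  have xl : `|x| <= 2 * l.
    have : `|x| ^+ 2 <= (2 * l) ^+ 2.
      apply: (le_trans (norm_sqr_le_sqnorm x)).
      have : sqnorm x <= 2 * l ^+ 2.
        by rewrite -ler_pdivrMr ?exprn_gt0// mulrC -exprVn.
      have := sqr_ge0 l; rewrite exprMn; nra.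
    by rewrite ler_pXn2r ?nnegrE ?mulr_ge0 ?(ltW l0).
  have x1 : `|x| <= 1 by lra.
  apply: (le_trans (hC s sm x x1)); rewrite -[leLHS]add0r lerD//.
  rewrite ler_pdivlMr ?exprn_gt0 ?wt_gt0//.
  have -> : C * 2 ^+ m.+1 * 2 ^+ m * l ^+ m.+1 = C * (2 * l) ^+ m.+1 * 2 ^+ m.
    by rewrite exprMn; ring.
  rewrite ler_pM ?mulr_ge0 ?exprn_ge0 ?wt_ge0//.
    by rewrite ler_wpM2l// lerXn2r ?nnegrE ?mulr_ge0 ?(ltW l0).
  by rewrite lerXn2r ?nnegrE ?wt_ge0//; lra.
pose g x := be x * (al x * h x).
have sg : csmooth g := csmoothM sbe (csmoothM sal sh).
have gsupp x : g x != 0 -> l ^+ 2 <= sqnorm x <= 2 * l^-1 ^+ 2.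
  move=> gx; apply/andP; split; rewrite leNgt; apply/negP => q.
    move: gx; rewrite /g /be chi1 ?subrr ?mul0r ?eqxx//.
    by rewrite sqnormZ mulrC exprVn ler_pdivrMr ?exprn_gt0// mul1r ltW.
  move: gx; rewrite /g /al chi2 ?mul0r ?mulr0 ?eqxx//.
  by rewrite sqnormZ mulrC -ler_pdivrMr ?exprn_gt0// -exprVn ltW.
exists g, (l ^+ 2), (2 * l^-1 ^+ 2); split=> //.
- apply: (@schwartz_compact_support _ _ _ (1 + 2 * l^-1 ^+ 2)) => // x xb.
  apply/eqP; apply: contraPT isT => /gsupp/andP[_ qx].
  have := le_trans (norm_sqr_le_sqnorm x) qx; have : 0 <= 2 * l^-1 ^+ 2 by rewrite mulr_ge0 ?sqr_ge0.
  by move: xb; move: (2 * l^-1 ^+ 2) `|x| => u v; nra.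
- by rewrite exprn_gt0.
have -> : (fun x => h x - g x) = fun x => h x * ka x.
  by apply/funext => x; rewrite /g /ka; ring.
move=> s x sm.
have [Ux|nU] := pselect (U x).
  rewrite (_ : iter_cpartial s _ x = 0) ?normc0 ?mulr0 ?ltW//.
  by apply: (iter_cpartial_eq0 s oU) Ux => y Uy; rewrite ka0// mulr0.
have := iter_cpartialM_le sh ska (fun s sm => hU s x sm nU) (fun s sm => kaK s x sm) sm.
move=> /(ler_wpM2l (wt_pow_ge0 x m))/le_trans; apply; apply: le_trans lM.
rewrite le_eqVlt; apply/orP; left; apply/eqP; rewrite /M.
have w0 : (1 + `|x|) ^+ m != 0 by rewrite expf_neq0// gt_eqF// wt_gt0.
have lm0 : l ^+ m != 0 by rewrite expf_neq0.
rewrite [l ^+ m.+1]exprSr exprVn; move: w0 lm0.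
move: ((1 + `|x|) ^+ m) (l ^+ m) (b * _ + _) => u v w u0 v0.
by field; rewrite u0 v0.
Qed.

End cutoff.

(** * Localization on the Fourier side *)

Section main.
Variables (R : realType) (d : nat).
Local Notation V := ('rV[R]_d).
Implicit Types (f g h psi : V -> R[i]) (T : (V -> R[i]) -> R[i]).

Lemma fourier_sum (I : Type) (r : seq I) (h : I -> V -> R[i]) w : (forall i, schwartz (h i)) ->
  fourier (fun x => \sum_(i <- r) h i x) w = \sum_(i <- r) fourier (h i) w.
Proof.
move=> Sh; under [RHS]eq_bigr do rewrite fourierE.
rewrite fourierE -cintegral_sum => [|i].
  by congr cintegral; apply/funext => x; rewrite mulr_suml.
by have [C hC] := schwartz_cdom (Sh i); exists C; exact: cdom_wave.
Qed.

Lemma fourierB f g w : schwartz f -> schwartz g ->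
  fourier (fun x => f x - g x) w = fourier f w - fourier g w.
Proof.
move=> /schwartz_cdom[C /(cdom_wave w) fC] /schwartz_cdom[C' /(cdom_wave w) gC].
rewrite !fourierE -mulN1r -(cintegralZ _ gC) -(cintegralD fC (cdomZ (-1) gC)).
by congr cintegral; apply/funext => x; ring.
Qed.

(* On the annulus the [u i], the Fourier transforms of the reflected [k i], have
   no common zero, so [g = \sum_i u i * theta i] with [theta i] Schwartz. *)
Lemma annulus_vanish T (I : choiceType) (k : I -> V -> R[i]) g (r r' : R) :
  tempered_distribution T -> (forall i, schwartz (k i)) ->
  (forall i t, T (fun x => k i (x - t)) = 0) ->
  (forall x, x != 0 -> exists i, fourier (fun y => k i (- y)) x != 0) ->
  schwartz g -> 0 < r -> (forall x, g x != 0 -> r <= sqnorm x <= r') -> T (fourier g) = 0.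
Proof.
move=> TT Sk Tk cov Sg r0 gK.
pose u i : V -> R[i] := fourier (fun y => k i (- y)).
have Su i : schwartz (u i) := schwartz_fourier (schwartz_opp (Sk i)).
pose K := [set x : V | r <= sqnorm x <= r'].
have cq : continuous (@sqnorm R d) := smooth_cont (@smooth_sqnorm R d).
have cK : compact K.
  apply: bounded_closed_compact.
    exists (1 + r'); split; [exact: num_real|move=> y Ny z/= /andP[_ zr]; apply/ltW; apply: lt_trans Ny].
    have := le_trans (norm_sqr_le_sqnorm z) zr.
    by have := normr_ge0 z; move: `|z| => v; nra.
  rewrite (_ : K = [set x | r <= sqnorm x] `&` [set x | sqnorm x <= r']).
    apply: closedI.
      by apply: (@closed_comp _ _ (fun x : V => sqnorm x) [set t | r <= t]);
        [move=> x _; exact: cq|exact: closed_ge].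
    by apply: (@closed_comp _ _ (fun x : V => sqnorm x) [set t | t <= r']);
      [move=> x _; exact: cq|exact: closed_le].
  by apply/seteqP; split => x /= /andP.
have [D _ Dcov] : finite_subset_cover setT (fun i => [set x | 0 < normc (u i x)]) K.
  move: cK; rewrite compact_cover; apply.
    have cu i : continuous (fun x : V => normc (u i x)).
      exact: csmooth_continuous_normc (schwartz_csmooth (Su i)).
    move=> i _; apply: (@open_comp _ _ (fun x : V => normc (u i x)) [set t | 0 < t]).
      by move=> x _; exact: cu.
    exact: open_gt.
  move=> x /andP[rx _]; have [|i ui] := cov x.
    apply: contraTneq rx => ->; rewrite -ltNge (le_lt_trans _ r0)//.
    by rewrite (le_trans (sqnorm_le_norm_sqr _))// normr0 expr0n/= mulr0.
  by exists i => //; change (0 < normc (u i x)); rewrite lt_neqAle normc_ge0 andbT eq_sym normc_eq0.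
pose s : seq I := finmap.enum_fset D.
pose q i x : R := complex.Re (u i x) * complex.Re (u i x) + complex.Im (u i x) * complex.Im (u i x).
have q0 i x : 0 <= q i x by rewrite addr_ge0// -expr2 sqr_ge0.
(* The sum of squared moduli is positive only near the annulus. The flat terms vanish on the annulus
   and make [v] positive everywhere else, so [1 / v] is smooth on the whole space. *)
pose v x := \sum_(i <- s) q i x + (flat 0 (r - sqnorm x) + flat 0 (sqnorm x - r')).
have sv : smooth v.
  have sq i : smooth (q i).
    have su := schwartz_csmooth (Su i).
    exact: smoothD (smoothM (csmooth_Re su) (csmooth_Re su)) (smoothM (csmooth_Im su) (csmooth_Im su)).
  have s1 := smooth_flat 0 (smoothD (@smooth_cst R d r) (smoothN (@smooth_sqnorm R d))).
  have s2 := smooth_flat 0 (smoothD (@smooth_sqnorm R d) (@smooth_cst R d (- r'))).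
  have s3 : smooth (fun x => \sum_(i <- s) q i x) by apply: smooth_sum => i _; exact: sq.
  exact: smoothD s3 (smoothD s1 s2).
have v0 x : 0 < v x.
  have [rx|rx] := ltP (sqnorm x) r.
    by rewrite ltr_wpDl ?sumr_ge0// ltr_wpDr ?flat_ge0// flat_gt0// subr_gt0.
  have [rx'|rx'] := ltP r' (sqnorm x).
    by rewrite ltr_wpDl ?sumr_ge0// ltr_wpDl ?flat_ge0// flat_gt0// subr_gt0.
  rewrite ltr_wpDr ?addr_ge0 ?flat_ge0//.
  have [|i iD] := Dcov x; first by rewrite /K /= rx.
  move=> uix; rewrite (perm_big _ (perm_to_rem iD))/= big_cons ltr_wpDr ?sumr_ge0//.
  rewrite lt_neqAle q0 andbT eq_sym; apply: contraTneq uix => qi.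
  rewrite /mkset -leNgt le_eqVlt; apply/orP; left.
  by move: qi; rewrite /q; case: (u i x) => a b /= qi; rewrite !expr2 qi sqrtr0.
have vK x : K x -> v x = \sum_(i <- s) q i x.
  by move=> /andP[rx rx']; rewrite /v !flat_le0 ?subr_le0// !addr0.
(* Multiplying by [u i] and summing gives the sum of |u_i|^2 over [v], times [g]; this ratio is 1 on
   the support of [g]. *)
pose theta i x := conjc (u i x) * ((v x)^-1%:C * g x).
have Sth i : schwartz (theta i).
  apply: (@schwartz_compact_support _ _ _ (1 + r')).
    apply: csmoothM; first exact: csmoothJ (schwartz_csmooth (Su i)).
    apply: csmoothM; last exact: schwartz_csmooth Sg.
    by apply: csmooth_real; apply: smoothV sv => x; rewrite gt_eqF.
  move=> x xr; rewrite /theta (_ : g x = 0) ?mulr0//.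
  apply/eqP; apply: contraPT isT => /gK/andP[_ qx].
  have := le_trans (norm_sqr_le_sqnorm x) qx.
  by have := normr_ge0 x; move: xr; move: `|x| => t; nra.
have gE : g = fun x => \sum_(i <- s) u i x * theta i x.
  apply/funext => x; have [gx|gx] := eqVneq (g x) 0.
    by rewrite gx big1// => i _; rewrite /theta gx !mulr0.
  rewrite /theta; under eq_bigr do rewrite mulrA.
  rewrite -mulr_suml; have -> : \sum_(i <- s) u i x * conjc (u i x) = (v x)%:C.
    rewrite vK; last exact: gK.
    rewrite rmorph_sum; apply: eq_bigr => i _; rewrite /q; case: (u i x) => a b /=.
    by apply: eq_ReIm => /=; ring.
  by rewrite mulrA -rmorphM divff ?rmorph1 ?mul1r// gt_eqF.
have Sut i : schwartz (fun x => u i x * theta i x) := schwartzM (Sth i) (Su i).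
have -> : fourier g = fun w => \sum_(i <- s) 1 * fourier (fun x => u i x * theta i x) w.
  rewrite gE; apply/funext => w; rewrite (fourier_sum _ _ Sut).
  by apply: eq_bigr => i _; rewrite mul1r.
rewrite (schwartz_linear_sum _ _ TT.1 (fun i => schwartz_fourier (Sut i))).
rewrite big1// => i _; rewrite mul1r.
exact: tempered_conv0 TT (Sk i) (Sth i) (Tk i).
Qed.

(** The order [m] of [T] fixes the order [m'] needed before the Fourier transform, and approximation
    on annuli in order [m'] asks for [m'.*2.+1] vanishing orders. *)
Lemma flat_vanish T (I : choiceType) (k : I -> V -> R[i]) :
  tempered_distribution T -> (forall i, schwartz (k i)) ->
  (forall i t, T (fun x => k i (x - t)) = 0) ->
  (forall x, x != 0 -> exists i, fourier (fun y => k i (- y)) x != 0) ->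
  exists n, forall h, schwartz h ->
    (forall s, (size s < n)%N -> iter_cpartial s h 0 = 0) -> T (fourier h) = 0.
Proof.
move=> TT Sk Tk cov; have [m Hm] := tempered_approx0 TT.
have [m' [C [C0 HC]]] := @fourier_sb R d m.
exists m'.*2.+1 => h Sh h0; apply: (Hm _ (schwartz_fourier Sh)) => e e0.
have [g [r [r' [Sg r0 gr hg]]]] := annulus_approx Sh h0 (divr_gt0 e0 (ltr_wpDr C0 ltr01)).
exists (fourier g); split; first exact: schwartz_fourier.
  exact: annulus_vanish TT Sk Tk cov Sg r0 gr.
have Shg : schwartz (fun x => h x - g x).
  by have := schwartzD Sh (schwartzZ (-1) Sg); under eq_fun do rewrite mulN1r.
have := HC _ _ Shg hg.
rewrite (_ : fourier _ = fun w => fourier h w - fourier g w); last first.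
  by apply/funext => w; exact: fourierB.
by apply: sb_le => //; rewrite mulrCA ger_pMr// ler_pdivrMr ?ltr_wpDr// mul1r lerDr.
Qed.

(** A set of positive measure is nonempty. Writing scales as exponentials indexes the dilates by all
    of [R] with no positivity condition. *)
Lemma nontrivial_expR g x : nontrivial_in_every_direction g -> x != 0 ->
  exists a : R, g (expR a *: x) != 0.
Proof.
move=> ntg x0; pose n := Num.sqrt (sqnorm x).
have n0 : 0 < n.
  rewrite sqrtr_gt0; apply: lt_le_trans (norm_sqr_le_sqnorm x).
  by rewrite exprn_gt0// normr_gt0.
have [[r [r0 gr]]|/nonemptyPn E] := pselect ([set r : R | 0 < r /\ g (r *: (n^-1 *: x)) != 0] !=set0).
- exists (ln (r / n)); rewrite lnK ?posrE ?divr_gt0//.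
  by rewrite -scalerA.
have := ntg (n^-1 *: x); rewrite /nontrivial_in_direction E measure0 ltxx => H.
suff /H : dot (n^-1 *: x) (n^-1 *: x) = 1 by [].
rewrite -[LHS]/(sqnorm _) sqnormZ exprVn sqr_sqrtr ?sqnorm_ge0// mulVf//.
by rewrite gt_eqF// -sqrtr_gt0.
Qed.

End main.

Theorem theorem4 (R : realType) (d : nat) (d_ge1 : (1 <= d)%N)
    (f : ('rV[R]_d -> R[i]) -> R[i]) (psi : 'rV[R]_d -> R[i])
    (f_tempered : tempered_distribution f) (psi_schwartz : schwartz psi)
    (f_ortho : forall (s : R) (t : 'rV[R]_d), 0 < s ->
       pairing f (dilate_translate psi s t) = 0)
    (psi_nontrivial : nontrivial_in_every_direction (fourier psi)) :
  is_polynomial f.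
Proof.
have [C pC] := schwartz_cdom psi_schwartz.
pose k (a : R) (x : 'rV[R]_d) := conjc (psi (expR a *: x)).
have Spa a : schwartz (fun x => psi (expR a *: x)).
  have := @schwartz_affine R d psi (expR a) 0 _ psi_schwartz; rewrite gt_eqF ?expR_gt0// => /(_ isT).
  by under eq_fun do rewrite addr0.
have Sk a : schwartz (k a) := schwartzJ (Spa a).
have fk a t : f (fun x => k a (x - t)) = 0.
  (* The dilate by [expR a] corresponds to the scale [s = expR (- a)]; the normalizing power of [s]
     is nonzero and cancels. *)
  have := f_ortho (expR (- a)) t (expR_gt0 _); rewrite /pairing /dilate_translate.
  set c := _ `^ _ => H.
  have : f (fun x => c%:C * k a (x - t)) = 0.
    rewrite -[RHS]H; congr f; apply/funext => x.
    by rewrite rmorphM -expRN opprK; congr (_ * _); rewrite /= oppr0.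
  rewrite (schwartz_linearZ _ f_tempered.1 (schwartz_translate t (Sk a))) => /eqP.
  by rewrite mulf_eq0 (inj_eq (@complexI _)) gt_eqF ?powR_gt0 ?expR_gt0//= => /eqP.
have cov x : x != 0 -> exists a, fourier (fun y => k a (- y)) x != 0.
  (* Dilation by [expR (- a)] before the transform is dilation by [expR a] after it; reflection and
     conjugation together only conjugate the value. *)
  move=> /(nontrivial_expR psi_nontrivial)[a pa]; exists (- a).
  have [C1 oC] := schwartz_cdom (schwartz_opp (Spa (- a))).
  have [C2 aC] := schwartz_cdom (Spa (- a)).
  rewrite (fourierJ x oC) (fourier_opp _ aC) opprK fmorph_eq0.
  have := fourier_affine 0 x (expR_gt0 (- a)) pC.
  under [X in fourier X]eq_fun do rewrite addr0.
  move=> ->; rewrite scaler0 oppr0 waveC wave0 mul1r -expRN opprK mulf_neq0//.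
  by rewrite (inj_eq (@complexI _)) expf_neq0// gt_eqF// expR_gt0.
have [n Hn] := flat_vanish f_tempered Sk fk cov.
have [chi [Schi chi1 _]] := exists_cutoff R d.
have chi0 : chi 0 != 0.
  by rewrite chi1 ?oner_neq0// (le_trans (sqnorm_le_norm_sqr _))// normr0 expr0n/= mulr0.
(* Any Schwartz function nonzero at 0 gives the inversion formula; the cutoff is one. *)
have FF := fourier_fourier Schi chi0; set c := _ / _ in FF.
have c0 : c != 0.
  (* A basis vector supplies a direction, hence a point where [fourier psi] is nonzero. *)
  have e0 : dir R (Ordinal d_ge1) != 0 :> 'rV[R]_d.
    by apply/eqP => /matrixP/(_ 0 (Ordinal d_ge1)) /eqP; rewrite !mxE !eqxx oner_eq0.
  have [a pa] := nontrivial_expR psi_nontrivial e0.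
  exact: fourier_fourier_neq0 psi_schwartz pa FF.
apply: (@moments_polynomial _ _ f (seqs_upto 'I_d n) f_tempered.1) => eta Se eta0.
have SFe := schwartz_fourier Se; have [D eD] := schwartz_cdom SFe.
have Sh := schwartz_opp SFe.
(* The derivatives of [fourier eta] at 0 are the moments of [eta], here all zero, so the reflected
   transform is flat at 0. Its own transform is [c * eta]. *)
have : f (fourier (fun w => fourier eta (- w))) = 0.
  apply: (Hn _ Sh) => s sn.
  have := iter_cpartial_affine (-1) 0 s (schwartz_csmooth SFe).
  under eq_fun do rewrite scaleN1r addr0.
  move=> ->; rewrite scaler0 addr0 iter_cpartial_fourier// fourierE.
  under [X in cintegral X]eq_fun do rewrite wave0 mulr1.
  by rewrite eta0 ?mulr0// mem_seqs_upto// ltnW.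
have -> : fourier (fun w => fourier eta (- w)) = fun x => c * eta x.
  by apply/funext => x; rewrite (fourier_opp x eD) FF// opprK.
by rewrite (schwartz_linearZ _ f_tempered.1 Se) => /eqP; rewrite mulf_eq0 (negbTE c0) => /eqP.
Qed.
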